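(* Let $\mu \in \mathscr{W}(\mathbb{R}^n)$ with distribution function $f$. Write $x \in \mathbb{R}^n$ as $x = (x', x_n) \in \mathbb{R}^{n-1}\times \mathbb{R}$. Suppose that for every $c\in\mathbb{R}$ the set $H(\vec{e_n}, c) =\{x \in \mathbb{R}^n: x_n \ge c\}$ is minimal for $\mu$-perimeter among all measurable sets $F$ with $\mu(F)=\mu(H(\vec{e_n}, c))$. Then the following statements hold. (1) There exists a disjoint collection of open intervals $\{I_j\}_{j\in \mathbb{N}}$ such that for $\mathcal{H}^{n-1}$-a.e. $x' \in \mathbb{R}^{n-1}$, the positivity set satisfies $\{f(x', \cdot)>0\} = \bigcup_{j \in A}I_j$ for some index set $A \subset \mathbb{N}$ depending on $x'$. (2) For each $I_k \in \{I_j \}_{j\in \mathbb{N}}$, there exist functions $A_k: \mathbb{R}^{n-1}\rightarrow \mathbb{R}$, $B_k:I_k\rightarrow \mathbb{R}$ such that for $\mathcal{H}^{n}$-a.e. $(x', x_n) \in \mathbb{R}^{n-1}\times I_k$, $$f(x',x_n) = A_k(x')B_k(x_n).$$ (3) For every $I_k \in \{I_j \}_{j\in \mathbb{N}}$, we have $B_k \in W^{1, 1}_{\mathrm{loc}}(I_k) \subset C(I_k)$ and $B_k>0$ on $I_k$.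
   Context: $\mathscr{W}(\mathbb{R}^n)$ is the class of measures $\mu=f\mathcal{L}^n$ whose distribution function (density) $f$ is non-negative and in $L^1(\mathbb{R}^n)\cap W^{1,1}_{\mathrm{loc}}(\mathbb{R}^n)$; $f$ is always taken to be its precise representative (the limit as $r\to0$ of its averages over $B_r(x)$ where this limit exists, $0$ elsewhere). Weighted perimeter: for measurable $E\subset\mathbb{R}^n$, $$\operatorname{Per}_\mu(E)=\sup\left\{\int_{\mathbb{R}^n}\chi_E\big(\operatorname{div}(\phi)f+\phi\cdot\nabla f\big)\,dx:\ \phi\in C^1_c(\mathbb{R}^n;\mathbb{R}^n),\ \|\phi\|_\infty\le 1\right\}\in[0,\infty].$$ A set $H$ is minimal for $\mu$-perimeter among a class of sets if $\operatorname{Per}_\mu(H)\le\operatorname{Per}_\mu(F)$ for every $F$ in the class. $\vec{e_n}$ is the $n$-th standard basis vector. *)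

(* Defs.v *)
From HB Require Import structures.
From mathcomp Require Import all_boot all_order all_algebra.
From mathcomp Require Import all_classical all_reals all_analysis.

Set Implicit Arguments.
Unset Strict Implicit.
Unset Printing Implicit Defensive.

Import Order.TTheory GRing.Theory Num.Theory.
Import numFieldNormedType.Exports.

Local Open Scope classical_set_scope.
Local Open Scope ring_scope.

(* R^n is 'rV[R]_n. Its topology is the library's one (the norm of 'rV[R]_n is
   the sup norm); Euclidean lengths are written explicitly with [enorm]. *)

Section euclidean.
Context {R : realType} {n : nat}.
Implicit Types x y : 'rV[R]_n.

Definition edot x y : R := \sum_(i < n) x ord0 i * y ord0 i.
Definition enorm x : R := Num.sqrt (edot x x).
Definition eball x (r : R) : set 'rV[R]_n := [set y | enorm (y - x) < r].

End euclidean.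

(* The splitting R^(n+1) = R^n x R, x = (x', t) with t the last coordinate. *)
Section splitting.
Context {R : realType} {n : nat}.

Definition row_rcons (x' : 'rV[R]_n) (t : R) : 'rV[R]_n.+1 :=
  \row_i if unlift ord_max i is Some j then x' ord0 j else t.
Definition row_init (x : 'rV[R]_n.+1) : 'rV[R]_n :=
  \row_j x ord0 (lift ord_max j).
Definition row_last (x : 'rV[R]_n.+1) : R := x ord0 ord_max.

Lemma row_init_rcons x' t : row_init (row_rcons x' t) = x'.
Proof. by apply/rowP => j; rewrite !mxE liftK. Qed.

Lemma row_last_rcons x' t : row_last (row_rcons x' t) = t.
Proof. by rewrite /row_last mxE unlift_none. Qed.

Lemma row_rconsK x : row_rcons (row_init x) (row_last x) = x.
Proof. by apply/rowP => i; rewrite mxE; case: unliftP => [j|] ->; rewrite ?mxE. Qed.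

End splitting.

(* The sigma-algebra of 'rV[R]_n is the product one, i.e. the Borel one. *)
Definition rV_display : measure_display.
Proof. exact: default_measure_display. Qed.

Section measurable_rV.
Context {R : realType} {n : nat}.

Let coord (i : 'I_n) (x : 'rV[R]_n) : measurableTypeR R := x ord0 i.

Let rV_set0 : g_sigma_preimage coord set0.
Proof. exact: sigma_algebra0. Qed.

Let rV_setC A : g_sigma_preimage coord A -> g_sigma_preimage coord (~` A).
Proof. exact: sigma_algebraC. Qed.

Let rV_bigcup (F : _^nat) : (forall i, g_sigma_preimage coord (F i)) ->
  g_sigma_preimage coord (\bigcup_i (F i)).
Proof. exact: sigma_algebra_bigcup. Qed.

HB.instance Definition _ := @isMeasurable.Build rV_display
  'rV[R]_n (g_sigma_preimage coord) rV_set0 rV_setC rV_bigcup.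

Lemma measurable_coord (i : 'I_n) :
  measurable_fun [set: 'rV[R]_n] (fun x => x ord0 i : measurableTypeR R).
Proof.
move=> _ Y mY; rewrite setTI; apply: sub_sigma_algebra => /=.
rewrite -bigcup_seq/=; exists i => /=; first by rewrite mem_index_enum.
by exists Y => //; rewrite setTI.
Qed.

Lemma measurable_rVP d (T : measurableType d) (h : T -> 'rV[R]_n) :
  (forall i, measurable_fun [set: T] (fun z => h z ord0 i : measurableTypeR R)) ->
  measurable_fun [set: T] h.
Proof.
move=> mh.
suff S : g_sigma_preimage (fun i => coord i \o h) `<=` measurable.
  move=> _ A mA; rewrite setTI; apply: S; rewrite g_sigma_preimage_comp.
  by exists A => //; rewrite setTI.
apply: smallest_sub; first exact: sigma_algebra_measurable.
rewrite -bigcup_seq/=; apply: bigcup_sub => i _ _ [B mB <-].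
exact: mh.
Qed.

End measurable_rV.

Section lebesgue_rV.
Context {R : realType}.

Lemma measurable_row_rcons n : measurable_fun setT
  (fun p : 'rV[R]_n * measurableTypeR R => row_rcons p.1 p.2).
Proof.
apply: measurable_rVP => i.
under eq_fun do rewrite mxE.
case: unliftP => [j _|_]; last exact: measurable_snd.
exact: (measurableT_comp (measurable_coord j) measurable_fst).
Qed.

Lemma measurable_row_init n : measurable_fun setT (@row_init R n).
Proof.
apply: measurable_rVP => j; under eq_fun do rewrite mxE.
exact: measurable_coord.
Qed.

Section step.
Variables (n : nat) (m : {sigma_finite_measure set 'rV[R]_n -> \bar R}).

Definition leb_step : set 'rV[R]_n.+1 -> \bar R :=
  pushforward (m \x (@lebesgue_measure R))%E
    (fun p : 'rV[R]_n * measurableTypeR R => row_rcons p.1 p.2).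

Let leb_step0 : leb_step set0 = 0%E.
Proof. by rewrite /leb_step /pushforward preimage_set0 measure0. Qed.

Let leb_step_ge0 A : (0 <= leb_step A)%E.
Proof. by rewrite /leb_step /pushforward measure_ge0. Qed.

Let leb_step_sigma_additive : semi_sigma_additive leb_step.
Proof.
move=> F mF tF mUF; rewrite /leb_step /pushforward preimage_bigcup.
have mpre k : measurable
    ((fun p : 'rV[R]_n * measurableTypeR R => row_rcons p.1 p.2) @^-1` F k).
  by rewrite -[X in measurable X]setTI; exact: measurable_row_rcons.
apply: measure_semi_sigma_additive => //.
- apply/trivIsetP => /= i j _ _ ij; rewrite -preimage_setI.
  by move/trivIsetP : tF => /(_ _ _ _ _ ij) ->//; rewrite preimage_set0.
- exact: bigcup_measurable.
Qed.

HB.instance Definition _ := isMeasure.Build _ _ _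
  leb_step leb_step0 leb_step_ge0 leb_step_sigma_additive.

Let leb_step_sigma_finite : sigma_finite setT leb_step.
Proof.
have /sigma_finiteP[F [FT ndF Foo]] := sigma_finiteT m.
have /sigma_finiteP[G [GT ndG Goo]] := sigma_finiteT (@lebesgue_measure R).
pose split (x : 'rV[R]_n.+1) : 'rV[R]_n * measurableTypeR R :=
  (row_init x, row_last x).
have msplit : measurable_fun setT split.
  apply/measurable_fun_pairP; split; first exact: measurable_row_init.
  exact: measurable_coord.
exists (fun k => split @^-1` (F k `*` G k)).
  apply/esym; rewrite -subTset => x _.
  have [i _ Fi] : (\bigcup_k F k) (row_init x) by rewrite -FT.
  have [j _ Gj] : (\bigcup_k G k) (row_last x) by rewrite -GT.
  exists (maxn i j) => //; split => /=.
    by move: Fi; apply/subsetPset/ndF/leq_maxl.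
  by move: Gj; apply/subsetPset/ndG/leq_maxr.
move=> k; have [[mFk Fkoo] [mGk Gkoo]] := (Foo k, Goo k); split.
  by rewrite -[X in measurable X]setTI; apply: msplit => //; exact: measurableX.
rewrite /leb_step /pushforward -comp_preimage (_ : split \o _ = id).
  rewrite preimage_id product_measure1E// lte_mul_pinfty// ge0_fin_numE//.
by apply/funext => -[x' t]; rewrite /split /= row_init_rcons row_last_rcons.
Qed.

HB.instance Definition _ := Measure_isSigmaFinite.Build _ _ _
  leb_step leb_step_sigma_finite.

End step.

(* The n-dimensional Lebesgue measure, on Borel sets: the iterated product of
   the one-dimensional one. On the one-point space R^0 it is the unit mass. *)
Fixpoint leb n : {sigma_finite_measure set 'rV[R]_n -> \bar R} :=
  if n is n'.+1 then leb_step (leb n') else \d_(0 : 'rV[R]_0).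

(* The completion of the Borel sigma-algebra. *)
Definition lebesgue_measurable n (E : set 'rV[R]_n) : Prop :=
  exists2 B, measurable B & (leb n).-negligible (E `+` B).

End lebesgue_rV.
Arguments leb {R} n.

(* Hausdorff measures. The gauge of C is omega_s (diam C / 2)^s, where omega_s
   is the volume of the unit ball of R^s; the empty set has gauge 0, also for
   s = 0. The exponent s is a natural number, which is all that is needed. *)
Section hausdorff.
Context {R : realType} {n : nat}.
Implicit Types (A C : set 'rV[R]_n) (s : nat).
Local Open Scope ereal_scope.

Definition ediam C : \bar R :=
  ereal_sup [set d | exists x y, [/\ C x, C y & d = (enorm (x - y))%:E]].

Definition omega s : \bar R := leb s (eball 0%R 1%R).

Definition hausdorff_gauge s C : \bar R :=
  if `[< C !=set0 >] then omega s * ((fine (ediam C) / 2) ^+ s)%:E else 0.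

Definition hausdorff_delta s (delta : R) A : \bar R :=
  ereal_inf [set \sum_(0 <= k <oo) hausdorff_gauge s (C k) |
    C in [set C : nat -> set 'rV[R]_n | A `<=` \bigcup_k C k /\
                                        forall k, ediam (C k) <= delta%:E]].

Definition hausdorff s A : \bar R :=
  ereal_sup [set hausdorff_delta s delta A | delta in [set d : R | (0 < d)%R]].

Definition hausdorff_ae s (P : 'rV[R]_n -> Prop) : Prop :=
  hausdorff s [set x | ~ P x] = 0.

End hausdorff.

(* C^1 functions on R^n, with values in R or R^n. *)
Section test_functions.
Context {R : realType} {n : nat}.

Definition partial {W : normedModType R} (i : 'I_n) (phi : 'rV[R]_n -> W) :=
  'D_(delta_mx ord0 i) phi.

Definition tsupport {T : topologicalType} {W : nmodType} (phi : T -> W) :=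
  closure [set x | phi x != 0].

Definition C1c {W : normedModType R} (phi : 'rV[R]_n -> W) : Prop :=
  [/\ forall i x, derivable phi x (delta_mx ord0 i),
      forall i, continuous (partial i phi) &
      compact (tsupport phi)].

Definition div (phi : 'rV[R]_n -> 'rV[R]_n) (x : 'rV[R]_n) : R :=
  \sum_(i < n) partial i (fun y => phi y ord0 i) x.

End test_functions.

(* W^{1,1}_loc(R^n). Since L^1_loc functions are classes modulo null sets,
   Borel representatives are used; a precise representative is always Borel. *)
Section sobolev.
Context {R : realType} {n : nat}.
Implicit Types (f : 'rV[R]_n -> R) (g : 'rV[R]_n -> 'rV[R]_n).

Definition L1loc f : Prop := measurable_fun setT (f : 'rV[R]_n -> measurableTypeR R) /\
  forall K : set 'rV[R]_n, compact K -> (leb n).-integrable K (EFin \o f).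

Definition is_weak_gradient f g : Prop :=
  (forall i, L1loc (fun x => g x ord0 i)) /\
  forall (i : 'I_n) (phi : 'rV[R]_n -> R), C1c phi ->
    (\int[leb n]_x (f x * partial i phi x)%:E =
     - \int[leb n]_x (g x ord0 i * phi x)%:E)%E.

Definition W11loc f : Prop := L1loc f /\ exists g, is_weak_gradient f g.

Definition grad f : 'rV[R]_n -> 'rV[R]_n := xget (fun=> 0) (is_weak_gradient f).

Definition average f (x : 'rV[R]_n) (r : R) : R :=
  fine (\int[leb n]_(y in eball x r) (f y)%:E) / fine (leb n (eball x r)).

Definition precise_rep f (x : 'rV[R]_n) : R :=
  if `[< cvg (average f x r @[r --> 0^'+]) >]
  then lim (average f x r @[r --> 0^'+]) else 0.

End sobolev.

Section weighted.
Context {R : realType} {n : nat}.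
Implicit Types (f : 'rV[R]_n -> R) (E H : set 'rV[R]_n).

(* f is the density of a measure of the class W(R^n). *)
Definition weight f : Prop :=
  [/\ forall x, 0 <= f x,
      (leb n).-integrable setT (EFin \o f),
      W11loc f &
      f = precise_rep f].

(* The integrands in [wmeasure] and [Per] are not Borel when E is only Lebesgue
   measurable. The library's integral of a nonnegative function is a supremum
   over Borel simple functions below it, hence it is unchanged by modification
   on a null set, and these are the integrals for the completed measure. *)
Definition wmeasure f E : \bar R := (\int[leb n]_(x in E) (f x)%:E)%E.

Definition Per f E : \bar R :=
  ereal_sup [set (\int[leb n]_x
                    (\1_E x * (div phi x * f x + edot (phi x) (grad f x)))%:E)%E |
    phi in [set phi : 'rV[R]_n -> 'rV[R]_n |
              C1c phi /\ forall x, enorm (phi x) <= 1]].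

Definition Per_minimal f H (F : set (set 'rV[R]_n)) : Prop :=
  forall E, F E -> (Per f H <= Per f E)%E.

End weighted.

Definition halfspace {R : realType} {n : nat} (c : R) : set 'rV[R]_n.+1 :=
  [set x | c <= row_last x].

(* W^{1,1}_loc of an open subset of the real line. *)
Section sobolev1.
Context {R : realType}.
Implicit Types (I : set R) (b g : R -> R).

Definition C1c1 I (phi : R -> R) : Prop :=
  [/\ forall t, derivable phi t 1, continuous (derive1 phi),
      compact (tsupport phi) & tsupport phi `<=` I].

Definition is_weak_derivative I b g : Prop :=
  locally_integrable I g /\
  forall phi, C1c1 I phi ->
    (\int[@lebesgue_measure R]_(t in I) (b t * derive1 phi t)%:E =
     - \int[@lebesgue_measure R]_(t in I) (g t * phi t)%:E)%E.

Definition W11loc1 I b : Prop :=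
  locally_integrable I b /\ exists g, is_weak_derivative I b g.

End sobolev1.

(* Main.v *)
Require Import Defs.
From HB Require Import structures.
From mathcomp Require Import all_boot all_order all_algebra.
From mathcomp Require Import all_classical all_reals all_analysis.
From mathcomp Require Import measurable_realfun.
From mathcomp Require Import ring lra zify.

(** Write a point of the space as (y, t) with t its last coordinate, g for the last component of the
weak gradient of f, and P_a(t) for the integral over y of a(y) f(y, t).

The half-space above the height c is compared with the epigraph of c + w, for w a C^1 function of y
with compact support that encloses the same mass.  By the Gauss-Green formula the perimeter of an
epigraph is at most the integral of (1 + |grad w|^2 / 2) f(y, c + w(y)), and that of the half-space
is at least the integral of f(y, c) ([gauss_green_epigraph], [weight_halfspace_minimal]).  Hence
minimality bounds the second integral by the first one.

Put w = s u and let s tend to 0.  To first order the mass constraint reads P_u(c) = 0 and the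
inequality, applied to u and to -u, says that the derivative of P_u vanishes at c.  With
u = a - k b, where k = P_a(c) / P_b(c), this is the equation (P_a / P_b)' = 0: the ratio of two
averages is constant on every interval on which P_b is positive.  Since the test functions a
separate points, all the slices f(., t) with t in such an interval are proportional
([slices_proportional]), which is the product form of f.  The intervals I_j decompose
the open set of the heights t at which some P_a with a nonnegative is positive; at the other heights
f(., t) vanishes almost everywhere.

Two points need care.

First, f is only a Sobolev function.  Its precise representative is absolutely continuous on almost
every vertical line ([ae_acl_line]): outside a null set of y, every (y, t) is a point where the
averages of f converge to the absolutely continuous version.  This rests on the Lebesgue
differentiation theorem, obtained from dyadic cubes ([lebesgue_point_ae]).  Setting f to 0 on the
exceptional lines gives a representative that is good on every line ([weight_regular]).

Second, P_a is absolutely continuous but need not be differentiable at a given height, so the first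
variation cannot be computed height by height.  Instead the inequality is integrated over the
heights c between c0 and c1 before s tends to 0; on each line the integral of
f(y, c + s u(y)) - f(y, c) in c is a boundary term ([integrated_variation]).  The coefficient k that
solves the mass constraint varies with c and is not known to be continuous; it is replaced with a
fixed k0 at a cost proportional to the oscillation of the ratio times the variation of f along the
lines ([ratio_step], [ratio_bound]).  On a short interval this cost is at most half of the
oscillation of the ratio, so the oscillation is 0 ([ratio_halve], [ratio_const]).

Null sets of y are turned into sets of Hausdorff measure 0 by [negligible_hausdorff]. *)

Set Implicit Arguments.
Unset Strict Implicit.
Unset Printing Implicit Defensive.

Import Order.TTheory GRing.Theory Num.Theory.
Import numFieldNormedType.Exports.

Local Open Scope classical_set_scope.
Local Open Scope ring_scope.

(** * Dyadic cubes *)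

Section dyadic.
Context {R : realType} {n : nat}.
Implicit Types (x y : 'rV[R]_n) (k : nat) (z : 'rV[int]_n).

Definition dyadic_code k y : 'rV[int]_n := \row_i Num.floor (2 ^+ k * y ord0 i).

Definition dyadic_cube k z : set 'rV[R]_n := [set y | dyadic_code k y = z].

Definition hbox (a : 'rV[R]_n) (l : R) : set 'rV[R]_n :=
  [set y | forall i, a ord0 i <= y ord0 i < a ord0 i + l].

Lemma dyadic_code_nested k x y :
  dyadic_code k.+1 x = dyadic_code k.+1 y -> dyadic_code k x = dyadic_code k y.
Proof.
move=> /rowP h; apply/rowP => i; move: (h i); rewrite !mxE !exprS -!mulrA.
move: (2 ^+ k * x ord0 i) (2 ^+ k * y ord0 i) => {h}a b h.
suff main (u v : R) : Num.floor (2 * u) = Num.floor (2 * v) ->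
    Num.floor u <= Num.floor v.
  by apply/eqP; rewrite eq_le !main.
move=> huv; rewrite floor_ge_int.
have h2 : 2 * Num.floor u <= Num.floor (2 * u).
  by rewrite floor_ge_int intrM ler_pM2l// floor_le.
by move: h2; rewrite huv !floor_ge_int intrM ler_pM2l.
Qed.

Lemma dyadic_code_nestedD k j x y :
  dyadic_code (k + j) x = dyadic_code (k + j) y ->
  dyadic_code k x = dyadic_code k y.
Proof.
by elim: j => [|j IH]; rewrite ?addn0 // addnS => /dyadic_code_nested.
Qed.

Lemma dyadic_code_le k k' x y : (k <= k')%N ->
  dyadic_code k' x = dyadic_code k' y -> dyadic_code k x = dyadic_code k y.
Proof. by move=> kk'; rewrite -(subnKC kk'); exact: dyadic_code_nestedD. Qed.

Lemma dyadic_cubeE k z :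
  dyadic_cube k z = hbox (\row_i ((z ord0 i)%:~R / 2 ^+ k)) (2 ^- k).
Proof.
have k0 : 0 < (2 : R) ^+ k by rewrite exprn_gt0.
apply/seteqP; split => y.
  move=> <- i; rewrite !mxE; have /andP[h1 h2] := floor_itv (2 ^+ k * y ord0 i).
  rewrite ler_pdivrMr// -[X in _ + X]mul1r -mulrDl ltr_pdivlMr//.
  by rewrite !(mulrC (y _ _)) h1/= -[X in _ + X]/(1%:~R) -intrD.
move=> h; apply/rowP => i; rewrite mxE; apply: floor_def.
have := h i; rewrite !mxE => /andP[].
rewrite ler_pdivrMr// -[X in _ + X]mul1r -mulrDl ltr_pdivlMr// => h1 h2.
by rewrite mulrC h1/= intrD.
Qed.

(** Two dyadic cubes are nested or disjoint.  Keeping the cubes of P that meet no larger cube of P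
    therefore makes the family disjoint without uncovering any point. *)
Lemma dyadic_maximal (P : nat -> 'rV[int]_n -> Prop) :
  exists s : nat -> option (nat * 'rV[int]_n),
  [/\ forall j k z, s j = Some (k, z) -> P k z,
      trivIset setT (fun j => if s j is Some (k, z) then dyadic_cube k z else set0) &
      forall k z, P k z -> dyadic_cube k z !=set0 -> exists j k' z',
        [/\ s j = Some (k', z'), (k' <= k)%N & dyadic_cube k z `<=` dyadic_cube k' z']].
Proof.
pose M k z := P k z /\ forall k' z', P k' z' -> (k' < k)%N ->
  ~ (dyadic_cube k z `&` dyadic_cube k' z' !=set0).
pose s (j : nat) : option (nat * 'rV[int]_n) :=
  if pickle_inv j is Some kz then (if `[< M kz.1 kz.2 >] then Some kz else None)
  else None.
have sP j k z : s j = Some (k, z) -> M k z /\ pickle_inv j = Some (k, z).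
  rewrite /s; case: pickle_inv => // -[k' z'] /=.
  by case: asboolP => // Mk [<- <-].
exists s; split.
- by move=> j k z /sP[[]].
- apply/trivIsetP => i j _ _ ij.
  case Ei : (s i) => [[k z]|]; last by rewrite set0I.
  case Ej : (s j) => [[k' z']|]; last by rewrite setI0.
  have [[Pk Mk] pi] := sP _ _ _ Ei; have [[Pk' Mk'] pj] := sP _ _ _ Ej.
  apply/seteqP; split => // x [zx zx'].
  have [kk'|kk'|kk'] := ltngtP k k'.
  + by apply: (Mk' _ _ Pk kk'); exists x.
  + by apply: (Mk _ _ Pk' kk'); exists x.
  + subst k'; have zz' : z = z' by rewrite -zx -zx'.
    move: (pickle_invK (T := (nat * 'rV[int]_n)%type) i)
       (pickle_invK (T := (nat * 'rV[int]_n)%type) j).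
    rewrite pi pj zz' /= => hi hj; move: ij => /eqP; apply.
    by rewrite -hi -hj.
- move=> k; elim/ltn_ind: k => k IH z Pk z0.
  have [Mkz|] := pselect (M k z).
    exists (pickle (k, z)), k, z; split => //.
    by rewrite /s pickleK_inv; case: asboolP.
  move=> /not_andP[//|] /existsNP[k'] /existsNP[z'] /not_implyP[Pk'].
  move=> /not_implyP[k'k] /contrapT[x [xz xz']].
  have z'0 : dyadic_cube k' z' !=set0 by exists x.
  have [j [k'' [z'' [sj k''k' sub]]]] := IH _ k'k z' Pk' z'0.
  exists j, k'', z''; split => //; first exact: leq_trans (ltnW k'k).
  apply: subset_trans sub => y yz; rewrite /dyadic_cube/= -xz'.
  by apply: (dyadic_code_le (ltnW k'k)); rewrite yz.
Qed.

End dyadic.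

Section topology_rV.
Context {R : realType} {n : nat}.
Implicit Types (x y : 'rV[R]_n) (k : nat) (z : 'rV[int]_n).

Lemma ball_rVP x e y : 0 < e ->
  ball x e y <-> forall i, `|x ord0 i - y ord0 i| < e.
Proof.
move=> e0; split; first by move=> [_ h] i; exact: (h ord0 i).
by move=> h; split => // i j; rewrite (ord1 i); exact: h.
Qed.

Lemma coord_measurable_rV (i : 'I_n) : measurable_fun setT (fun x : 'rV[R]_n => x ord0 i).
Proof. exact: measurable_coord. Qed.

Lemma measurable_dyadic_cube k z : measurable (@dyadic_cube R n k z).
Proof.
rewrite dyadic_cubeE.
rewrite (_ : hbox _ _ = \bigcap_(i in [set: 'I_n])
  ((fun x : 'rV[R]_n => x ord0 i) @^-1` `[(z ord0 i)%:~R / 2 ^+ k, (z ord0 i)%:~R / 2 ^+ k + 2 ^- k[)).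
  apply: fin_bigcap_measurable => // i _; rewrite -[X in measurable X]setTI.
  by apply: coord_measurable_rV => //; exact: measurable_itv.
apply/seteqP; split => y.
  by move=> h i _; rewrite /= in_itv/=; have := h i; rewrite mxE.
by move=> h i; have := h i I; rewrite /= in_itv/= mxE.
Qed.

Lemma dyadic_cube_ball k x y z : dyadic_cube k z x -> dyadic_cube k z y ->
  forall i, `|x ord0 i - y ord0 i| < 2 ^- k.
Proof.
rewrite dyadic_cubeE => hx hy i; have := hx i; have := hy i; rewrite mxE.
move: (_ / _) => a; move: (2 ^- k) => e /andP[h1 h2] /andP[h3 h4].
by rewrite ltr_norml; apply/andP; split; lra.
Qed.

Lemma exp2V_small (e : R) : 0 < e -> exists k, (2 : R) ^- k < e.
Proof.
move=> e0; exists (Num.truncn e^-1).+1.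
rewrite invf_plt ?posrE ?exprn_gt0//.
apply: (lt_le_trans (truncnS_gt _)).
by rewrite -natrX ler_nat ltnW// ltn_expl.
Qed.

Lemma exp2V_le (k k' : nat) : (k <= k')%N -> (2 : R) ^- k' <= 2 ^- k.
Proof.
move=> kk'; rewrite lef_pV2 ?posrE ?exprn_gt0//.
by rewrite ler_eXn2l// ltr1n.
Qed.

Lemma open_dyadic (O : set 'rV[R]_n) x K : open O -> O x ->
  exists2 k, (K <= k)%N & dyadic_cube k (dyadic_code k x) `<=` O.
Proof.
move=> oO Ox; have : nbhs x O by exact: open_nbhs_nbhs.
rewrite -(@nbhs_ballE R) => -[e /= e0 xeO].
have [k ke] := exp2V_small e0.
exists (maxn K k); first exact: leq_maxl.
move=> y yx; apply: xeO; apply/ball_rVP => // i.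
rewrite distrC; apply: lt_trans (dyadic_cube_ball yx _ i) _ => //.
by apply: le_lt_trans ke; apply/exp2V_le/leq_maxr.
Qed.

Lemma open_measurable_rV (O : set 'rV[R]_n) : open O -> measurable O.
Proof.
move=> oO; rewrite (_ : O = \bigcup_(kz : nat * 'rV[int]_n)
    (if `[< dyadic_cube kz.1 kz.2 `<=` O >] then dyadic_cube kz.1 kz.2 else set0)).
  apply: countable_bigcupT_measurable => //.
  by move=> kz; case: ifPn => // _; exact: measurable_dyadic_cube.
apply/seteqP; split => [x Ox|x [kz _]].
  have [k _ kO] := open_dyadic 0 oO Ox.
  by exists (k, dyadic_code k x) => //=; case: asboolP.
by case: asboolP => // h /h.
Qed.

Lemma closed_measurable_rV (O : set 'rV[R]_n) : closed O -> measurable O.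
Proof.
by move=> /closed_openC/open_measurable_rV/measurableC; rewrite setCK.
Qed.

Lemma continuous_measurable_rV (h : 'rV[R]_n -> R) : continuous h -> measurable_fun setT h.
Proof.
move=> /continuousP ch; apply: (measurability _ (RGenOpens.measurableE R)).
move=> _ [_ [a [b ->] <-]]; rewrite setTI; apply: open_measurable_rV.
by apply: ch; exact: interval_open.
Qed.

End topology_rV.

(** * Fubini's theorem and volumes *)

Section fubini_leb.
Context {R : realType} {n : nat}.
Local Notation lam := (@lebesgue_measure R).
Local Open Scope ereal_scope.

Definition rc (p : 'rV[R]_n * measurableTypeR R) : 'rV[R]_n.+1 := row_rcons p.1 p.2.

Lemma measurable_rc : measurable_fun setT rc.
Proof. exact: measurable_row_rcons. Qed.

Lemma measurable_comp_rc d (T : measurableType d) (F : 'rV[R]_n.+1 -> T) :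
  measurable_fun setT F -> measurable_fun setT (F \o rc).
Proof. by move=> mF; apply: measurableT_comp => //; exact: measurable_rc. Qed.

Lemma lebSE : @leb R n.+1 = pushforward (leb n \x lam) rc :> (set _ -> \bar R).
Proof. by []. Qed.

Lemma leb_ge0_integral (F : 'rV[R]_n.+1 -> \bar R) : measurable_fun [set: 'rV[R]_n.+1] F ->
  (forall x, 0 <= F x) ->
  \int[leb n.+1]_x F x = \int[leb n \x lam]_p F (rc p).
Proof.
move=> mF F0; rewrite lebSE ge0_integral_pushforward//.
exact: measurable_rc.
Qed.

Lemma leb_ge0_fubini1 (F : 'rV[R]_n.+1 -> \bar R) : measurable_fun [set: 'rV[R]_n.+1] F ->
  (forall x, 0 <= F x) ->
  \int[leb n.+1]_x F x = \int[leb n]_x \int[lam]_t F (row_rcons x t).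
Proof.
move=> mF F0; rewrite leb_ge0_integral//.
have mFr := measurable_comp_rc mF.
by rewrite (fubini_tonelli1 (F \o rc))// => p; exact: F0.
Qed.

Lemma leb_integrable_rc (F : 'rV[R]_n.+1 -> \bar R) : measurable_fun [set: 'rV[R]_n.+1] F ->
  (leb n.+1).-integrable setT F <-> (leb n \x lam).-integrable setT (F \o rc).
Proof.
move=> mF; have mFr := measurable_comp_rc mF.
have e : \int[leb n.+1]_x `|F x| = \int[leb n \x lam]_p `|(F \o rc) p|.
  by rewrite leb_ge0_integral//; exact: measurableT_comp.
split => /integrableP[_ h]; apply/integrableP; split => //.
  by rewrite -e.
by rewrite e.
Qed.

Lemma leb_integral_rc (F : 'rV[R]_n.+1 -> \bar R) : measurable_fun [set: 'rV[R]_n.+1] F ->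
  (leb n.+1).-integrable setT F ->
  \int[leb n.+1]_x F x = \int[leb n \x lam]_p F (rc p).
Proof.
move=> mF iF; rewrite lebSE integral_pushforward//; first exact: measurable_rc.
by apply/leb_integrable_rc.
Qed.

Lemma leb_fubini1 (F : 'rV[R]_n.+1 -> \bar R) : (leb n.+1).-integrable setT F ->
  \int[leb n.+1]_x F x = \int[leb n]_x \int[lam]_t F (row_rcons x t).
Proof.
move=> iF; have mF := measurable_int _ iF.
rewrite leb_integral_rc// -(integral12_prod_meas1 (f := F \o rc))//.
by apply/leb_integrable_rc.
Qed.

Lemma leb_fubini2 (F : 'rV[R]_n.+1 -> \bar R) : (leb n.+1).-integrable setT F ->
  \int[leb n.+1]_x F x = \int[lam]_t \int[leb n]_x F (row_rcons x t).
Proof.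
move=> iF; have mF := measurable_int _ iF.
rewrite leb_integral_rc// -(integral21_prod_meas1 (f := F \o rc))//.
by apply/leb_integrable_rc.
Qed.

Lemma ae_integrable_slice (F : 'rV[R]_n.+1 -> \bar R) :
  (leb n.+1).-integrable setT F ->
  {ae leb n, forall x, lam.-integrable setT (fun t => F (row_rcons x t))}.
Proof.
move=> iF; have mF := measurable_int _ iF.
by apply: (ae_integrable1 (f := F \o rc)); apply/leb_integrable_rc.
Qed.

Lemma leb_negligible_cylinder (N : set 'rV[R]_n) : (leb n).-negligible N ->
  (leb n.+1).-negligible [set x | N (row_init x)].
Proof.
move=> [A [mA A0 NA]]; exists [set x | A (row_init x)]; split.
- by rewrite -[X in measurable X]setTI; exact: measurable_row_init.
- rewrite lebSE /pushforward (_ : _ @^-1` _ = A `*` setT).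
    transitivity (leb n A * lam setT); first exact: product_measure1E.
    by rewrite A0 mul0e.
  by apply/seteqP; split => -[x t] /=; rewrite /rc/= row_init_rcons; [|case].
- by move=> x /= /NA.
Qed.

End fubini_leb.

Section volume.
Context {R : realType}.

Lemma measurable_hbox n (a : 'rV[R]_n) l : measurable (hbox a l).
Proof.
rewrite (_ : hbox _ _ = \bigcap_(i in [set: 'I_n])
  ((fun x : 'rV[R]_n => x ord0 i) @^-1` `[a ord0 i, a ord0 i + l[)).
  apply: fin_bigcap_measurable => // i _; rewrite -[X in measurable X]setTI.
  by apply: coord_measurable_rV => //; exact: measurable_itv.
by apply/seteqP; split => y h i; [move=> _|]; have := h i; rewrite /= in_itv/=; exact.
Qed.

Lemma leb_hbox n (a : 'rV[R]_n) l : 0 <= l -> leb n (hbox a l) = (l ^+ n)%:E.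
Proof.
move=> l0; elim: n a => [|n IH] a.
  rewrite /= diracE expr0 mem_set//; by case.
rewrite lebSE /pushforward (_ : _ @^-1` _ =
    hbox (row_init a) l `*` `[row_last a, row_last a + l[%classic).
  transitivity (leb n (hbox (row_init a) l) * lebesgue_measure `[row_last a, (row_last a + l)%R[%classic)%E.
    by apply: product_measure1E; [exact: measurable_hbox|exact: measurable_itv].
  rewrite IH lebesgue_measure_itv/= lte_fin ltrDl; case: ifPn => l1.
    by rewrite -EFinD addrC addKr -EFinM exprSr.
  have -> : l = 0 by apply/eqP; rewrite eq_le l0 leNgt l1.
  by rewrite mule0 expr0n.
apply/seteqP; split => -[x t]; rewrite /rc /hbox/=.
  move=> h; split => [i|].
    by have := h (lift ord_max i); rewrite !mxE liftK.
  by have := h ord_max; rewrite mxE unlift_none in_itv/=.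
move=> [h]; rewrite in_itv/= => t1 i; rewrite !mxE.
case: unliftP => [j ->|-> //].
by have := h j; rewrite !mxE.
Qed.

Lemma leb_dyadic_cube n k z : leb n (@dyadic_cube R n k z) = ((2 ^- k) ^+ n)%:E.
Proof. by rewrite dyadic_cubeE leb_hbox// invr_ge0 exprn_ge0. Qed.

Lemma ball_sub_hbox n (x : 'rV[R]_n) r : ball x r `<=` hbox (x - const_mx r) (2 * r).
Proof.
move=> y [r0 h] i; have := h ord0 i; rewrite /ball/= !mxE ltr_distlC => /andP[h1 h2].
by rewrite (ltW h1)/=; apply: lt_le_trans h2 _; lra.
Qed.

Lemma leb_ball_le n (x : 'rV[R]_n) r : 0 < r -> (leb n (ball x r) <= ((2 * r) ^+ n)%:E)%E.
Proof.
move=> r0; have r2 : 0 <= 2 * r by rewrite mulr_ge0// ltW.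
rewrite -(leb_hbox (x - const_mx r))//.
apply: le_measure; rewrite ?inE; last exact: ball_sub_hbox.
- by apply: open_measurable_rV; exact: ball_open.
- exact: measurable_hbox.
Qed.

End volume.

Lemma cvg_ereal_lt {R : realType} (u : nat -> \bar R) l e :
  u k @[k --> \oo] --> l -> (l < e)%E -> exists K, (u K < e)%E.
Proof.
move=> ul le; have /ul : nbhs l [set x | (x < e)%E].
  by apply: open_nbhs_nbhs; split => //; exact: open_ereal_lt_ereal.
by move=> [K _ /(_ K (leqnn K))] hK; exists K.
Qed.

Lemma measure_bigcupT d (T : measurableType d) {R : realType}
    (mu : {measure set T -> \bar R}) (F : nat -> set T) :
  (forall k, measurable (F k)) -> trivIset setT F ->
  mu (\bigcup_k F k) = (\sum_(0 <= k <oo) mu (F k))%E.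
Proof.
move=> mF tF; rewrite measure_bigcup//.
by apply: eq_eseriesl => k; rewrite in_setT.
Qed.

(** * Regularity of finite Borel measures *)

Section regularity.
Context {R : realType} {n : nat}.
Local Open Scope ereal_scope.
Variable m : {measure set 'rV[R]_n -> \bar R}.
Hypothesis mfin : m setT < +oo.

Definition regular_set (A : set 'rV[R]_n) := forall e : R, (0 < e)%R ->
  exists F O, [/\ closed F, open O, F `<=` A, A `<=` O & m (O `\` F) < e%:E].

Let mfinA A : measurable A -> m A < +oo.
Proof.
by move=> mA; apply: le_lt_trans mfin; apply: le_measure => //; rewrite ?inE.
Qed.

Lemma regular_setC A : regular_set A -> regular_set (~` A).
Proof.
move=> h e /h[C [U [cC oU CA AU CU]]]; exists (~` U), (~` C).
split; [exact: open_closedC|exact: closed_openC|exact: subsetC|exact: subsetC|].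
by rewrite (_ : _ `\` _ = U `\` C)// setDE setCK setIC -setDE.
Qed.

Lemma regular_bigcup (A : nat -> set 'rV[R]_n) : (forall k, regular_set (A k)) ->
  regular_set (\bigcup_k A k).
Proof.
move=> h e e0.
have e2 k : (0 < (e / 2) / (2 ^ k.+1)%:R)%R by rewrite !divr_gt0// ltr0n expn_gt0.
have /choice[FO hFO] : forall k, exists FO : set 'rV[R]_n * set 'rV[R]_n,
  [/\ closed FO.1, open FO.2, FO.1 `<=` A k, A k `<=` FO.2 &
      m (FO.2 `\` FO.1) < ((e / 2) / (2 ^ k.+1)%:R)%:E].
  by move=> k; have [C [U CU]] := h k _ (e2 k); exists (C, U).
pose O := \bigcup_k (FO k).2; pose F := \bigcup_k (FO k).1.
pose G K := \bigcup_(k in `I_K) (FO k).1.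
have oO : open O by apply: bigcup_open => k _; have [] := hFO k.
have cG K : closed (G K).
  by apply: closed_bigcup => //; move=> k _; have [] := hFO k.
have mO := open_measurable_rV oO.
have mF1 k : measurable (FO k).1 by apply: closed_measurable_rV; have [] := hFO k.
have mF2 k : measurable (FO k).2 by apply: open_measurable_rV; have [] := hFO k.
have mF : measurable F by exact: bigcup_measurable.
have mOF : m (O `\` F) <= (e / 2)%:E.
  apply: (@le_trans _ _ (\sum_(0 <= k <oo) m ((FO k).2 `\` (FO k).1))).
    apply: measure_sigma_subadditive.
    - by move=> k; exact: measurableD.
    - exact: measurableD.
    - move=> x [[k _ xk] nF]; exists k => //; split => // xF; apply: nF.
      by exists k.
  apply: le_trans (epsilon_trick0 xpredT _); last by rewrite divr_ge0// ltW.
  by apply: lee_nneseries => // k _; have [_ _ _ _ /ltW] := hFO k.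
(* a finite union of the closed cores is closed, and its defect tends to that of F *)
have cvgG : m (O `\` G K) @[K --> \oo] --> m (O `\` F).
  rewrite (_ : O `\` F = \bigcap_K (O `\` G K)).
    apply: (@nonincreasing_cvg_mu _ _ _ m (fun K => O `\` G K)).
    - by apply: mfinA; apply: measurableD => //; apply: closed_measurable_rV.
    - by move=> K; apply: measurableD => //; apply: closed_measurable_rV.
    - by apply: bigcapT_measurable => K; apply: measurableD => //; apply: closed_measurable_rV.
    - move=> K K' KK'; apply/subsetPset; apply: setDS => x [k /= kK Fk].
      by exists k => //=; exact: leq_trans KK'.
  apply/seteqP; split => [x [Ox nF] K _|x h2].
    by split => // -[k _ xk]; apply: nF; exists k.
  split; first by have [] := h2 0%N I.
  by move=> [k _ xk]; have [_] := h2 k.+1 I; apply; exists k => /=.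
have lt : m (O `\` F) < e%:E.
  by apply: le_lt_trans mOF _; rewrite lte_fin ltr_pdivrMr// ltr_pMr// ltr1n.
have [K hK] := cvg_ereal_lt cvgG lt.
exists (G K), O; split => //.
- by move=> x [k _ xk]; exists k => //; have [_ _ + _ _] := hFO k; apply.
- by move=> x [k _ xk]; exists k => //; have [_ _ _ + _] := hFO k; apply.
Qed.

Lemma regular_ray (i : 'I_n) (a : R) :
  regular_set ((fun x : 'rV[R]_n => x ord0 i) @^-1` `[a, +oo[).
Proof.
move=> e e0; set A := _ @^-1` _.
have cc : continuous (fun x : 'rV[R]_n => x ord0 i) by exact: coord_continuous.
pose O (k : nat) := (fun x : 'rV[R]_n => x ord0 i) @^-1` `](a - k.+1%:R^-1)%R, +oo[%classic.
have oO k : open (O k) by apply: open_comp => //; exact: interval_open.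
have cA : closed A by apply: closed_comp => //; exact: interval_closed.
have mA := closed_measurable_rV cA.
have mO k := open_measurable_rV (oO k).
have cvgG : m (O k `\` A) @[k --> \oo] --> m (\bigcap_k (O k `\` A)).
  apply: (@nonincreasing_cvg_mu _ _ _ m (fun k => O k `\` A)).
  - by apply: mfinA; apply: measurableD.
  - by move=> K; apply: measurableD.
  - by apply: bigcapT_measurable => K; apply: measurableD.
  - move=> K K' KK'; apply/subsetPset; apply: setSD => x; rewrite /O/= !in_itv/= !andbT.
    apply: le_lt_trans; rewrite lerD2l lerN2 lef_pV2 ?posrE//.
    by rewrite ler_nat.
have E0 : \bigcap_k (O k `\` A) = set0.
  apply/seteqP; split => // x h; have [_] := h 0%N I; apply.
  rewrite /A/= in_itv/= andbT leNgt; apply/negP => xa.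
  have := ltr_add_invr xa => -[k hk]; have [] := h k I.
  by rewrite /O/= in_itv/= andbT ltrBlDr => /lt_trans/(_ hk); rewrite ltxx.
have [|K hK] := @cvg_ereal_lt _ _ _ e%:E cvgG.
  by rewrite E0 measure0 lte_fin.
exists A, (O K); split => //.
move=> x; rewrite /A /O/= !in_itv/= !andbT; apply: lt_le_trans.
by rewrite ltrBlDr ltrDl.
Qed.

(** Closed coordinate half-spaces are regular, and the regular sets form a sigma-algebra. *)
Lemma measurable_regular A : measurable A -> regular_set A.
Proof.
have sG : sigma_algebra setT regular_set.
  split.
  - move=> e e0; exists set0, set0; split => //; rewrite ?setD0 ?measure0 ?lte_fin//.
    exact: closed0.
  - by move=> B hB; rewrite setTD; exact: regular_setC.
  - exact: regular_bigcup.
suff S : measurable `<=` regular_set by exact: S.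
apply: smallest_sub => //.
rewrite -bigcup_seq/=; apply: bigcup_sub => i _ _ [B mB <-]; rewrite setTI.
have mB' : (@RGenCInfty.G R).-sigma.-measurable B.
  by rewrite -RGenCInfty.measurableE; exact: mB.
suff S : (@RGenCInfty.G R).-sigma.-measurable `<=`
    [set B | regular_set ((fun x : 'rV[R]_n => x ord0 i) @^-1` B)] by exact: S.
apply: smallest_sub.
  split.
  - by rewrite /= preimage_set0; case: sG.
  - by move=> C hC; rewrite /= setTD preimage_setC; exact: regular_setC.
  - by move=> C hC; rewrite /= preimage_bigcup; exact: regular_bigcup.
by move=> _ [a ->]; exact: regular_ray.
Qed.

End regularity.

(** * Null sets are null for the Hausdorff measure *)

Section negligible_cover.
Context {R : realType} {n : nat}.
Local Open Scope ereal_scope.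

Lemma leb_ball_fin (x : 'rV[R]_n) r : leb n (ball x r) < +oo.
Proof.
have [r0|r0] := ltP 0%R r; last first.
  rewrite (_ : ball _ _ = set0) ?measure0 ?ltry//.
  by apply/seteqP; split => // y [] /lt_le_trans/(_ r0); rewrite ltxx.
by apply: le_lt_trans (leb_ball_le x r0) _; rewrite ltry.
Qed.

Lemma measurable_ball_rV (x : 'rV[R]_n) r : measurable (ball x r).
Proof. by apply: open_measurable_rV; exact: ball_open. Qed.

Lemma ball_cover_rV (x : 'rV[R]_n) : exists k : nat, ball (0%R : 'rV[R]_n) k.+1%:R x.
Proof.
exists (Num.truncn `|x|); rewrite -ball_normE /ball_/= sub0r normrN.
exact: truncnS_gt.
Qed.

(** Regularity is available for finite measures only: it is applied to the restrictions to balls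
    that exhaust the space, with errors that sum up to e. *)
Lemma negligible_open_cover (N : set 'rV[R]_n) (e : R) : (leb n).-negligible N -> (0 < e)%R ->
  exists O, [/\ open O, N `<=` O & leb n O <= e%:E].
Proof.
move=> [A [mA A0 NA]] e0.
pose W (k : nat) := ball (0%R : 'rV[R]_n) k.+1%:R.
have mW k : measurable (W k) by exact: measurable_ball_rV.
have e2 k : (0 < e / (2 ^ k.+1)%:R)%R by rewrite !divr_gt0// ltr0n expn_gt0.
have /choice[U_ hU] : forall k, exists U, [/\ open U, A `<=` U &
    leb n (U `&` W k) <= (e / (2 ^ k.+1)%:R)%:E].
  move=> k.
  have fin : mrestr (leb n) (mW k) setT < +oo by rewrite /mrestr setTI leb_ball_fin.
  have [C [U [cC oU CA AU CU]]] := measurable_regular fin mA (e2 k).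
  exists U; split => //; apply: le_trans (ltW CU).
  have mU := open_measurable_rV oU; have mC := closed_measurable_rV cC.
  apply: (@le_trans _ _ (leb n (((U `\` C) `&` W k) `|` A))).
    apply: le_measure; rewrite ?inE.
    - exact: measurableI.
    - by apply: measurableU => //; apply: measurableI => //; exact: measurableD.
    - move=> x [Ux Wx]; have [Cx|Cx] := pselect (C x).
        by right; exact: CA.
      by left.
  apply: le_trans (measureU2 _ _ _) _ => //.
    by apply: measurableI => //; exact: measurableD.
  by rewrite [X in _ + X]A0 adde0.
exists (\bigcup_k (U_ k `&` W k)); split.
- by apply: bigcup_open => k _; apply: openI; [have [] := hU k|exact: ball_open].
- move=> x /NA Ax; have [k Wk] := ball_cover_rV x; exists k => //; split => //.
  by have [_ + _] := hU k; apply.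
- apply: (@le_trans _ _ (\sum_(0 <= k <oo) leb n (U_ k `&` W k))).
    apply: measure_sigma_subadditive => //.
    + by move=> k; apply: measurableI => //; apply: open_measurable_rV; have [] := hU k.
    + apply: bigcup_measurable => k _; apply: measurableI => //.
      by apply: open_measurable_rV; have [] := hU k.
  apply: le_trans (epsilon_trick0 xpredT (ltW e0)).
  by apply: lee_nneseries => // k _; have [] := hU k.
Qed.

End negligible_cover.

Section euclid.
Context {R : realType} {n : nat}.
Implicit Types x y : 'rV[R]_n.

Lemma edot_ge0 x : 0 <= edot x x.
Proof. by apply: sumr_ge0 => i _; rewrite -expr2 sqr_ge0. Qed.

Lemma enorm_ltP x r : 0 < r -> (enorm x < r) = (edot x x < r ^+ 2).
Proof.
move=> r0; rewrite /enorm -[in LHS](ger0_norm (ltW r0)) -sqrtr_sqr ltr_sqrt//.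
by rewrite exprn_gt0.
Qed.

Lemma enorm_le_sum x : enorm x <= \sum_i `|x ord0 i|.
Proof.
have s0 : 0 <= \sum_i `|x ord0 i| by apply: sumr_ge0.
rewrite /enorm -[leRHS](ger0_norm s0) -sqrtr_sqr ler_sqrt ?sqr_ge0//.
rewrite expr2 mulr_sumr; apply: ler_sum => i _.
rewrite -expr2 -real_normK ?num_real// expr2 ler_wpM2r//.
by rewrite (bigD1 i)//= lerDl sumr_ge0.
Qed.

Lemma coord_le_enorm x i : `|x ord0 i| <= enorm x.
Proof.
rewrite /enorm -sqrtr_sqr ler_sqrt ?edot_ge0// /edot (bigD1 i)//= expr2 lerDl.
by apply: sumr_ge0 => j _; rewrite -expr2 sqr_ge0.
Qed.

Lemma continuous_edot (z : 'rV[R]_n) : continuous (fun y => edot (y - z) (y - z)).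
Proof.
move=> x; rewrite /edot.
have cc i : continuous (fun y : 'rV[R]_n => (y - z) ord0 i).
  move=> y; under eq_fun do rewrite !mxE.
  by apply: continuousB; [exact: coord_continuous|exact: cst_continuous].
apply: (@cvg_big _ _ +%R 0 predT (@add_continuous R) _ (nbhs x)) => i _.
by apply: continuousM; exact: cc.
Qed.

Lemma open_eball x r : open (eball x r).
Proof.
have [r0|r0] := ltP 0 r; last first.
  rewrite (_ : eball x r = set0); first exact: open0.
  apply/seteqP; split => // y; rewrite /eball/= => /lt_le_trans/(_ r0).
  by rewrite ltNge sqrtr_ge0.
rewrite (_ : eball x r = (fun y => edot (y - x) (y - x)) @^-1` `]-oo, (r ^+ 2)[).
  by apply: open_comp; [move=> y _; exact: continuous_edot|exact: interval_open].
by apply/seteqP; split => y; rewrite /eball/= in_itv/= enorm_ltP.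
Qed.

Lemma eball_sub_ball x r : 0 < r -> eball x r `<=` ball x r.
Proof.
move=> r0 y xy; apply/ball_rVP => // i; rewrite distrC.
by apply: le_lt_trans xy; have := coord_le_enorm (y - x) i; rewrite !mxE.
Qed.

Lemma hbox_sub_eball x r : 0 < r ->
  hbox x (r / n.+1%:R) `<=` eball x r.
Proof.
move=> r0 y h; rewrite /eball/=; apply: le_lt_trans (enorm_le_sum _) _.
apply: (@le_lt_trans _ _ (\sum_(i < n) (r / n.+1%:R))).
  apply: ler_sum => i _; rewrite !mxE; have /andP[h1 h2] := h i.
  by rewrite ger0_norm ?subr_ge0// lerBlDl ltW.
rewrite sumr_const card_ord -[X in X < _]mulr_natr -mulrA gtr_pMr//.
by rewrite mulrC ltr_pdivrMr// mul1r ltr_nat.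
Qed.

End euclid.

Section null_hausdorff.
Context {R : realType} {n : nat}.

Lemma omega_fin : (omega n : \bar R) \is a fin_num.
Proof.
rewrite ge0_fin_numE// /omega.
apply: (@le_lt_trans _ _ (leb n (ball (0 : 'rV[R]_n) 1))).
  apply: le_measure; rewrite ?inE; last exact: eball_sub_ball.
  - by apply: open_measurable_rV; exact: open_eball.
  - exact: measurable_ball_rV.
exact: leb_ball_fin.
Qed.

Lemma hausdorff_gauge_ge0 s (C : set 'rV[R]_n) : (0 <= hausdorff_gauge s C)%E.
Proof.
rewrite /hausdorff_gauge; case: asboolP => // -[x Cx].
apply: mule_ge0; first exact: measure_ge0.
rewrite lee_fin exprn_ge0// divr_ge0// fine_ge0//.
apply: ereal_sup_ubound; exists x, x; split => //.
by rewrite subrr /enorm /edot big1 ?sqrtr0// => i _; rewrite mxE mul0r.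
Qed.

Lemma dyadic_ediam k z : (ediam (@dyadic_cube R n k z) <= (n%:R * 2 ^- k)%:E)%E.
Proof.
apply: ge_ereal_sup => _ [x [y [Cx Cy ->]]]; rewrite lee_fin.
apply: le_trans (enorm_le_sum _) _.
rewrite -[leRHS](_ : \sum_(i < n) (2 ^- k : R) = _); last first.
  by rewrite sumr_const card_ord mulr_natl.
apply: ler_sum => i _; rewrite !mxE; apply: ltW; exact: (dyadic_cube_ball Cx Cy).
Qed.

(** A cube of side l has diameter at most n l. *)
Lemma dyadic_gauge k z (c := fine (omega n) * (n%:R / 2) ^+ n) :
  (hausdorff_gauge n (@dyadic_cube R n k z) <= c%:E * leb n (@dyadic_cube R n k z))%E.
Proof.
rewrite leb_dyadic_cube /hausdorff_gauge; case: asboolP => [[x Cx]|_]; last first.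
  rewrite -EFinM lee_fin !mulr_ge0// ?exprn_ge0// ?divr_ge0//.
  by rewrite fine_ge0.
rewrite -(fineK omega_fin) -!EFinM lee_fin /c -mulrA ler_wpM2l ?fine_ge0//.
rewrite -exprMn lerXn2r// ?nnegrE.
- rewrite divr_ge0// fine_ge0//; apply: ereal_sup_ubound; exists x, x; split => //.
  by rewrite subrr /enorm /edot big1 ?sqrtr0// => i _; rewrite mxE mul0r.
- by rewrite !mulr_ge0// ?invr_ge0// exprn_ge0.
rewrite mulrAC ler_pM2r ?invr_gt0//.
have h := dyadic_ediam k z.
have d0 : (0 <= ediam (@dyadic_cube R n k z))%E.
  apply: ereal_sup_ubound; exists x, x; split => //.
  by rewrite subrr /enorm /edot big1 ?sqrtr0// => i _; rewrite mxE mul0r.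
by rewrite -lee_fin fineK// ge0_fin_numE// (le_lt_trans h)// ltry.
Qed.

(** An open set of small measure around N is a disjoint union of dyadic cubes of small diameter, and
    the gauge of a cube is at most a constant times its volume. *)
Lemma negligible_hausdorff (N : set 'rV[R]_n) : (leb n).-negligible N -> hausdorff n N = 0%E.
Proof.
move=> N0; apply/eqP; rewrite eq_le; apply/andP; split; last first.
  apply: ereal_sup_ge; exists (hausdorff_delta n 1 N); first by exists 1 => /=.
  apply: le_ereal_inf_tmp => _ [C _ <-]; apply: nneseries_ge0 => k _ _.
  exact: hausdorff_gauge_ge0.
apply: ge_ereal_sup => _ [d /= d0 <-].
pose c : R := fine (omega n) * (n%:R / 2) ^+ n.
have c0 : 0 <= c by rewrite mulr_ge0// ?fine_ge0// exprn_ge0// divr_ge0.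
apply/lee_addgt0Pr => e e0; rewrite add0e.
have [U [oU NO leO]] := negligible_open_cover N0 (divr_gt0 e0 (ltr_wpDl c0 ltr01)).
have d1 : 0 < d / n.+1%:R by rewrite divr_gt0.
have [K hK] := exp2V_small d1.
have [s [sP trs cov]] := @dyadic_maximal R n
  (fun k z => (K <= k)%N /\ dyadic_cube k z `<=` U).
pose C j := if s j is Some (k, z) then @dyadic_cube R n k z else set0.
have mC j : measurable (C j).
  by rewrite /C; case: (s j) => [[k z]|//]; exact: measurable_dyadic_cube.
apply: (@le_trans _ _ (\sum_(0 <= j <oo) hausdorff_gauge n (C j))%E).
  apply: ereal_inf_lbound; exists C => //; split.
    move=> x /NO Ox; have [k Kk kO] := open_dyadic K oU Ox.
    have [|j [k' [z' [sj _ sub]]]] := cov k (dyadic_code k x) (conj Kk kO).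
      by exists x.
    by exists j => //; rewrite /C sj; apply: sub.
  move=> j; rewrite /C; case Ej : (s j) => [[k z]|]; last first.
    rewrite /ediam (_ : [set _ | _] = set0) ?ereal_sup0 ?leNye//.
    by apply/seteqP; split => // x [y [z []]].
  apply: le_trans (dyadic_ediam _ _) _; rewrite lee_fin.
  have [Kk _] := sP _ _ _ Ej; have := le_lt_trans (exp2V_le Kk) hK.
  rewrite ltr_pdivlMr// => h; apply/ltW; apply: le_lt_trans h.
  by rewrite mulrC ler_wpM2l ?invr_ge0 ?exprn_ge0// ler_nat.
apply: (@le_trans _ _ (\sum_(0 <= j <oo) c%:E * leb n (C j))%E).
  apply: lee_nneseries => [j _ _|j _]; first exact: hausdorff_gauge_ge0.
  rewrite /C; case: (s j) => [[k z]|]; first exact: dyadic_gauge.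
  by rewrite measure0 mule0 /hausdorff_gauge; case: asboolP => // -[].
rewrite nneseriesZl// -measure_bigcupT//.
apply: (@le_trans _ _ (c%:E * leb n U)%E).
  apply: lee_wpmul2l; first by rewrite lee_fin.
  apply: le_measure; rewrite ?inE.
  - exact: bigcup_measurable.
  - exact: open_measurable_rV.
  - move=> x [j _]; rewrite /C; case Ej : (s j) => [[k z]|//].
    by have [_] := sP _ _ _ Ej; apply.
apply: (@le_trans _ _ (c%:E * (e / (c + 1))%:E)%E).
  by apply: lee_wpmul2l => //; rewrite lee_fin.
rewrite -EFinM lee_fin mulrCA ler_piMr ?(ltW e0)// ler_pdivrMr ?ltr_wpDl// mul1r.
by rewrite lerDl.
Qed.

End null_hausdorff.

(** * Lebesgue points *)

Lemma negligible_small d (T : measurableType d) {R : realType}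
    (mu : {measure set T -> \bar R}) (A : set T) :
  (forall e : R, 0 < e -> exists B, [/\ measurable B, A `<=` B & (mu B <= e%:E)%E]) ->
  mu.-negligible A.
Proof.
move=> h.
have /choice[B hB] : forall k : nat, exists B, [/\ measurable B, A `<=` B &
    (mu B <= (k.+1%:R^-1)%:E)%E].
  by move=> k; apply: h; rewrite invr_gt0.
exists (\bigcap_k B k); split.
- by apply: bigcapT_measurable => k; have [] := hB k.
- apply/eqP; rewrite eq_le measure_ge0 andbT; apply/lee_addgt0Pr => e e0.
  rewrite add0e; have [k] := ltr_add_invr e0; rewrite add0r => /ltW ke.
  have [mB AB lek] := hB k.
  apply: (@le_trans _ _ (mu (B k))); last by apply: le_trans lek _; rewrite lee_fin.
  apply: le_measure; rewrite ?inE//; last by move=> x; exact.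
  by apply: bigcapT_measurable => j; have [] := hB j.
- by move=> x Ax k _; have [_ + _] := hB k; exact.
Qed.

Lemma integrable_cst_fin d (T : measurableType d) {R : realType}
    (mu : {measure set T -> \bar R}) (A : set T) (k : R) :
  measurable A -> (mu A < +oo)%E -> mu.-integrable A (EFin \o cst k).
Proof.
move=> mA Aoo; apply/integrableP; split; first exact/measurable_EFinP/measurable_cst.
by rewrite /= integral_cst//= lte_mul_pinfty// lee_fin.
Qed.

Section neighbours.
Context {R : realType} {n : nat}.
Implicit Types (x y : 'rV[R]_n) (k : nat).

(** The 3^n dyadic cubes of generation k that surround the cube of x; they cover the balls centred
    at x of radius at most 2^-k. *)
Definition nbr k x (E : {ffun 'I_n -> 'I_3}) : 'rV[int]_n :=
  \row_i (dyadic_code k x ord0 i + (E i)%:Z - 1).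

Lemma nbr_inj k x : injective (nbr k x).
Proof.
move=> E E' /rowP h; apply/ffunP => i; apply/val_inj => /=.
by have := h i; rewrite !mxE => /addIr/addrI [].
Qed.

Lemma ball_sub_nbr k x y r : r <= 2 ^- k -> ball x r y ->
  exists E, dyadic_cube k (nbr k x E) y.
Proof.
move=> rk [r0 h].
have k0 : 0 < (2 : R) ^+ k by rewrite exprn_gt0.
have hi (i : 'I_n) : exists j : 'I_3, Num.floor (2 ^+ k * y ord0 i) =
   Num.floor (2 ^+ k * x ord0 i) + j%:Z - 1.
  have : `|2 ^+ k * x ord0 i - 2 ^+ k * y ord0 i| < 1.
    rewrite -mulrBr normrM (gtr0_norm k0) mulrC -ltr_pdivlMr// div1r.
    by apply: lt_le_trans rk; exact: (h ord0 i).
  move: (_ * x _ _) (_ * y _ _) => a b.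
  have := floor_itv a; have := floor_itv b.
  move: (Num.floor a) (Num.floor b) => u v.
  rewrite !intrD ltr_distl => /andP[b1 b2] /andP[a1 a2] /andP[ab1 ab2].
  have h1 : v < u + 2 by rewrite -(ltr_int R) intrD; lra.
  have h2 : u < v + 2 by rewrite -(ltr_int R) intrD; lra.
  exists (inord (absz (v - u + 1))); rewrite inordK; lia.
have /choice[E hE] := hi.
by exists [ffun i => E i]; apply/rowP => i; rewrite !mxE ffunE; exact: hE.
Qed.

Lemma nbr_close k x y E : dyadic_cube k (nbr k x E) y ->
  forall i, `|x ord0 i - y ord0 i| < 2 * 2 ^- k.
Proof.
have k0 : 0 < (2 : R) ^+ k by rewrite exprn_gt0.
move=> /rowP h i; have := h i; rewrite !mxE => {}h.
rewrite ltr_pdivlMr// mulrC -[X in X * _](gtr0_norm k0) -normrM mulrBr.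
move: h; have := floor_itv (2 ^+ k * x ord0 i); have := floor_itv (2 ^+ k * y ord0 i).
move: (_ * x _ _) (_ * y _ _) => a b.
move: (Num.floor a) (Num.floor b) => u v.
move=> /andP[b1 b2] /andP[a1 a2] vE.
have E2 : ((E i : nat)%:R : R) <= 2 by rewrite ler_nat -ltnS ltn_ord.
have E0 : 0 <= ((E i : nat)%:R : R) by [].
move: b1 b2; rewrite vE !intrD [(_%:Z)%:~R]/= => b1 b2.
by rewrite ltr_distl; apply/andP; split; lra.
Qed.

End neighbours.

Section L1loc.
Context {R : realType} {n : nat}.
Implicit Types (f : 'rV[R]_n -> R) (x y : 'rV[R]_n).

Definition cbox (N : R) : set 'rV[R]_n := [set y | forall i, y ord0 i \in `[- N, N]].

Lemma cbox_compact N : compact (cbox N).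
Proof.
apply: (@rV_compact _ n (fun=> `[- N, N]%classic)).
by move=> _; exact: segment_compact.
Qed.

Lemma compact_closed_rV (K : set 'rV[R]_n) : compact K -> closed K.
Proof. by apply: compact_closed; exact: norm_hausdorff. Qed.

Lemma compact_measurable_rV (K : set 'rV[R]_n) : compact K -> measurable K.
Proof. by move=> /compact_closed_rV/closed_measurable_rV. Qed.

Lemma coord_le_norm x i : `|x ord0 i| <= `|x|.
Proof.
apply/ler_addgt0Pr => e e0; have : ball x (`|x| + e) (0 : 'rV[R]_n).
  by rewrite -ball_normE/= subr0 ltrDl.
by move=> [_ /(_ ord0 i)]; rewrite /ball/= !mxE subr0 => /ltW.
Qed.

Lemma bounded_sub_cbox (A : set 'rV[R]_n) : bounded_set A ->
  exists N : nat, A `<=` cbox N%:R.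
Proof.
move=> [M [_ hM]]; exists (Num.truncn (M + 1)).+1 => x Ax i.
have h : `|x| <= M + 1 by apply: hM Ax; rewrite ltrDl.
rewrite in_itv/= -ler_norml; apply: le_trans (coord_le_norm x i) _.
by apply: le_trans h _; apply/ltW/truncnS_gt.
Qed.

Lemma ball_sub_cbox x r : exists N : nat, ball x r `<=` cbox N%:R.
Proof.
apply: bounded_sub_cbox; exists (`|x| + `|r|); split => //= M hM y.
rewrite -ball_normE/= distrC => xy; apply: le_trans (ltW hM).
rewrite -(subrK x y) (le_trans (ler_normD _ _))// addrC lerD2l.
by apply: le_trans (ltW xy) _; exact: ler_norm.
Qed.

Lemma compact_sub_cbox (K : set 'rV[R]_n) : compact K -> exists N : nat, K `<=` cbox N%:R.
Proof. by move=> /compact_bounded; exact: bounded_sub_cbox. Qed.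

Lemma L1loc_cbox f : measurable_fun setT f ->
  (forall N : nat, (leb n).-integrable (cbox N%:R) (EFin \o f)) -> L1loc f.
Proof.
move=> mf h; split => // K cK; have [N KN] := compact_sub_cbox cK.
apply: integrableS (h N) => //; apply: compact_measurable_rV => //.
exact: cbox_compact.
Qed.

Lemma L1loc_integrable_cbox f N : L1loc f -> (leb n).-integrable (cbox N) (EFin \o f).
Proof. by move=> [_]; apply; exact: cbox_compact. Qed.

Lemma measurable_cbox N : measurable (cbox N).
Proof. by apply: compact_measurable_rV; exact: cbox_compact. Qed.

Lemma L1loc_integrable_ball f x r : L1loc f -> (leb n).-integrable (ball x r) (EFin \o f).
Proof.
move=> lf; have [N h] := ball_sub_cbox x r.
apply: integrableS (L1loc_integrable_cbox N%:R lf) => //.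
- exact: measurable_cbox.
- exact: measurable_ball_rV.
Qed.

Lemma cbox_cover x : exists N : nat, cbox N%:R x.
Proof. by have [N h] := ball_sub_cbox x 1; exists N; apply: h; exact: ballxx. Qed.

End L1loc.

Section lebesgue_points.
Context {R : realType} {n : nat}.
Variable F : 'rV[R]_n -> R.
Hypothesis F1 : L1loc F.
Let mF : measurable_fun setT F := F1.1.
Local Notation mu := (@leb R n).

(** 30 = 3 * 5 * 2: one of the 3^n neighbouring cubes carries its share of the integral, cubes are
    enlarged 5 times, and their side is at most twice the radius of the ball. *)
Definition leb_const : R := 2 * 30 ^+ n.

Section bad_set.
Variables (N : nat) (q e : R).
Hypothesis e0 : 0 < e.
Let W := ball (0 : 'rV[R]_n) N.+1%:R.
Let rho (A : set 'rV[R]_n) := (\int[mu]_(y in A) `|F y - q|%:E)%E.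
Let S := W `&` [set x | `|F x - q| < e].

(** The obstruction to being a Lebesgue point, with the value F x replaced by a number q near it, so
    that countably many such sets are enough. *)
Definition bad_set := S `&` [set x | forall d, 0 < d -> exists r,
  [/\ 0 < r, r < d & ((leb_const * e * r ^+ n)%:E < rho (ball x r))%E]].

Let mFq : measurable_fun setT (fun y => `|F y - q|).
Proof.
apply: measurableT_comp => //; apply: measurable_funB => //; exact: measurable_cst.
Qed.

Let mEFq A : measurable_fun A (fun y => `|F y - q|%:E).
Proof. by apply/measurable_EFinP; exact: measurable_funTS. Qed.

Let mW : measurable W. Proof. exact: measurable_ball_rV. Qed.

Let mS : measurable S.
Proof.
apply: measurableI => //; rewrite -[X in measurable X]setTI.
have -> : [set x | `|F x - q| < e] = (fun y => `|F y - q|) @^-1` `]-oo, e[.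
  by apply/seteqP; split => x; rewrite /= in_itv.
exact: mFq.
Qed.

Let iFq : mu.-integrable W (fun y => `|F y - q|%:E).
Proof.
apply: (@integrable_norm _ _ _ mu _ (fun y => F y - q)).
apply: (@integrableB _ _ _ mu W mW (EFin \o F) (EFin \o cst q)).
  exact: L1loc_integrable_ball.
by apply: integrable_cst_fin => //; exact: leb_ball_fin.
Qed.

Lemma rho_abs_cont (eta : R) : 0 < eta -> exists2 d : R, 0 < d &
  forall B, measurable B -> B `<=` W -> (mu B < d%:E)%E -> (rho B <= eta%:E)%E.
Proof.
move=> eta0.
have ig : mu.-integrable setT (EFin \o ((fun y => F y - q) \_ W)).
  have : mu.-integrable W (EFin \o (fun y => F y - q)).
    apply: (@integrableB _ _ _ mu W mW (EFin \o F) (EFin \o cst q)).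
      exact: L1loc_integrable_ball.
    by apply: integrable_cst_fin => //; exact: leb_ball_fin.
  by move/(integrable_mkcond _ mW); rewrite restrict_EFin.
have [d [d0 hd]] := integral_normr_continuous ig eta0.
exists d => // B mB BW /(hd _ mB) /ltW.
rewrite -lee_fin; apply: le_trans; rewrite /Rintegral fineK.
  rewrite le_eqVlt; apply/orP; left; apply/eqP; apply: eq_integral => x /set_mem xB.
  by rewrite patchE mem_set//; exact: BW.
rewrite ge0_fin_numE ?integral_ge0//.
have /integrableP[_] := ig; apply: le_lt_trans.
apply: ge0_subset_integral => //.
by do 2 apply: measurableT_comp => //; case/integrableP : ig => /measurable_EFinP.
Qed.

Lemma rho_sub A B : measurable A -> measurable B -> A `<=` B -> (rho A <= rho B)%E.
Proof. by move=> mA mB AB; apply: ge0_subset_integral => //; exact: mEFq. Qed.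

Lemma rho_S A : measurable A -> A `<=` S -> (rho A <= e%:E * mu A)%E.
Proof.
move=> mA AS; rewrite -integral_cst//; apply: ge0_le_integral => //.
by move=> x /AS [_ /= h]; rewrite lee_fin ltW.
Qed.

Lemma rho_nbr k x r : r <= 2 ^- k ->
  (rho (ball x r) <= \sum_E rho (dyadic_cube k (nbr k x E)))%E.
Proof.
move=> rk; pose D := \big[setU/set0]_(E <- enum {: {ffun 'I_n -> 'I_3}}) @dyadic_cube R n k (nbr k x E).
have mD : measurable D by apply: bigsetU_measurable => E _; exact: measurable_dyadic_cube.
apply: (@le_trans _ _ (rho D)).
  apply: rho_sub => //; first exact: measurable_ball_rV.
  move=> y /(ball_sub_nbr rk)[E yE]; rewrite /D -bigcup_seq; exists E => //=.
  by rewrite mem_enum.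
rewrite /rho /D ge0_integral_bigsetU//= ?enum_uniq//.
- by rewrite big_enum.
- by move=> E; exact: measurable_dyadic_cube.
- apply/trivIsetP => E E' _ _ EE'; apply/seteqP; split => // y [].
  by rewrite /dyadic_cube/= => -> /nbr_inj; apply/eqP.
Qed.

(** Around a bad point some dyadic cube carries much more than its share of the integral of |F - q|.
    The disjoint maximal cubes of this kind, enlarged 5 times, still cover the bad set; their total
    volume is controlled by the integral of |F - q| over a neighbourhood of A, which is close to the
    integral over A, where |F - q| < e. *)
Lemma bad_set_half (A : set 'rV[R]_n) (eta : R) : 0 < eta -> measurable A ->
  bad_set `<=` A -> A `<=` S ->
  exists A', [/\ measurable A', bad_set `<=` A', A' `<=` S &
    (mu A' <= 2^-1%:E * mu A + eta%:E)%E].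
Proof.
move=> eta0 mA TA AS.
have AW : A `<=` W by move=> x /AS[].
have eta'0 : 0 < 2 * e * eta by rewrite !mulr_gt0.
have [d d0 hd] := rho_abs_cont eta'0.
have fin : (mrestr mu mW setT < +oo)%E by rewrite /mrestr setTI leb_ball_fin.
have [K [U0 [cK oU0 KA AU0 KU0]]] := measurable_regular fin mA d0.
pose U := U0 `&` W.
have oU : open U by apply: openI => //; exact: ball_open.
have mU := open_measurable_rV oU.
have UA : (rho U <= rho A + (2 * e * eta)%:E)%E.
  have AU : U = A `|` (U `\` A).
    by rewrite setDE setUIr setUCr setIT setUidr// => x Ax; split; [exact: AU0|exact: AW].
  rewrite AU /rho ge0_integral_setU//.
  - rewrite leeD2l//; apply: hd.
    + exact: measurableD.
    + by move=> x [[]].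
    + apply: le_lt_trans KU0; rewrite /mrestr; apply: le_measure; rewrite ?inE.
      * exact: measurableD.
      * apply: measurableI => //; apply: measurableD.
          exact: open_measurable_rV.
        exact: closed_measurable_rV.
      * by move=> x [[Ux Wx] Ax]; split => //; split => // /KA.
  - exact: measurableD.
  - by apply/disj_setPS => x [Ax []].
pose c : R := 2 * 5 ^+ n * e.
have c0 : 0 < c by rewrite !mulr_gt0// exprn_gt0.
have [s [sP trs cov]] := @dyadic_maximal R n (fun k z =>
  dyadic_cube k z `<=` U /\ ((c * (2 ^- k) ^+ n)%:E < rho (dyadic_cube k z))%E).
pose C j := if s j is Some (k, z) then @dyadic_cube R n k z else set0.
pose C5 j := if s j is Some (k, z) then
  hbox (\row_i (((z ord0 i)%:~R - 2) * 2 ^- k : R)) (5 * 2 ^- k) else set0.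
have mC j : measurable (C j).
  by rewrite /C; case: (s j) => [[k z]|//]; exact: measurable_dyadic_cube.
have mC5 j : measurable (C5 j).
  by rewrite /C5; case: (s j) => [[k z]|//]; exact: measurable_hbox.
have CU j : C j `<=` U.
  by rewrite /C; case Ej : (s j) => [[k z]|//]; have [] := sP _ _ _ Ej.
have C5rho j : (mu (C5 j) <= (2 * e)^-1%:E * rho (C j))%E.
  rewrite /C5 /C; case Ej : (s j) => [[k z]|]; last first.
    by rewrite measure0 /rho integral_set0 mule0.
  have [_ /ltW h] := sP _ _ _ Ej.
  have h5 : 0 <= 5 * 2 ^- k :> R by rewrite mulr_ge0// invr_ge0 exprn_ge0.
  rewrite leb_hbox//.
  apply: le_trans (lee_wpmul2l _ h); last by rewrite lee_fin invr_ge0 mulr_ge0// ltW.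
  rewrite -EFinM lee_fin exprMn /c le_eqVlt; apply/orP; left; apply/eqP.
  by field; rewrite ?lt0r_neq0// exprn_gt0.
exists (S `&` \bigcup_j C5 j); split.
- by apply: measurableI => //; exact: bigcup_measurable.
- move=> x Tx; split; first by case: Tx.
  have Ux : U x by split; [exact/AU0/TA|exact/AW/TA].
  have : nbhs x U by exact: open_nbhs_nbhs.
  rewrite -(@nbhs_ballE R) => -[b /= b0 xbU].
  have [d1 [d10 d1b d11]] : exists d1 : R, [/\ 0 < d1, 4 * d1 <= b & d1 <= 1].
    exists (Num.min (b / 4) 1); split.
    - by rewrite lt_min divr_gt0/=.
    - by rewrite mulrC -ler_pdivlMr// ge_min lexx.
    - by rewrite ge_min lexx orbT.
  have [_ /(_ _ d10)[r [r0 rd1 hr]]] := Tx.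
  have r1 : r < 1 by exact: lt_le_trans d11.
  have ex : exists k, (2 : R) ^- k.+1 <= r.
    have [k /ltW hk] := exp2V_small r0; exists k; apply: le_trans hk.
    exact: exp2V_le.
  pose k := ex_minn ex.
  have [k1 k2] : (2 : R) ^- k.+1 <= r /\ r <= 2 ^- k.
    rewrite /k; case: ex_minnP => -[|m] hm hmin; split => //.
      by rewrite expr0 invr1 ltW.
    by rewrite leNgt; apply/negP => /ltW/hmin; rewrite ltnn.
  have k3 : (2 : R) ^- k <= 2 * r.
    by rewrite -ler_pdivrMl// -invfM -exprS.
  (* otherwise the 3^n neighbours together carry too little *)
  have [E hE] : exists E, ((c * (2 ^- k) ^+ n)%:E < rho (dyadic_cube k (nbr k x E)))%E.
    apply/not_existsP => h; move: hr; apply/negP; rewrite -leNgt.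
    apply: le_trans (rho_nbr _ k2) _.
    apply: (@le_trans _ _ (\sum_(E : {ffun 'I_n -> 'I_3}) (c * (2 ^- k) ^+ n)%:E)%E).
      by apply: lee_sum => E _; rewrite leNgt; apply/negP; exact: h.
    rewrite sumEFin lee_fin sumr_const card_ffun !card_ord -[X in X <= _]mulr_natl natrX.
    rewrite /c /leb_const.
    have -> : 2 * 30 ^+ n * e * r ^+ n = (3%:R ^+ n) * (2 * 5 ^+ n * e * (2 * r) ^+ n).
      have -> : (30 : R) = 3 * 5 * 2 by rewrite -!natrM.
      by rewrite !exprMn; ring.
    rewrite ler_wpM2l ?exprn_ge0// ler_wpM2l//; first by rewrite !mulr_ge0 ?exprn_ge0// ltW.
    by rewrite lerXn2r// ?nnegrE ?invr_ge0 ?exprn_ge0// mulr_ge0// ltW.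
  have EU : dyadic_cube k (nbr k x E) `<=` U.
    move=> y /nbr_close hy; apply: xbU; apply/ball_rVP => // i.
    by have := hy i; move: (2 ^- k) k3 => q' k3; lra.
  have [y Ey] : @dyadic_cube R n k (nbr k x E) !=set0.
    apply/set0P/eqP => E0; move: hE; rewrite E0 /rho integral_set0 lte_fin.
    by rewrite ltNge mulr_ge0 ?exprn_ge0 ?invr_ge0 ?exprn_ge0// ltW.
  have [|j [k' [z' [sj k'k sub]]]] := cov k _ (conj EU hE); first by exists y.
  exists j => //; rewrite /C5 sj => i; rewrite mxE.
  have := sub _ Ey; rewrite dyadic_cubeE => /(_ i); rewrite mxE => /andP[z1 z2].
  have := nbr_close Ey i; rewrite ltr_distl => /andP[y1 y2].
  have := exp2V_le (R := R) k'k.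
  move: z1 z2 y1 y2; rewrite mulrBl.
  by move: (2 ^- k) (2 ^- k') => u v z1 z2 y1 y2 uv; apply/andP; split; lra.
- by move=> x [].
- apply: (@le_trans _ _ (\sum_(0 <= j <oo) mu (C5 j))%E).
    apply: measure_sigma_subadditive => //.
    by apply: measurableI => //; exact: bigcup_measurable.
  apply: (@le_trans _ _ (\sum_(0 <= j <oo) (2 * e)^-1%:E * rho (C j))%E).
    by apply: lee_nneseries.
  have e2 : 0 <= (2 * e)^-1 by rewrite invr_ge0 mulr_ge0// ltW.
  rewrite nneseriesZl; last by move=> j _; exact: integral_ge0.
  rewrite /rho -ge0_integral_bigcup//.
  apply: (@le_trans _ _ ((2 * e)^-1%:E * rho U)%E).
    apply: lee_wpmul2l; first by rewrite lee_fin.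
    apply: rho_sub => //; first exact: bigcup_measurable.
    by move=> x [j _]; exact: CU.
  apply: (@le_trans _ _ ((2 * e)^-1%:E * (e%:E * mu A + (2 * e * eta)%:E))%E).
    apply: lee_wpmul2l; first by rewrite lee_fin.
    by apply: le_trans UA _; rewrite leeD2r//; exact: rho_S.
  rewrite ge0_muleDr ?mule_ge0 ?lee_fin ?(ltW e0)//; last by rewrite !mulr_ge0// ltW.
  rewrite muleA -!EFinM.
  have -> : (2 * e)^-1 * e = 2^-1 by field; rewrite lt0r_neq0.
  have -> : (2 * e)^-1 * (2 * e * eta) = eta by field; rewrite lt0r_neq0.
  by [].
Qed.

(** If the infimum of the measures of the sets A between the bad set and S were positive,
    [bad_set_half] would go below it. *)
Lemma bad_set_negligible : mu.-negligible bad_set.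
Proof.
have Sfin : (mu S < +oo)%E.
  apply: le_lt_trans (leb_ball_fin (0 : 'rV[R]_n) N.+1%:R).
  by apply: le_measure; rewrite ?inE//; exact: subIsetl.
pose V : set R := [set fine (mu A) | A in [set A | [/\ measurable A, bad_set `<=` A & A `<=` S]]].
have finA A : measurable A -> A `<=` S -> mu A \is a fin_num.
  move=> mA AS; rewrite ge0_fin_numE//; apply: le_lt_trans Sfin.
  by apply: le_measure; rewrite ?inE.
have V0 : V !=set0.
  by exists (fine (mu S)), S => //; split => // x [].
have Vlb : lbound V 0 by move=> _ [A _ <-]; exact: fine_ge0.
have hV : has_inf V by split => //; exists 0.
have inf0 : inf V <= 0.
  rewrite leNgt; apply/negP => i0.
  have i4 : 0 < inf V / 4 by rewrite divr_gt0.
  have [_ [A [mA TA AS] <-] hA] := inf_adherent i4 hV.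
  have [A' [mA' TA' AS' hA']] := bad_set_half i4 mA TA AS.
  have : inf V <= fine (mu A') by apply: ge_inf; [exists 0|exists A'].
  move: hA'; rewrite -(fineK (finA _ mA AS)) -(fineK (finA _ mA' AS')) -EFinM -EFinD lee_fin.
  move: (inf V) i0 hA => v i0 /=.
  by move: (fine (mu A)) (fine (mu A')) => a a'; lra.
apply: negligible_small => d d0.
have [_ [A [mA TA AS] <-] hA] := inf_adherent d0 hV.
exists A; split => //; rewrite -[leLHS]fineK ?finA// lee_fin.
by apply/ltW/(lt_le_trans hA); rewrite gerDr.
Qed.

End bad_set.

Lemma lebesgue_point_ae : {ae mu, forall x, forall e : R, 0 < e ->
  exists2 d : R, 0 < d & forall r, 0 < r -> r < d ->
    (\int[mu]_(y in ball x r) `|F y - F x|%:E <= (e * r ^+ n)%:E)%E}.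
Proof.
pose B (i : nat) := let t := odflt (0%N, 0 : rat, 0%N) (pickle_inv i) in
  bad_set t.1.1 (ratr t.1.2) (t.2.+1%:R^-1).
have B0 i : mu.-negligible (B i) by apply: bad_set_negligible; rewrite invr_gt0.
apply: negligibleS (negligible_bigcup B0) => x /= hx.
apply: contrapT => nB; apply: hx => e e0.
pose C : R := leb_const + 2 ^+ n.
have C0 : 0 < C by rewrite addr_gt0// ?exprn_gt0// mulr_gt0// exprn_gt0.
have [m] := ltr_add_invr (divr_gt0 e0 C0); rewrite add0r => hm.
set eps := m.+1%:R^-1 in hm; have eps0 : 0 < eps by rewrite invr_gt0.
have [q /andP[q1 q2]] : exists q : rat, F x - eps < ratr q < F x + eps.
  have h : F x - eps < F x + eps by lra.
  have [q] := rat_in_itvoo h; rewrite in_itv/= => hq; by exists q.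
have [N hN] := ball_cover_rV x.
have : ~ bad_set N (ratr q) eps x.
  by move=> h; apply: nB; exists (pickle (N, q, m)) => //; rewrite /B pickleK_inv.
have Fq : `|F x - ratr q| < eps by rewrite ltr_distlC; apply/andP; split; lra.
move=> /not_andP[[]|]; first by split.
move=> /existsNP[d] /not_implyP[d0] /forallNP h.
exists d => // r r0 rd.
have {}h : (\int[mu]_(y in ball x r) `|F y - ratr q|%:E <= (leb_const * eps * r ^+ n)%:E)%E.
  by rewrite leNgt; apply/negP => h'; apply: (h r).
have mB := measurable_ball_rV x r.
have mFF : measurable_fun (ball x r) F by exact: measurable_funTS.
apply: (@le_trans _ _ (\int[mu]_(y in ball x r) (`|F y - ratr q|%:E + cst eps%:E y))%E).
  apply: ge0_le_integral => //.
  - apply/measurable_EFinP; apply: measurableT_comp => //.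
    by apply: measurable_funB => //; exact: measurable_cst.
  - apply: emeasurable_funD => //; apply/measurable_EFinP; apply: measurableT_comp => //.
    by apply: measurable_funB => //; exact: measurable_cst.
  - move=> y _; rewrite /= -EFinD lee_fin.
    rewrite (_ : F y - F x = (F y - ratr q) + (ratr q - F x)); last by ring.
    by apply: le_trans (ler_normD _ _) _; rewrite lerD2l distrC ltW.
rewrite ge0_integralD//.
- rewrite integral_cst//=.
  apply: (@le_trans _ _ ((leb_const * eps * r ^+ n)%:E + eps%:E * ((2 * r) ^+ n)%:E)%E).
    apply: leeD => //; apply: lee_wpmul2l; first by rewrite lee_fin ltW.
    exact: leb_ball_le.
  rewrite -EFinM -EFinD lee_fin exprMn.
  have -> : leb_const * eps * r ^+ n + eps * (2 ^+ n * r ^+ n) = (C * eps) * r ^+ n.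
    by rewrite /C; ring.
  rewrite ler_wpM2r ?exprn_ge0 ?(ltW r0)// mulrC -ler_pdivlMr//.
  exact: ltW.
- apply/measurable_EFinP; apply: measurableT_comp => //.
  by apply: measurable_funB => //; exact: measurable_cst.
- by move=> y _; rewrite lee_fin ltW.
Qed.

End lebesgue_points.

(** * C^1 test functions *)

Section directional.
Context {R : realType} {V : normedModType R}.
Implicit Types (f : V -> R) (x v : V).

(** Squares of positive parts and squared distances have a quadratic remainder on every line, and
    they are the building blocks of the test functions. *)
Lemma is_derive_quad f x v (d C : R) :
  (forall h : R, `|f (h *: v + x) - f x - h * d| <= C * h ^+ 2) -> is_derive x v f d.
Proof.
move=> hq.
have C0 : 0 <= C by have := hq 1; rewrite expr1n mulr1; exact: le_trans.
have cv : (fun h : R => h^-1 *: ((f \o shift x) (h *: v) - f x)) @ 0^' --> d.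
  apply/cvgrPdist_le => /= e e0; near=> h.
  have h0 : h != 0 by near: h; exact: nbhs_dnbhs_neq.
  have he : `|h| < e / (C + 1).
    by near: h; apply: dnbhs0_lt; rewrite divr_gt0// ltr_wpDl.
  rewrite -normrN opprB.
  have -> : h^-1 *: (f (h *: v + x) - f x) - d = h^-1 * (f (h *: v + x) - f x - h * d).
    by rewrite [RHS]mulrBr mulKf.
  rewrite normrM normfV mulrC ler_pdivrMr ?normr_gt0//.
  apply: le_trans (hq h) _; rewrite -real_normK ?num_real// expr2 mulrA.
  rewrite ler_wpM2r//; move: he; rewrite ltr_pdivlMr ?ltr_wpDl// => he.
  by apply: ltW; apply: le_lt_trans he; rewrite mulrC ler_wpM2l// lerDl.
split; last exact: cvg_lim.
by apply/cvg_ex; exists d.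
Unshelve. all: by end_near. Qed.

Lemma is_derive_line f x v (h0 d : R) : is_derive (h0 *: v + x) v f d ->
  is_derive h0 1 (fun h : R => f (h *: v + x)) d.
Proof.
move=> [df fd].
have E : (fun h : R => h^-1 *: (((fun h => f (h *: v + x)) \o shift h0) (h *: (1 : R)) - f (h0 *: v + x))) =
         (fun h : R => h^-1 *: ((f \o shift (h0 *: v + x)) (h *: v) - f (h0 *: v + x))).
  apply/funext => h /=; congr (_ *: (f _ - _)).
  by rewrite (_ : h%:A = h); [rewrite scalerDl addrA|exact: mulr1].
by split; rewrite /derivable /derive E.
Qed.

Lemma is_derive_line0 f x v (d : R) : is_derive (0 : R) 1 (fun h : R => f (h *: v + x)) d ->
  is_derive x v f d.
Proof.
move=> [df fd].
have E : (fun h : R => h^-1 *: (((fun h => f (h *: v + x)) \o shift 0) (h *: (1 : R)) - f (0 *: v + x))) =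
         (fun h : R => h^-1 *: ((f \o shift x) (h *: v) - f x)).
  apply/funext => h /=; rewrite scale0r add0r; congr (_ *: (f _ - _)).
  by rewrite (_ : h%:A = h); [rewrite addr0|exact: mulr1].
by move: df fd; rewrite /derivable /derive E.
Qed.

Lemma is_derive_comp_dir f (g : R -> R) x v (df dg : R) :
  is_derive x v f df -> is_derive (f x) 1 g dg ->
  is_derive x v (g \o f) (dg * df).
Proof.
move=> hf hg; apply: is_derive_line0.
apply: (@is_derive1_comp _ g (fun h : R => f (h *: v + x))).
  by rewrite scale0r add0r.
by apply: is_derive_line; rewrite scale0r add0r.
Qed.

End directional.

Section step.
Context {R : realType}.
Implicit Types t : R.

Definition psq t : R := Num.max t 0 ^+ 2.

(** A C^1 step from 0 on t <= -1 to 1 on t >= 0: a second difference of the square of the positive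
    part.  Its derivative is the piecewise linear [tent]. *)
Definition stepf t : R := 2 * psq (t + 1) - 4 * psq (t + 2^-1) + 2 * psq t.

Definition tent t : R :=
  4 * Num.max (t + 1) 0 - 8 * Num.max (t + 2^-1) 0 + 4 * Num.max t 0.

Lemma is_derive_psq t : is_derive t 1 psq (2 * Num.max t 0).
Proof.
apply: (@is_derive_quad _ _ _ _ _ _ 1) => h.
rewrite (_ : h *: 1 = h); last exact: mulr1.
rewrite /psq mul1r ler_norml.
by case: (leP (h + t) 0) => h1; case: (leP t 0) => h2; apply/andP; split; nra.
Qed.

Lemma is_derive_translate (f : R -> R) t a d : is_derive (t + a) 1 f d ->
  is_derive t 1 (fun t => f (t + a)) d.
Proof.
move=> h; rewrite -[d]mulr1; apply: (@is_derive1_comp _ f (fun t => t + a)) => //.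
by apply: is_derive_eq; rewrite addr0.
Qed.

Lemma is_derive_stepf t : is_derive t 1 stepf (tent t).
Proof.
have h1 := is_derive_translate (is_derive_psq (t + 1)).
have h2 := is_derive_translate (is_derive_psq (t + 2^-1)).
have h3 := is_derive_psq t.
rewrite /stepf; apply: is_derive_eq.
by rewrite /tent /GRing.scale/=; ring.
Qed.

Lemma stepf_le0 t : t <= -1 -> stepf t = 0.
Proof.
move=> t1; rewrite /stepf /psq !max_r; first by rewrite expr0n !mulr0 subrr addr0.
all: lra.
Qed.

Lemma stepf_ge1 t : 0 <= t -> stepf t = 1.
Proof.
move=> t0; rewrite /stepf /psq !max_l; first by field.
all: lra.
Qed.

Lemma stepf_ge0 t : 0 <= stepf t.
Proof.
rewrite /stepf /psq.
case: (leP (t + 1) 0) => h1; case: (leP (t + 2^-1) 0) => h2; case: (leP t 0) => h3; nra.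
Qed.

Lemma stepf_le1 t : stepf t <= 1.
Proof.
rewrite /stepf /psq.
case: (leP (t + 1) 0) => h1; case: (leP (t + 2^-1) 0) => h2; case: (leP t 0) => h3; nra.
Qed.

Lemma tent_ge0 t : 0 <= tent t.
Proof.
rewrite /tent.
case: (leP (t + 1) 0) => h1; case: (leP (t + 2^-1) 0) => h2; case: (leP t 0) => h3; lra.
Qed.

Lemma tent_ge_eq0 t : 0 <= t -> tent t = 0.
Proof.
move=> t0; rewrite /tent !max_l; first by field.
all: lra.
Qed.

Lemma tent_le_eq0 t : t <= -1 -> tent t = 0.
Proof.
move=> t1; rewrite /tent !max_r; first by rewrite !mulr0 subrr addr0.
all: lra.
Qed.

Lemma is_derive1_continuous (f df : R -> R) : (forall t, is_derive t 1 f (df t)) -> continuous f.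
Proof. by move=> h t; apply/differentiable_continuous/derivable1_diffP; case: (h t). Qed.

Lemma continuous_stepf : continuous stepf.
Proof. exact: is_derive1_continuous is_derive_stepf. Qed.

Lemma continuous_maxr0 (a : R) : continuous (fun t : R => Num.max (t + a) 0).
Proof.
move=> t; apply: (@continuous_max _ _ (fun t => t + a) (cst 0)); last exact: cst_continuous.
by apply: continuousD; [exact: id|exact: cst_continuous].
Qed.

Lemma continuous_tent : continuous tent.
Proof.
have h (a b : R) : continuous (fun t : R => a * Num.max (t + b) 0).
  move=> t; apply: (@continuousM _ _ (cst a) (fun t => Num.max (t + b) 0)).
    exact: cst_continuous.
  exact: continuous_maxr0.
move=> t; apply: (@continuousD _ _ _ (fun t => 4 * Num.max (t + 1) 0 -
   8 * Num.max (t + 2^-1) 0) (fun t => 4 * Num.max t 0)).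
  apply: (@continuousB _ _ _ (fun t => 4 * Num.max (t + 1) 0)
    (fun t => 8 * Num.max (t + 2^-1) 0)); exact: h.
rewrite (_ : (fun t => _) = (fun t : R => 4 * Num.max (t + 0) 0)); first exact: h.
by apply/funext => s; rewrite addr0.
Qed.

Lemma stepf_cvg1 t : 0 < t -> stepf (k.+1%:R * t - 1) @[k --> \oo] --> (1 : R).
Proof.
move=> t0; apply: cvg_near_cst; have [m] := ltr_add_invr t0; rewrite add0r => hm.
near=> k; apply: stepf_ge1; rewrite subr_ge0 mulrC -ler_pdivrMr// div1r.
apply: ltW; apply: le_lt_trans hm; rewrite lef_pV2 ?posrE// ler_nat.
by near: k; exists m => // k /=; rewrite ltnS.
Unshelve. all: by end_near. Qed.

Lemma stepf_cvg0 t : t <= 0 -> stepf (k.+1%:R * t - 1) @[k --> \oo] --> (0 : R).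
Proof.
move=> t0; apply: cvg_near_cst; apply: nearW => k; apply: stepf_le0.
by rewrite gerDr mulr_ge0_le0.
Qed.

End step.



Lemma tsupport_compact (T : topologicalType) (W : nmodType) (phi : T -> W) (K : set T) :
  hausdorff_space T -> compact K -> (forall x, phi x != 0 -> K x) ->
  compact (tsupport phi).
Proof.
move=> hT cK h; apply: (subclosed_compact _ cK); first exact: closed_closure.
apply: subset_trans (closure_subset h) _.
by rewrite -((closure_id K).1 (compact_closed hT cK)).
Qed.

Lemma tsupportP (T : topologicalType) (W : nmodType) (phi : T -> W) x :
  ~ tsupport phi x -> phi x = 0.
Proof.
by move=> h; apply/eqP/negPn/negP => h'; apply: h; exact: subset_closure.
Qed.

Section C1.
Context {R : realType} {n : nat}.
Implicit Types (x y : 'rV[R]_n) (i : 'I_n).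

Lemma C1cI (phi : 'rV[R]_n -> R) (dphi : 'I_n -> 'rV[R]_n -> R) (K : set 'rV[R]_n) :
  (forall i x, is_derive x (delta_mx ord0 i) phi (dphi i x)) ->
  (forall i, continuous (dphi i)) -> compact K ->
  (forall x, phi x != 0 -> K x) -> C1c phi.
Proof.
move=> h1 h2 cK h3; split; first by move=> i x; case: (h1 i x).
- move=> i; rewrite (_ : partial i phi = dphi i)//.
  by apply/funext => x; exact: derive_val.
- by apply: tsupport_compact h3 => //; exact: norm_hausdorff.
Qed.

Lemma C1c_is_derive (phi : 'rV[R]_n -> R) i x : C1c phi ->
  is_derive x (delta_mx ord0 i) phi (partial i phi x).
Proof. by move=> [h _ _]; split. Qed.

Lemma C1c_coord_lip (phi : 'rV[R]_n -> R) i z (h M : R) : C1c phi ->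
  (forall s, `|s| <= `|h| -> `|partial i phi (s *: delta_mx ord0 i + z)| <= M) ->
  `|phi (h *: delta_mx ord0 i + z) - phi z| <= M * `|h|.
Proof.
move=> c1 hM; set v := delta_mx ord0 i; pose g s := phi (s *: v + z).
have dg (s : R) : is_derive s 1 g (partial i phi (s *: v + z)).
  by apply: is_derive_line; exact: C1c_is_derive.
have cg : continuous g := is_derive1_continuous dg.
have g0 : g 0 = phi z by rewrite /g scale0r add0r.
rewrite -g0 -/(g h); have [h0|h0] := leP 0 h.
  have [c cI ->] := MVT_segment h0 (fun s _ => dg s) (continuous_subspaceT cg).
  rewrite normrM subr0 ler_wpM2r//; apply: hM.
  by move: cI; rewrite in_itv/= => /andP[c0 ch]; rewrite !ger0_norm.
have [c cI] := MVT_segment (ltW h0) (fun s _ => dg s) (continuous_subspaceT cg).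
rewrite distrC => ->; rewrite normrM sub0r normrN ler_wpM2r//; apply: hM.
by move: cI; rewrite in_itv/= => /andP[c0 ch]; rewrite !ler0_norm ?lerN2// ltW.
Qed.

(** Continuous partial derivatives are locally bounded; moving from x to y one coordinate at a time
    gives a local Lipschitz bound. *)
Lemma C1c_continuous (phi : 'rV[R]_n -> R) : C1c phi -> continuous phi.
Proof.
move=> c1; have [_ cp _] := c1 => x; apply/(@cvgrPdist_le _ R _ (nbhs x)) => /= e e0.
have [M [r [M0 r0 hM]]] : exists M r : R, [/\ 0 < M, 0 < r &
    forall i y, ball x r y -> `|partial i phi y| <= M].
  have loc i : exists Mr : R * R, [/\ 0 < Mr.1, 0 < Mr.2 &
      forall y, ball x Mr.2 y -> `|partial i phi y| <= Mr.1].
    have := cp i x => /(@cvgrPdist_lt _ R _ (nbhs x))/(_ 1 ltr01).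
    rewrite -(@nbhs_ballE R) => -[r /= r0 hr].
    exists (`|partial i phi x| + 1, r); split => //; first by rewrite /= ltr_wpDl.
    move=> y /hr /= h; rewrite -(subrK (partial i phi x) (partial i phi y)) addrC.
    by apply: le_trans (ler_normD _ _) _; rewrite lerD2l distrC ltW.
  have /choice[Mr hMr] := loc.
  exists (1 + \sum_i (Mr i).1), (\big[Num.min/1]_i (Mr i).2); split.
  - by rewrite ltr_pwDl// sumr_ge0// => i _; have [/ltW] := hMr i.
  - by apply/lt_bigmin => //= i _; have [] := hMr i.
  - move=> i y [b0 hb]; have [h1 h2 h3] := hMr i.
    have : ball x (Mr i).2 y.
      apply/ball_rVP => // j; apply: lt_le_trans (hb ord0 j) _.
      exact: bigmin_le_cond.
    move=> /h3/le_trans; apply; rewrite (bigD1 i)//= addrCA lerDl addr_ge0// sumr_ge0// => j _.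
    by have [/ltW] := hMr j.
rewrite -(@nbhs_ballE R).
pose d := Num.min r (e / (n.+1%:R * M)).
have d0 : 0 < d by rewrite lt_min r0 divr_gt0// mulr_gt0.
exists d => //= y [_ xy].
have {}xy j : `|x ord0 j - y ord0 j| < d := xy ord0 j.
(* the path from x to y that changes the coordinates in order *)
pose z (k : nat) : 'rV[R]_n := \row_j (if (j < k)%N then y ord0 j else x ord0 j).
have z0 : z 0%N = x by apply/rowP => j; rewrite mxE.
have zn : z n = y by apply/rowP => j; rewrite mxE ltn_ord.
have step k : (k <= n)%N -> `|phi x - phi (z k)| <= k%:R * (M * d).
  elim: k => [|k IH] kn; first by rewrite z0 subrr normr0 mul0r.
  rewrite -(subrK (phi (z k)) (phi x)) -addrA.
  apply: le_trans (ler_normD _ _) _; rewrite -natr1 mulrDl mul1r.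
  apply: lerD; first exact: IH (ltnW kn).
  pose i := Ordinal kn; pose h := y ord0 i - x ord0 i.
  have zk : z k.+1 = h *: delta_mx ord0 i + z k.
    apply/rowP => j; rewrite !mxE ltnS leq_eqVlt eqxx/=.
    have [->|ji] := eqVneq j i; first by rewrite /= eqxx ltnn mulr1 subrK.
    by rewrite mulr0 add0r; case: eqVneq => //= jk; move: ji; rewrite -val_eqE/= jk eqxx.
  rewrite distrC zk; apply: le_trans (C1c_coord_lip c1 (M := M) _) _.
    move=> s sh; apply: hM; apply/ball_rVP => // j; rewrite !mxE.
    apply: lt_le_trans (_ : d <= r); last by rewrite ge_min lexx.
    have [->|ji] := eqVneq j i; rewrite ?eqxx/=.
      by rewrite ltnn mulr1 opprD addrCA subrr addr0 normrN (le_lt_trans sh)// distrC.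
    by rewrite mulr0 add0r; case: ifPn => _ //; rewrite subrr normr0.
  by rewrite ler_wpM2l ?(ltW M0)// distrC ltW.
rewrite -{}[in X in _ - X]zn; apply: le_trans (step n (leqnn _)) _.
apply: (@le_trans _ _ (n.+1%:R * M * d)).
  by rewrite mulrA ler_wpM2r ?(ltW d0)// ler_wpM2r ?(ltW M0)// ler_nat.
by rewrite mulrC -ler_pdivlMr ?mulr_gt0// ge_min lexx orbT.
Qed.

End C1.

Section bumps.
Context {R : realType} {n : nat}.
Implicit Types (x y c : 'rV[R]_n) (i : 'I_n).

Definition sqd c y : R := edot (y - c) (y - c).

Lemma sqd_line c y i (h : R) : sqd c (h *: delta_mx ord0 i + y) =
  sqd c y + h * (2 * (y ord0 i - c ord0 i)) + h ^+ 2.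
Proof.
rewrite /sqd /edot (bigD1 i)//= [in RHS](bigD1 i)//=.
rewrite (eq_bigr (fun j => (y - c) ord0 j * (y - c) ord0 j)); last first.
  by move=> j ji; rewrite !mxE eqxx (negbTE ji)/= mulr0 add0r.
by rewrite !mxE !eqxx/=; ring.
Qed.

Lemma is_derive_sqd c y i : is_derive y (delta_mx ord0 i) (sqd c) (2 * (y ord0 i - c ord0 i)).
Proof.
apply: (@is_derive_quad _ _ _ _ _ _ 1) => h; rewrite sqd_line mul1r.
rewrite (_ : _ - _ - _ = h ^+ 2); last by ring.
by rewrite ger0_norm// sqr_ge0.
Qed.

(** For alpha > 0, equal to 1 where sqd c y <= rho and to 0 where sqd c y >= rho + 1 / alpha. *)
Definition cutoff (alpha rho : R) c y : R := stepf (alpha * (rho - sqd c y)).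

Definition dcutoff (alpha rho : R) c i y : R :=
  tent (alpha * (rho - sqd c y)) * (- (alpha * (2 * (y ord0 i - c ord0 i)))).

Lemma is_derive_cutoff alpha rho c i y :
  is_derive y (delta_mx ord0 i) (cutoff alpha rho c) (dcutoff alpha rho c i y).
Proof.
apply: (@is_derive_comp_dir _ _ (fun y => alpha * (rho - sqd c y)) stepf).
  have h := is_derive_sqd c y i.
  rewrite (_ : (fun y => _) = (fun y => alpha *: (cst rho y - sqd c y)))//.
  apply: is_derive_eq; rewrite sub0r /GRing.scale/=; ring.
exact: is_derive_stepf.
Qed.

Lemma continuous_sqd c : continuous (sqd c).
Proof. by move=> x; exact: continuous_edot. Qed.

Lemma continuous_alpha_sqd (alpha rho : R) c : continuous (fun y => alpha * (rho - sqd c y)).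
Proof.
move=> y; apply: (@continuousM _ _ (cst alpha) (fun y => rho - sqd c y)).
  exact: cst_continuous.
apply: (@continuousB _ _ _ (cst rho) (sqd c)); first exact: cst_continuous.
exact: continuous_sqd.
Qed.

Lemma continuous_cutoff alpha rho c : continuous (cutoff alpha rho c).
Proof.
move=> y; apply: (@continuous_comp _ _ _ (fun y => alpha * (rho - sqd c y)) stepf).
  exact: continuous_alpha_sqd.
exact: continuous_stepf.
Qed.

Lemma continuous_dcutoff alpha rho c i : continuous (dcutoff alpha rho c i).
Proof.
move=> y; apply: (@continuousM _ _ (fun y => tent (alpha * (rho - sqd c y)))
  (fun y => - (alpha * (2 * (y ord0 i - c ord0 i))))).
  apply: (@continuous_comp _ _ _ (fun y => alpha * (rho - sqd c y)) tent).
    exact: continuous_alpha_sqd.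
  exact: continuous_tent.
apply: (@continuousN _ _ _ (fun y => alpha * (2 * (y ord0 i - c ord0 i)))).
apply: (@continuousM _ _ (cst alpha) (fun y => 2 * (y ord0 i - c ord0 i))).
  exact: cst_continuous.
apply: (@continuousM _ _ (cst 2) (fun y => y ord0 i - c ord0 i)).
  exact: cst_continuous.
apply: (@continuousB _ _ _ (fun y => y ord0 i) (cst (c ord0 i))).
  exact: coord_continuous.
exact: cst_continuous.
Qed.

Lemma sqd_bounded_compact c (M : R) : compact [set y | sqd c y <= M].
Proof.
apply: bounded_closed_compact; last first.
  rewrite (_ : [set y | _] = sqd c @^-1` `]-oo, M]); last first.
    by apply/seteqP; split => y; rewrite /= in_itv.
  by apply: closed_comp; [move=> y _; exact: continuous_sqd|exact: interval_closed].
exists (`|c| + `|M| + 1); split => //= N hN y hy; apply: le_trans (ltW hN).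
have h : ball c (`|M| + 1) y.
  apply: eball_sub_ball; first by rewrite ltr_wpDl.
  rewrite /eball/= enorm_ltP ?ltr_wpDl//; apply: le_lt_trans hy _.
  apply: le_lt_trans (ler_norm M) _.
  by have := normr_ge0 M; move: `|M| => m; nra.
move: h; rewrite -ball_normE/= distrC => h.
rewrite -(subrK c y) (le_trans (ler_normD _ _))// addrC -addrA lerD2l ltW//.
Qed.

Lemma cutoff_C1c alpha rho c : 0 < alpha -> C1c (cutoff alpha rho c).
Proof.
move=> a0; apply: (C1cI (dphi := dcutoff alpha rho c) (K := [set y | sqd c y <= rho + alpha^-1])).
- by move=> i x; exact: is_derive_cutoff.
- by move=> i; exact: continuous_dcutoff.
- exact: sqd_bounded_compact.
- move=> y; apply: contraNT; rewrite -ltNge => h; apply/eqP/stepf_le0.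
  by rewrite -ler_pdivlMl// mulrN1 lerNr opprB lerBrDl ltW.
Qed.

Lemma cutoff_ge0 alpha rho c y : 0 <= cutoff alpha rho c y.
Proof. exact: stepf_ge0. Qed.

Lemma cutoff_le1 alpha rho c y : cutoff alpha rho c y <= 1.
Proof. exact: stepf_le1. Qed.

Lemma cutoff_eq1 alpha rho c y : 0 < alpha -> sqd c y <= rho -> cutoff alpha rho c y = 1.
Proof. by move=> a0 h; apply: stepf_ge1; rewrite mulr_ge0// ?subr_ge0//; exact: ltW. Qed.

(** C^1 functions that converge to the indicator of an open Euclidean ball. *)
Definition ebump (r : R) c (k : nat) : 'rV[R]_n -> R :=
  cutoff k.+1%:R (r ^+ 2 - k.+1%:R^-1) c.

Lemma ebumpE r c k y : ebump r c k y = stepf (k.+1%:R * (r ^+ 2 - sqd c y) - 1).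
Proof.
rewrite /ebump /cutoff; congr stepf; rewrite addrAC mulrBr mulfV//.
Qed.

Lemma ebump_C1c r c k : C1c (ebump r c k).
Proof. exact: cutoff_C1c. Qed.

Lemma ebump_cvg r c y : 0 < r -> ebump r c k y @[k --> \oo] --> (\1_(eball c r) y : R).
Proof.
move=> r0; under eq_fun do rewrite ebumpE.
rewrite indicE; have [h|h] := boolP (y \in _).
  apply: stepf_cvg1; rewrite subr_gt0 -enorm_ltP//; exact: set_mem.
apply: stepf_cvg0; rewrite subr_le0 leNgt -enorm_ltP//; apply/negP => h'.
by move/negP: h; apply; exact: mem_set.
Qed.

Lemma ebump_eq0 r c k y : 0 < r -> ~ eball c r y -> ebump r c k y = 0.
Proof.
move=> r0 h; rewrite ebumpE; apply: stepf_le0; rewrite gerDr pmulr_rle0// subr_le0.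
by rewrite leNgt -enorm_ltP//; exact/negP.
Qed.

End bumps.

Section splitting_calculus.
Context {R : realType} {n : nat}.
Implicit Types (x y : 'rV[R]_n.+1).

Lemma row_init_line x (h : R) (j : 'I_n) :
  row_init (h *: delta_mx ord0 (lift ord_max j) + x) = h *: delta_mx ord0 j + row_init x.
Proof. by apply/rowP => i; rewrite !mxE (inj_eq lift_inj). Qed.

Lemma row_init_line_max x (h : R) :
  row_init (h *: delta_mx ord0 ord_max + x) = row_init x.
Proof.
apply/rowP => i; rewrite !mxE [lift _ _ == _]eq_sym (negbTE (neq_lift _ _)).
by rewrite andbF mulr0 add0r.
Qed.

Lemma row_last_line x (h : R) (j : 'I_n) :
  row_last (h *: delta_mx ord0 (lift ord_max j) + x) = row_last x.
Proof. by rewrite /row_last !mxE (negbTE (neq_lift _ _)) andbF mulr0 add0r. Qed.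

Lemma row_last_line_max x (h : R) :
  row_last (h *: delta_mx ord0 ord_max + x) = h + row_last x.
Proof. by rewrite /row_last !mxE !eqxx mulr1. Qed.

Lemma is_derive_init (a : 'rV[R]_n -> R) x (j : 'I_n) d :
  is_derive (row_init x) (delta_mx ord0 j) a d ->
  is_derive x (delta_mx ord0 (lift ord_max j)) (a \o @row_init R n) d.
Proof.
move=> h; apply: is_derive_line0.
rewrite (_ : (fun h => _) = (fun h : R => a (h *: delta_mx ord0 j + row_init x))).
  by apply: is_derive_line; rewrite scale0r add0r.
by apply/funext => s /=; rewrite row_init_line.
Qed.

Lemma is_derive_init_max (a : 'rV[R]_n -> R) x :
  is_derive x (delta_mx ord0 ord_max) (a \o @row_init R n) 0.
Proof.
apply: is_derive_line0; rewrite (_ : (fun h => _) = cst (a (row_init x))).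
  exact: is_derive_cst.
by apply/funext => s /=; rewrite row_init_line_max.
Qed.

Lemma is_derive_last (th : R -> R) x (j : 'I_n) :
  is_derive x (delta_mx ord0 (lift ord_max j)) (th \o @row_last R n) 0.
Proof.
apply: is_derive_line0; rewrite (_ : (fun h => _) = cst (th (row_last x))).
  exact: is_derive_cst.
by apply/funext => s /=; rewrite row_last_line.
Qed.

Lemma is_derive_last_max (th : R -> R) x d : is_derive (row_last x) 1 th d ->
  is_derive x (delta_mx ord0 ord_max) (th \o @row_last R n) d.
Proof.
move=> h; apply: is_derive_line0.
rewrite (_ : (fun h => _) = (fun h : R => th (h + row_last x))).
  by apply: is_derive_translate; rewrite add0r.
by apply/funext => s /=; rewrite row_last_line_max.
Qed.

Lemma continuous_row_last : continuous (@row_last R n).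
Proof. by move=> x; exact: coord_continuous. Qed.

Lemma continuous_row_init : continuous (@row_init R n).
Proof.
move=> x U; rewrite -(@nbhs_ballE R) => -[e /= e0 xU].
rewrite nbhs_simpl /= -(@nbhs_ballE R); exists e => //= y [_ xy].
by apply: xU; apply/ball_rVP => // i; rewrite !mxE; exact: xy.
Qed.

Lemma C1c1P (th : R -> R) : C1c1 setT th -> forall t : R, is_derive t 1 th (th^`()%classic t).
Proof. by move=> [h _ _ _] t; split => //; rewrite derive1E. Qed.

Definition dtensor (a : 'rV[R]_n -> R) (th : R -> R) (i : 'I_n.+1) x : R :=
  if unlift ord_max i is Some j then partial j a (row_init x) * th (row_last x)
  else a (row_init x) * th^`()%classic (row_last x).

Definition tensor (a : 'rV[R]_n -> R) (th : R -> R) x : R :=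
  a (row_init x) * th (row_last x).

Lemma is_derive_tensor a th i x : C1c a -> C1c1 setT th ->
  is_derive x (delta_mx ord0 i) (tensor a th) (dtensor a th i x).
Proof.
move=> ca cth; rewrite /dtensor /tensor.
rewrite (_ : (fun x => _) = (a \o @row_init R n) * (th \o @row_last R n))//.
case: unliftP => [j ->|->].
  have h1 := is_derive_init (C1c_is_derive j (row_init x) ca).
  have h2 := is_derive_last th x j.
  by apply: is_derive_eq; rewrite scaler0 add0r /GRing.scale/= mulrC.
have h1 := is_derive_init_max a x.
have h2 := is_derive_last_max (C1c1P cth (row_last x)).
by apply: is_derive_eq; rewrite scaler0 addr0.
Qed.

Lemma row_rcons_compact (K : set 'rV[R]_n) (J : set R) : compact K -> compact J ->
  exists2 L : set 'rV[R]_n.+1, compact L &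
    forall x, K (row_init x) -> J (row_last x) -> L x.
Proof.
move=> cK cJ; have [N KN] := compact_sub_cbox cK.
have [M [_ hM]] := compact_bounded cJ.
pose P := Num.max (N%:R : R) (M + 1).
exists (cbox P); first exact: cbox_compact.
move=> x Kx Jx i; rewrite in_itv/= -ler_norml.
have [j ->|->] := unliftP ord_max i.
  have := KN _ Kx j; rewrite in_itv/= -ler_norml mxE => h.
  by apply: le_trans h _; rewrite le_max lexx.
have hM1 : M < M + 1 by rewrite ltrDl.
by apply: le_trans (hM _ hM1 _ Jx) _; rewrite le_max lexx orbT.
Qed.

Lemma C1c1_continuous (th : R -> R) : C1c1 setT th -> continuous th.
Proof. by move=> /C1c1P; exact: is_derive1_continuous. Qed.

Lemma tensor_C1c a th : C1c a -> C1c1 setT th -> C1c (tensor a th).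
Proof.
move=> ca cth; have [_ cpa sa] := ca; have [_ cdth sth _] := cth.
have [L cL hL] := row_rcons_compact sa sth.
apply: (C1cI (dphi := dtensor a th) (K := L)) => //.
- by move=> i x; exact: is_derive_tensor.
- move=> i x; rewrite /dtensor; case: unliftP => [j _|_].
    apply: (@continuousM _ _ (partial j a \o @row_init R n) (th \o @row_last R n)).
      by apply: continuous_comp; [exact: continuous_row_init|exact: cpa].
    by apply: continuous_comp; [exact: continuous_row_last|exact: C1c1_continuous].
  apply: (@continuousM _ _ (a \o @row_init R n) (th^`()%classic \o @row_last R n)).
    by apply: continuous_comp; [exact: continuous_row_init|exact: C1c_continuous].
  by apply: continuous_comp; [exact: continuous_row_last|exact: cdth].
- move=> x; rewrite /tensor mulf_eq0 negb_or => /andP[ax tx].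
  by apply: hL; exact: subset_closure.
Qed.

Lemma partial_tensor_max a th x : C1c a -> C1c1 setT th ->
  partial ord_max (tensor a th) x = a (row_init x) * th^`()%classic (row_last x).
Proof.
move=> ca cth; have h := is_derive_tensor ord_max x ca cth.
by rewrite /partial derive_val /dtensor unlift_none.
Qed.

End splitting_calculus.

(** * Test functions separate locally integrable functions *)

Lemma dct_real d (T : measurableType d) {R : realType} (mu : {measure set T -> \bar R})
    (f_ : nat -> T -> R) (f g : T -> R) :
  (forall k, measurable_fun setT (f_ k)) -> measurable_fun setT f ->
  {ae mu, forall x, f_ k x @[k --> \oo] --> f x} ->
  mu.-integrable setT (EFin \o g) ->
  {ae mu, forall x, forall k, `|f_ k x| <= g x} ->
  mu.-integrable setT (EFin \o f) /\
  (\int[mu]_x (f_ k x)%:E)%E @[k --> \oo] --> (\int[mu]_x (f x)%:E)%E.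
Proof.
move=> mf_ mf hc ig hg.
have [||||] := @dominated_convergence _ _ _ mu setT measurableT
  (fun k x => (f_ k x)%:E) (EFin \o f) (EFin \o g) _ _ _ ig _ => //.
- by move=> k; apply/measurable_EFinP.
- by apply/measurable_EFinP.
- apply: filterS hc => x hx _; apply: cvg_EFin => //; exact: nearW.
- by apply: filterS hg => x hx k _; rewrite lee_fin.
Qed.

Lemma derive_neq0 {R : realType} {V : normedModType R} (psi : V -> R) x v :
  'D_v psi x != 0 -> tsupport psi x.
Proof.
apply: contraNP => nx.
have oS : open (~` tsupport psi) by apply: closed_openC; exact: closed_closure.
have : nbhs x (~` tsupport psi) by exact: open_nbhs_nbhs.
rewrite -(@nbhs_ballE R) => -[e /= e0 he].
apply/eqP; apply: cvg_lim => //.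
apply: cvg_near_cst; near=> h.
have hx : psi (h *: v + x) = 0.
  apply: tsupportP; apply: he; rewrite -ball_normE/= opprD addrCA subrr addr0 normrN.
  rewrite normrZ; near: h.
  have d1 : 0 < `|v| + 1 by rewrite ltr_wpDl.
  near=> h; apply: (@le_lt_trans _ _ (`|h| * (`|v| + 1))).
    by rewrite ler_wpM2l// lerDl.
  rewrite -ltr_pdivlMr//; near: h; apply: dnbhs0_lt.
  by rewrite divr_gt0.
by rewrite /= hx (tsupportP nx) subrr scaler0.
Unshelve. all: by end_near. Qed.

Section integrability.
Context {R : realType} {n : nat}.
Implicit Types (u psi : 'rV[R]_n -> R).

Lemma cc_bounded psi (K : set 'rV[R]_n) : continuous psi -> compact K ->
  (forall x, psi x != 0 -> K x) -> exists M, forall x, `|psi x| <= M.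
Proof.
move=> cpsi cK h.
have [M [_ hM]] : bounded_set (psi @` K).
  apply: compact_bounded; apply: continuous_compact => //.
  exact: continuous_subspaceT.
exists (`|M| + 1) => x; have [->|/h Kx] := eqVneq (psi x) 0.
  by rewrite normr0 addr_ge0.
apply: (hM (`|M| + 1)); first by rewrite (le_lt_trans (ler_norm _))// ltrDl.
by exists x.
Qed.

Lemma L1loc_integrableM u psi M N : L1loc u -> measurable_fun setT psi ->
  (forall x, `|psi x| <= M) -> (forall x, psi x != 0 -> cbox N x) ->
  (leb n).-integrable setT (EFin \o (fun x => u x * psi x)).
Proof.
move=> lu mpsi hM hN.
have M0 : 0 <= M by exact: le_trans (hM 0).
have iu := L1loc_integrable_cbox N lu.
have iu' : (leb n).-integrable setT (EFin \o (u \_ (cbox N))).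
  by rewrite -restrict_EFin; apply: (integrable_mkcond _ (measurable_cbox N)).1.
have mu_ : measurable_fun setT u := lu.1.
apply: le_integrable (integrableZl measurableT M iu') => //.
- by apply/measurable_EFinP; apply: measurable_funM.
- move=> x _; rewrite /= lee_fin normrM [leRHS]normrM (ger0_norm M0).
  rewrite patchE; case: ifPn => xN; first by rewrite mulrC ler_wpM2r.
  rewrite (_ : psi x = 0) ?normr0 ?mulr0//.
  by apply/eqP/negPn/negP => /hN h; move/negP: xN; apply; exact: mem_set.
Qed.

Lemma L1loc_integrable_cc u psi (K : set 'rV[R]_n) : L1loc u -> continuous psi -> compact K ->
  (forall x, psi x != 0 -> K x) ->
  (leb n).-integrable setT (EFin \o (fun x => u x * psi x)).
Proof.
move=> lu cpsi cK h; have [M hM] := cc_bounded cpsi cK h.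
have [N KN] := compact_sub_cbox cK.
apply: (L1loc_integrableM lu (continuous_measurable_rV cpsi) hM (N := N%:R)).
by move=> x /h /KN.
Qed.

Lemma C1c_neq0 psi x : psi x != 0 -> tsupport psi x.
Proof. by move=> h; exact: subset_closure. Qed.

Lemma partial_neq0 psi i x : partial i psi x != 0 -> tsupport psi x.
Proof. exact: derive_neq0. Qed.

Lemma L1loc_integrable_C1c u psi : L1loc u -> C1c psi ->
  (leb n).-integrable setT (EFin \o (fun x => u x * psi x)).
Proof.
move=> lu c1; have [_ _ cs] := c1; apply: L1loc_integrable_cc cs _ => //.
- exact: C1c_continuous.
- by move=> x; exact: C1c_neq0.
Qed.

Lemma L1loc_integrable_partial u psi i : L1loc u -> C1c psi ->
  (leb n).-integrable setT (EFin \o (fun x => u x * partial i psi x)).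
Proof.
move=> lu c1; have [_ cp cs] := c1; apply: L1loc_integrable_cc cs _ => //.
by move=> x; exact: partial_neq0.
Qed.

End integrability.

Section separation.
Context {R : realType} {n : nat}.
Implicit Types (u : 'rV[R]_n -> R).
Local Notation mu := (@leb R n).

(** At a Lebesgue point x the average of u over C is close to u x, since C fills a fixed proportion
    of the ball. *)
Lemma L1loc_ae0 u (c : R) : 0 < c -> L1loc u ->
  (forall (x : 'rV[R]_n) r, 0 < r -> r < 1 -> exists C, [/\ measurable C, C `<=` ball x r,
     ((c * r ^+ n)%:E <= mu C)%E & (\int[mu]_(y in C) (u y)%:E = 0)%E]) ->
  {ae mu, forall x, u x = 0}.
Proof.
move=> c0 lu hC; apply: filterS (lebesgue_point_ae lu) => x hx.
apply/eqP; rewrite -normr_eq0 eq_le normr_ge0 andbT; apply/ler_addgt0Pr => e e0.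
rewrite add0r; have [d d0 hd] := hx (e * c) (mulr_gt0 e0 c0).
pose r := Num.min (d / 2) 2^-1.
have r0 : 0 < r by rewrite lt_min !divr_gt0//=.
have rd : r < d by rewrite gt_min ltr_pdivrMr// ltr_pMr// ltr1n.
have r1 : r < 1 by rewrite gt_min invf_lt1// ltr1n orbT.
have [C [mC Cb hc hC0]] := hC x r r0 r1.
have iu : mu.-integrable C (EFin \o u).
  by apply: integrableS (L1loc_integrable_ball x r lu) => //; exact: measurable_ball_rV.
have Cfin : (mu C < +oo)%E.
  apply: le_lt_trans (leb_ball_fin x r); apply: le_measure; rewrite ?inE//.
  exact: measurable_ball_rV.
have ic := integrable_cst_fin (u x) mC Cfin.
have mF : measurable_fun setT (fun y => u y - u x).
  by apply: measurable_funB => //; exact: lu.1.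
have eB : (\int[mu]_(y in C) (u y - u x)%:E = - ((u x)%:E * mu C))%E.
  transitivity (\int[mu]_(y in C) ((EFin \o u) y - (EFin \o cst (u x)) y))%E => //.
  rewrite integralB// hC0 sub0e; congr (- _)%E.
  by rewrite -integral_cst//; exact: eq_integral.
have : (`|\int[mu]_(y in C) (u y - u x)%:E| <= (e * c * r ^+ n)%:E)%E.
  apply: le_trans (le_abse_integral _ _ _) _ => //.
    by apply/measurable_EFinP; exact: measurable_funTS.
  apply: le_trans (hd _ r0 rd).
  apply: ge0_subset_integral => //; first exact: measurable_ball_rV.
  by apply/measurable_EFinP/measurableT_comp => //; exact: measurable_funTS.
rewrite eB abseN abseM (gee0_abs (measure_ge0 _ _)) => h.
have : (`|u x|%:E * (c * r ^+ n)%:E <= (e * c * r ^+ n)%:E)%E.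
  by apply: le_trans h; apply: lee_wpmul2l => //; rewrite lee_fin.
by rewrite -EFinM lee_fin -mulrA ler_pM2r// mulr_gt0// exprn_gt0.
Qed.

Lemma indicator_limit u (C : set 'rV[R]_n) x r (B : nat -> 'rV[R]_n -> R) : L1loc u ->
  measurable C -> (forall k, measurable_fun setT (B k)) ->
  (forall k y, `|B k y| <= 1) -> (forall k y, B k y != 0 -> ball x r y) ->
  (forall y, B k y @[k --> \oo] --> (\1_C y : R)) ->
  (forall k, (\int[mu]_y (u y * B k y)%:E = 0)%E) ->
  (\int[mu]_(y in C) (u y)%:E = 0)%E.
Proof.
move=> lu mC mB B1 Br Bc h.
have [N bN] := ball_sub_cbox x r.
have iu := L1loc_integrable_cbox N%:R lu.
have iu' : mu.-integrable setT (abse \o (EFin \o (u \_ (cbox N%:R)))).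
  by apply: integrable_abse; rewrite -restrict_EFin; apply: (integrable_mkcond _ (measurable_cbox N%:R)).1.
have mu_ : measurable_fun setT u := lu.1.
have [|||||_] := @dct_real _ _ _ mu (fun k y => u y * B k y) (fun y => u y * \1_C y)
    (fun y => `|(u \_ (cbox N%:R)) y|).
- by move=> k; apply: measurable_funM.
- by apply: measurable_funM => //; exact: measurable_indic.
- by apply: aeW => y; apply: cvgMr; exact: Bc.
- exact: iu'.
- apply: aeW => y k; rewrite normrM patchE.
  have [->|/(Br k y) h'] := eqVneq (B k y) 0; first by rewrite normr0 mulr0.
  by rewrite mem_set ?ler_piMr//; exact: bN.
rewrite (_ : (fun k => _) = cst 0%E); last exact/funext.
move=> /(cvg_unique (@ereal_hausdorff R) (cvg_cst _)) e0.
rewrite integral_mkcond e0; apply: eq_integral => y _.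
by rewrite patchE indicE; case: ifPn => _; rewrite ?mulr1 ?mulr0.
Qed.

Lemma leb_eball_ge r (x : 'rV[R]_n) : 0 < r -> (((n.+1%:R)^-1 ^+ n * r ^+ n)%:E <= mu (eball x r))%E.
Proof.
move=> r0; rewrite -exprMn mulrC -(leb_hbox x) ?divr_ge0 ?(ltW r0)//.
apply: le_measure; rewrite ?inE; last exact: hbox_sub_eball.
  exact: measurable_hbox.
by apply: open_measurable_rV; exact: open_eball.
Qed.

(** Indicators of Euclidean balls are bounded limits of test functions, so u has integral 0 on all
    balls. *)
Lemma C1c_separates u : L1loc u ->
  (forall a, C1c a -> (\int[mu]_y (u y * a y)%:E = 0)%E) -> {ae mu, forall x, u x = 0}.
Proof.
move=> lu h; apply: (@L1loc_ae0 u (n.+1%:R^-1 ^+ n)) => //.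
move=> x r r0 r1; exists (eball x r); split.
- by apply: open_measurable_rV; exact: open_eball.
- exact: eball_sub_ball.
- exact: leb_eball_ge.
apply: (@indicator_limit u _ x r (ebump r x)) => //.
- by apply: open_measurable_rV; exact: open_eball.
- by move=> k; apply: continuous_measurable_rV; exact: continuous_cutoff.
- by move=> k y; rewrite ger0_norm ?cutoff_ge0// cutoff_le1.
- move=> k y; apply: contraNP => hy; apply/eqP/ebump_eq0 => //.
  by move=> /(eball_sub_ball r0).
- by move=> y; exact: ebump_cvg.
- by move=> k; apply: h; exact: ebump_C1c.
Qed.

End separation.

Section bump1.
Context {R : realType}.

(** The one-dimensional analogue of [ebump]. *)
Definition lbump (r t0 : R) (k : nat) (t : R) : R :=
  stepf (k.+1%:R * (r ^+ 2 - (t - t0) ^+ 2) - 1).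

Lemma C1c1I (J : set R) (th dth : R -> R) : (forall t : R, is_derive t 1 th (dth t)) -> continuous dth ->
  compact J -> (forall t, th t != 0 -> J t) -> C1c1 setT th.
Proof.
move=> h1 h2 cJ h; split => //.
- rewrite (_ : th^`()%classic = dth)//; apply/funext => t.
  by rewrite derive1E; exact: derive_val.
- by apply: tsupport_compact h => //; exact: Rhausdorff.
Qed.

Lemma lbump_C1c1 r t0 k : C1c1 setT (lbump r t0 k).
Proof.
pose q (t : R) : R := k.+1%:R * (r ^+ 2 - (t - t0) ^+ 2) - 1.
pose dq (t : R) : R := k.+1%:R * (- (2 * (t - t0))).
have dQ (t : R) : is_derive t 1 q (dq t).
  apply: (@is_derive_quad _ _ _ _ _ _ k.+1%:R) => h; rewrite /q /dq.
  rewrite (_ : h *: 1 = h); last exact: mulr1.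
  rewrite (_ : _ - _ - _ = - (k.+1%:R * h ^+ 2)); last by ring.
  by rewrite normrN ger0_norm// mulr_ge0// sqr_ge0.
have cq := is_derive1_continuous dQ.
have cdq : continuous dq.
  move=> t; apply: (@continuousM _ _ (cst k.+1%:R) (fun t => - (2 * (t - t0)))).
    exact: cst_continuous.
  apply: (@continuousN _ _ _ (fun t => 2 * (t - t0))).
  apply: (@continuousM _ _ (cst 2) (fun t => t - t0)); first exact: cst_continuous.
  by apply: continuousB; [exact: id|exact: cst_continuous].
apply: (@C1c1I `[t0 - `|r|, t0 + `|r|] _ (fun t => tent (q t) * dq t)).
- by move=> t; apply: is_derive1_comp; exact: is_derive_stepf.
- move=> t; apply: (@continuousM _ _ (tent \o q) dq); last exact: cdq.
  by apply: continuous_comp; [exact: cq|exact: continuous_tent].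
- exact: segment_compact.
- move=> t; apply: contraNT; rewrite /= in_itv/= -ler_distl -ltNge => h.
  apply/eqP/stepf_le0; rewrite gerDr pmulr_rle0// subr_le0.
  by rewrite -[r ^+ 2]real_normK ?num_real// -[leRHS]real_normK ?num_real// lerXn2r ?nnegrE// ltW.
Qed.

Lemma lbump_cvg r t0 t : 0 < r ->
  lbump r t0 k t @[k --> \oo] --> ((`|t - t0| < r)%R%:R : R).
Proof.
move=> r0; have e : (`|t - t0| < r) = ((t - t0) ^+ 2 < r ^+ 2).
  by rewrite -[in RHS]real_normK ?num_real// ltr_pXn2r ?nnegrE ?(ltW r0).
rewrite e; case: ltP => h; first by apply: stepf_cvg1; rewrite subr_gt0.
by apply: stepf_cvg0; rewrite subr_le0.
Qed.

Lemma lbump_eq0 r t0 k t : 0 < r -> r <= `|t - t0| -> lbump r t0 k t = 0.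
Proof.
move=> r0 h; apply: stepf_le0; rewrite gerDr pmulr_rle0// subr_le0.
by rewrite -[leRHS]real_normK ?num_real// lerXn2r ?nnegrE// ltW.
Qed.

End bump1.

Section separation_tensor.
Context {R : realType} {n : nat}.
Local Notation mu := (@leb R n.+1).

(** As [C1c_separates], with cylinders over balls in place of balls: their indicators are limits of
    products. *)
Lemma tensor_separates (u : 'rV[R]_n.+1 -> R) : L1loc u ->
  (forall a th, C1c a -> C1c1 setT th ->
    (\int[mu]_y (u y * tensor a th y)%:E = 0)%E) -> {ae mu, forall x, u x = 0}.
Proof.
move=> lu h; apply: (@L1loc_ae0 _ _ u (n.+2%:R^-1 ^+ n.+1)) => //.
move=> x r r0 r1.
pose C := @row_init R n @^-1` (eball (row_init x) r) `&`
          @row_last R n @^-1` [set t | `|t - row_last x| < r].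
have oC : open C.
  apply: openI; apply: open_comp => //.
  - by move=> y _; exact: continuous_row_init.
  - exact: open_eball.
  - by move=> y _; exact: continuous_row_last.
  - rewrite (_ : [set t | _] = ball (row_last x) r); first exact: ball_open.
    by apply/seteqP; split => t; rewrite /ball/= distrC.
have mC := open_measurable_rV oC.
have Cb : C `<=` ball x r.
  move=> y [/(eball_sub_ball r0)[_ h1] /= h2]; apply/ball_rVP => // i.
  have [j ->|->] := unliftP ord_max i; first by have := h1 ord0 j; rewrite !mxE.
  by rewrite distrC.
exists C; split => //.
- rewrite -exprMn mulrC -(leb_hbox x) ?divr_ge0 ?(ltW r0)//.
  apply: le_measure; rewrite ?inE//; first exact: measurable_hbox.
  move=> y hy; split.
    apply: hbox_sub_eball => // i; have := hy (lift ord_max i); rewrite !mxE => /andP[-> h1]/=.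
    apply: lt_le_trans h1 _; rewrite lerD2l ler_wpM2l ?(ltW r0)//.
    by rewrite lef_pV2 ?posrE// ler_nat.
  have /andP[h1 h2] := hy ord_max.
  rewrite /= ger0_norm ?subr_ge0// ltrBlDl; apply: lt_le_trans h2 _.
  by rewrite lerD2l ler_pdivrMr// ler_peMr ?(ltW r0)// ler1n.
- apply: (@indicator_limit _ _ u _ x r
    (fun k => tensor (ebump r (row_init x) k) (lbump r (row_last x) k))) => //.
  + move=> k; apply: continuous_measurable_rV; apply: C1c_continuous.
    by apply: tensor_C1c; [exact: ebump_C1c|exact: lbump_C1c1].
  + move=> k y; rewrite ger0_norm ?mulr_ge0 ?cutoff_ge0 ?stepf_ge0//.
    by rewrite mulr_ile1 ?cutoff_ge0 ?stepf_ge0 ?cutoff_le1 ?stepf_le1.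
  + move=> k y; rewrite /tensor mulf_eq0 negb_or => /andP[h1 h2]; apply: Cb; split.
      by apply: contrapT => /(ebump_eq0 k r0)/eqP; apply/negP.
    rewrite /= ltNge; apply/negP => /(lbump_eq0 k r0)/eqP; exact/negP.
  + move=> y; rewrite (_ : \1_C y = \1_(eball (row_init x) r) (row_init y) *
        (`|row_last y - row_last x| < r)%R%:R :> R).
      by apply: cvgM; [exact: ebump_cvg|exact: lbump_cvg].
    rewrite !indicE -natrM mulnb; congr (nat_of_bool _)%:R.
    apply/idP/andP => [/set_mem[h1 h2]|[/set_mem h1 h2]]; first by split => //; exact: mem_set.
    by apply: mem_set.
  + by move=> k; apply: h; [exact: ebump_C1c|exact: lbump_C1c1].
Qed.

End separation_tensor.

(** * Slices along the last coordinate *)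

Section real_integrals.
Context d (T : measurableType d) {R : realType} (m : {measure set T -> \bar R}).

Lemma integrable_dom (D : set T) (h k : T -> R) : measurable D -> measurable_fun setT h ->
  (forall x, `|h x| <= `|k x|) ->
  m.-integrable D (EFin \o k) -> m.-integrable D (EFin \o h).
Proof.
move=> mD mh hk; apply: le_integrable => //; last by move=> x _; rewrite /= lee_fin.
by apply/measurable_EFinP; exact: measurable_funTS.
Qed.

Lemma Rint_opp (u : T -> R) : m.-integrable setT (EFin \o u) ->
  \int[m]_x (- u x) = - \int[m]_x u x.
Proof.
by move=> iu; rewrite -mulN1r -RintegralZl//; apply: eq_Rintegral => x _; rewrite mulN1r.
Qed.

End real_integrals.

Section param.
Context d1 d2 (T1 : measurableType d1) (T2 : measurableType d2) {R : realType}.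
Variables (m1 : {sigma_finite_measure set T1 -> \bar R}) (m2 : {sigma_finite_measure set T2 -> \bar R}).

Lemma measurable_Rint_param (q : T1 * T2 -> R) : measurable_fun setT q ->
  measurable_fun setT (fun x => \int[m2]_y q (x, y)).
Proof.
move=> mq; apply: measurableT_comp => //.
have mEq : measurable_fun setT (EFin \o q) by exact/measurable_EFinP.
have h : (fun x => \int[m2]_y (q (x, y))%:E)%E =
    (fun x => fubini_F m2 ((EFin \o q)^\+)%E x - fubini_F m2 ((EFin \o q)^\-)%E x)%E.
  apply/funext => x; rewrite [LHS]integralE /fubini_F.
  congr (_ - _)%E; apply: eq_integral => y _.
    by rewrite -[RHS]/(((EFin \o q)^\+ \o pair x) y)%E -funepos_comp.
  by rewrite -[RHS]/(((EFin \o q)^\- \o pair x) y)%E -funeneg_comp.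
rewrite h; apply: emeasurable_funB.
  by apply: measurable_fun_fubini_tonelli_F => //; exact: measurable_funepos.
by apply: measurable_fun_fubini_tonelli_F => //; exact: measurable_funeneg.
Qed.

Lemma integrable_prod_tensor (h1 : T1 -> R) (h2 : T2 -> R) :
  m1.-integrable setT (EFin \o h1) -> m2.-integrable setT (EFin \o h2) ->
  (m1 \x m2)%E.-integrable setT (EFin \o (fun p => h1 p.1 * h2 p.2)).
Proof.
move=> i1 i2; have mh1 := (measurable_EFinP _ _).1 (measurable_int _ i1).
have mh2 := (measurable_EFinP _ _).1 (measurable_int _ i2).
apply/integrable12ltyP.
  apply/measurable_EFinP; apply: measurable_funM.
    exact: measurableT_comp mh1 measurable_fst.
  exact: measurableT_comp mh2 measurable_snd.
have /integrableP[_ h1oo] := i1; have /integrableP[_ h2oo] := i2.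
have h2f : (\int[m2]_y `|(h2 y)%:E| \is a fin_num)%E.
  by rewrite ge0_fin_numE// integral_ge0.
under eq_integral => x _.
  under eq_integral => y _ do rewrite /= normrM EFinM.
  rewrite ge0_integralZl//; last by apply/measurable_EFinP; exact: measurableT_comp.
  over.
rewrite /=; under eq_integral => x _ do rewrite muleC -(fineK h2f).
rewrite ge0_integralZl//; last 2 first.
- by apply/measurable_EFinP; exact: measurableT_comp.
- by rewrite lee_fin fine_ge0// integral_ge0.
by apply: lte_mul_pinfty => //; rewrite ?lee_fin ?fine_ge0// integral_ge0.
Qed.

End param.

Section real_fubini.
Context d1 d2 (T1 : measurableType d1) (T2 : measurableType d2) {R : realType}.
Variables (m1 : {sigma_finite_measure set T1 -> \bar R}) (m2 : {sigma_finite_measure set T2 -> \bar R}).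

Lemma Rint_fubini (F : T1 * T2 -> R) : (m1 \x m2)%E.-integrable setT (EFin \o F) ->
  \int[m1]_x (\int[m2]_y F (x, y)) = \int[m2]_y (\int[m1]_x F (x, y)).
Proof.
move=> iF; have E : (\int[m1]_x \int[m2]_y (EFin \o F) (x, y) = \int[m2]_y \int[m1]_x (EFin \o F) (x, y))%E.
  exact: Fubini.
have i1 := ae_integrable1 iF; have i2 := ae_integrable2 iF.
have mF : measurable_fun setT F by apply/measurable_EFinP; exact: measurable_int iF.
rewrite /Rintegral; congr fine.
transitivity (\int[m1]_x \int[m2]_y (EFin \o F) (x, y))%E.
  apply: ae_eq_integral => //.
  - by apply/measurable_EFinP; exact: measurable_Rint_param mF.
  - exact: measurable_fubini_F iF.
  apply: filterS i1 => x /= ix _.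
  by rewrite fineK//; exact: integrable_fin_num.
rewrite E; apply: ae_eq_integral => //.
- exact: measurable_fubini_G iF.
- apply/measurable_EFinP.
  have mF' : measurable_fun setT (fun p : T2 * T1 => F (p.2, p.1)).
    apply: (measurableT_comp (f := F) (g := fun p : T2 * T1 => (p.2, p.1))) => //.
    by apply/measurable_fun_pairP; split; [exact: measurable_snd|exact: measurable_fst].
  exact: (measurable_Rint_param _ mF').
apply: filterS i2 => y /= iy _.
by rewrite fineK//; exact: integrable_fin_num.
Qed.

End real_fubini.

Lemma itv_integrable_mkcond {R : realType} (i : interval R) (h : R -> \bar R) :
  (@lebesgue_measure R).-integrable [set` i] h <->
  (@lebesgue_measure R).-integrable setT (h \_ [set` i]).
Proof. by apply: integrable_mkcond; exact: measurable_itv. Qed.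

Section slices.
Context {R : realType} {n : nat}.
Implicit Types (u g : 'rV[R]_n.+1 -> R) (y : 'rV[R]_n).
Local Notation lam := (@lebesgue_measure R).
Local Notation mu := (@leb R n).
Local Notation nu := (@leb R n.+1).

Lemma measurable_slice d (T : measurableType d) (u : 'rV[R]_n.+1 -> T) y :
  measurable_fun setT u -> measurable_fun setT (fun t : R => u (row_rcons y t)).
Proof.
move=> mu_; apply: (measurableT_comp (f := u) (g := fun t : measurableTypeR R => row_rcons y t)) => //.
apply: (measurableT_comp (f := rc) (g := fun t : measurableTypeR R => (y, t))) => //.
  exact: measurable_rc.
by apply/measurable_fun_pairP; split => /=; [exact: measurable_cst|exact: measurable_id].
Qed.

Lemma measurable_slice_last d (T : measurableType d) (u : 'rV[R]_n.+1 -> T) (t : R) :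
  measurable_fun setT u -> measurable_fun setT (fun y => u (row_rcons y t)).
Proof.
move=> mu_; apply: (measurableT_comp (f := u) (g := fun y => row_rcons y t)) => //.
apply: (measurableT_comp (f := rc) (g := fun y : 'rV[R]_n => (y, t : measurableTypeR R))) => //.
  exact: measurable_rc.
Qed.

Lemma row_rcons_cbox N y t : cbox N (row_rcons y t) <-> cbox N y /\ t \in `[- N, N].
Proof.
split=> [h|[h1 h2] i].
  split=> [i|]; last by have := h ord_max; rewrite !mxE unlift_none.
  by have := h (lift ord_max i); rewrite !mxE liftK.
by rewrite mxE; case: unliftP => [j _|_].
Qed.

Definition slice_loc (h : R -> R) := measurable_fun setT h /\
  forall N : nat, lam.-integrable `[- N%:R, N%:R] (EFin \o h).

Lemma slice_loc_itv h (a b : R) : slice_loc h -> lam.-integrable `[a, b] (EFin \o h).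
Proof.
move=> [mh ih]; pose N := (Num.truncn (Num.max `|a| `|b|)).+1.
apply: integrableS (ih N) => //.
have /ltW : Num.max `|a| `|b| < N%:R by exact: truncnS_gt.
rewrite ge_max => /andP[aN bN].
move: aN bN; rewrite !ler_norml => /andP[a1 _] /andP[_ b1].
by apply: subset_itv; rewrite !bnd_simp.
Qed.

Lemma ae_slice_loc u : L1loc u -> {ae mu, forall y, slice_loc (fun t => u (row_rcons y t))}.
Proof.
move=> lu; have h N : {ae mu, forall y, lam.-integrable setT
    (fun t => (EFin \o (u \_ (cbox N%:R))) (row_rcons y t))}.
  apply: ae_integrable_slice; rewrite -restrict_EFin.
  exact: (integrable_mkcond _ (measurable_cbox N%:R)).1 (L1loc_integrable_cbox N%:R lu).
have {}h : {ae mu, forall y, forall N : nat, lam.-integrable setT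
    (fun t => (EFin \o (u \_ (cbox N%:R))) (row_rcons y t))} by exact/ae_foralln.
apply: filterS h => y hy; split; first exact: measurable_slice lu.1.
move=> N; have [N' hN'] := cbox_cover y.
pose M := maxn N N'.
have NM : (N%:R : R) <= M%:R by rewrite ler_nat leq_maxl.
have N'M : (N'%:R : R) <= M%:R by rewrite ler_nat leq_maxr.
have yM : cbox M%:R y.
  move=> i; have := hN' i; rewrite !in_itv/= -!ler_norml => h; exact: le_trans N'M.
have : lam.-integrable `[- M%:R, M%:R] (EFin \o (fun t => u (row_rcons y t))).
  apply/itv_integrable_mkcond.
  apply: eq_integrable (hy M) => // t _ /=; rewrite !patchE/=.
  have [tM|tM] := boolP (t \in `[- M%:R, M%:R]%classic).
    by rewrite mem_set//; apply/row_rcons_cbox; split => //; exact: set_mem.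
  rewrite memNset// => /row_rcons_cbox[_ h]; move/negP: tM; apply; exact: mem_set.
apply: integrableS => //; apply: subset_itv; rewrite !bnd_simp//.
by rewrite lerN2.
Qed.

Definition slint u (psi : R -> R) y : R := \int[lam]_t (u (row_rcons y t) * psi t).

(** Bounded with bounded support: what may be integrated against a locally integrable function. *)
Definition cbfun (psi : R -> R) := measurable_fun setT psi /\
  exists M N : nat, (forall t, `|psi t| <= M%:R) /\ (forall t, psi t != 0 -> t \in `[- N%:R, N%:R]).

Definition cbfunV m (a : 'rV[R]_m -> R) := measurable_fun setT a /\
  exists M N : nat, (forall t, `|a t| <= M%:R) /\ (forall t, a t != 0 -> cbox N%:R t).

Lemma measurable_row_last_fun : measurable_fun setT (@row_last R n).
Proof. exact: coord_measurable_rV. Qed.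

Lemma cbfun_tensor (a : 'rV[R]_n -> R) psi : cbfunV a -> cbfun psi ->
  cbfunV (tensor a psi).
Proof.
move=> [ma [M [N [aM aN]]]] [mp [M' [N' [pM pN]]]]; split.
  apply: measurable_funM.
    exact: measurableT_comp ma (@measurable_row_init R n).
  exact: measurableT_comp mp measurable_row_last_fun.
exists (M * M')%N, (maxn N N'); split => x; rewrite /tensor.
  by rewrite normrM natrM ler_pM.
rewrite mulf_eq0 negb_or => /andP[/aN h1 /pN h2].
rewrite -[x]row_rconsK; apply/row_rcons_cbox; split.
  move=> i; have := h1 i; rewrite !in_itv/= -!ler_norml => h; apply: le_trans h _.
  by rewrite ler_nat leq_maxl.
move: h2; rewrite !in_itv/= -!ler_norml => h; apply: le_trans h _.
by rewrite ler_nat leq_maxr.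
Qed.

Lemma L1loc_cbfunV m (u : 'rV[R]_m -> R) a : L1loc u -> cbfunV a ->
  (leb m).-integrable setT (EFin \o (fun x => u x * a x)).
Proof. by move=> lu [ma [M [N [aM aN]]]]; exact: L1loc_integrableM aN. Qed.

Lemma measurable_slint u psi : measurable_fun setT u -> measurable_fun setT psi ->
  measurable_fun setT (slint u psi).
Proof.
move=> mu_ mp.
pose q (p : 'rV[R]_n * measurableTypeR R) : R := u (row_rcons p.1 p.2) * psi p.2.
have mq : measurable_fun setT q.
  apply: measurable_funM; first exact: (measurable_comp_rc mu_).
  exact: measurableT_comp mp measurable_snd.
have H := measurable_Rint_param lam mq.
rewrite /slint.
by move: H; rewrite /q/=; apply.
Qed.

Lemma L1loc_slint u psi : L1loc u -> cbfun psi -> L1loc (slint u psi).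
Proof.
move=> lu cpsi; have [mu_ _] := lu; have [mp _] := cpsi.
apply: L1loc_cbox => [|N]; first exact: measurable_slint.
have ca : cbfunV (\1_(cbox N%:R) : 'rV[R]_n -> R).
  split; first by apply: measurable_indic; exact: measurable_cbox.
  exists 1%N, N; split => y; rewrite indicE; first by case: (_ \in _); rewrite ?normr1 ?normr0.
  by case: (boolP (y \in _)) => [/set_mem|_] //; rewrite eqxx.
have iT := L1loc_cbfunV lu (cbfun_tensor ca cpsi).
have /integrableP[_ hoo] := iT.
apply/(integrable_mkcond _ (measurable_cbox N%:R)); rewrite restrict_EFin.
apply/integrableP; split.
  apply/measurable_EFinP/measurable_restrict; rewrite ?setIT//.
  - exact: measurable_cbox.
  - by apply: measurable_funTS; exact: measurable_slint.
apply: le_lt_trans hoo; rewrite leb_ge0_fubini1//; last first.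
  by apply: measurableT_comp => //; exact: (measurable_int _ iT).
have mtu y : measurable_fun setT (fun t : R => u (row_rcons y t) * psi t).
  by apply: measurable_funM => //; exact: measurable_slice.
apply: ge0_le_integral => //.
- apply: measurableT_comp => //; apply/measurable_EFinP/measurable_restrict; rewrite ?setIT//.
  + exact: measurable_cbox.
  + by apply: measurable_funTS; exact: measurable_slint.
- pose F x : R := u x * tensor \1_(cbox N%:R) psi x.
  have mabs : measurable_fun [set: 'rV[R]_n.+1] (fun x => `|(EFin \o F) x|%E).
    by apply: measurableT_comp => //; exact: (measurable_int _ iT).
  have H := measurable_fun_fubini_tonelli_F (m2 := lam) _ (measurable_comp_rc mabs).
  by apply: H => p; exact: abse_ge0.
- move=> y _; rewrite /= patchE; case: ifPn => yN; last by rewrite normr0 integral_ge0.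
  rewrite /tensor; under eq_integral => t _ do
    rewrite row_init_rcons row_last_rcons indicE yN mul1r.
  rewrite /slint /Rintegral.
  have := le_abse_integral lam measurableT ((measurable_EFinP _ _).2 (mtu y)).
  apply: le_trans; case: (\int[_]_x _)%E => //= *; by rewrite normr0 leey.
Qed.

Lemma slint_fubini u (a : 'rV[R]_n -> R) psi : L1loc u -> cbfunV a -> cbfun psi ->
  (\int[nu]_x (u x * tensor a psi x)%:E = \int[mu]_y (slint u psi y * a y)%:E)%E.
Proof.
move=> lu ca cpsi; have iT := L1loc_cbfunV lu (cbfun_tensor ca cpsi).
rewrite leb_fubini1//; apply: ae_eq_integral => //.
- apply: (measurable_fubini_F (m1 := mu) (m2 := lam)
    (f := (EFin \o (fun x : 'rV[R]_n.+1 => u x * tensor a psi x)) \o rc)).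
  by apply/leb_integrable_rc => //; exact: (measurable_int _ iT).
- apply/measurable_EFinP; apply: measurable_funM; last by case: ca.
  by apply: measurable_slint; [case: lu|case: cpsi].
apply: filterS (ae_slice_loc lu) => y [hm hy] _.
have [mp [M [N [pM pN]]]] := cpsi.
have i1 : lam.-integrable setT (EFin \o (fun t => u (row_rcons y t) * psi t)).
  have iN := (itv_integrable_mkcond _ _).1 (hy N).
  apply: le_integrable (integrableZl measurableT M%:R iN) => //.
    by apply/measurable_EFinP; apply: measurable_funM.
  move=> t _; rewrite restrict_EFin /= lee_fin normrM [leRHS]normrM.
  rewrite patchE; case: ifPn => tN; first by rewrite mulrC ler_pM// normr_nat.
  rewrite (_ : psi t = 0) ?normr0 ?mulr0//.
  by apply/eqP/negPn/negP => /pN h; move/negP: tN; apply; exact: mem_set.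
rewrite /slint EFinM /Rintegral fineK; last exact: integrable_fin_num.
rewrite muleC -integralZl//; apply: eq_integral => t _.
by rewrite /= /tensor row_init_rcons row_last_rcons -EFinM; congr EFin; ring.
Qed.

End slices.

(** * Primitives on the line *)

Section kernel.
Context {R : realType}.
Local Notation lam := (@lebesgue_measure R).
Implicit Types (h : R -> R).

Lemma tsupport1_bound (th : R -> R) : compact (tsupport th) ->
  exists N : nat, forall t, tsupport th t -> `|t| <= N%:R.
Proof.
move=> /compact_bounded[M [_ hM]]; exists (Num.truncn (M + 1)).+1 => t tt.
have M1 : M < M + 1 by rewrite ltrDl.
by apply: le_trans (hM _ M1 _ tt) _; apply/ltW/truncnS_gt.
Qed.

Lemma cc1_cbfun (psi : R -> R) (N : nat) : continuous psi ->
  (forall t, psi t != 0 -> `|t| <= N%:R) -> cbfun psi.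
Proof.
move=> cpsi hN; split; first exact: continuous_measurable_fun.
have [M [_ hM]] : bounded_set (psi @` `[- N%:R, N%:R]).
  apply: compact_bounded; apply: continuous_compact; last exact: segment_compact.
  exact: continuous_subspaceT.
exists (Num.truncn (M + 1)).+1, N; split => t; last first.
  by move=> /hN; rewrite in_itv/= -ler_norml.
have [->|/hN tN] := eqVneq (psi t) 0; first by rewrite normr0.
have M1 : M < M + 1 by rewrite ltrDl.
apply: le_trans (ltW (truncnS_gt _)); apply: (hM _ M1); exists t => //.
by rewrite /= in_itv/= -ler_norml.
Qed.

Lemma C1c1_bound (th : R -> R) : C1c1 setT th -> exists N : nat,
  (forall t, th t != 0 -> `|t| <= N%:R) /\ (forall t, th^`()%classic t != 0 -> `|t| <= N%:R).
Proof.
move=> [_ _ cth _]; have [N hN] := tsupport1_bound cth; exists N; split => t ht; apply: hN.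
  exact: subset_closure.
by move: ht; rewrite derive1E; exact: derive_neq0.
Qed.

Lemma C1c1_cbfun (th : R -> R) : C1c1 setT th -> cbfun th /\ cbfun th^`()%classic.
Proof.
move=> c1; have [N [h1 h2]] := C1c1_bound c1.
split; first by apply: cc1_cbfun h1; exact: C1c1_continuous.
by apply: cc1_cbfun h2; case: c1.
Qed.

Lemma C1_FTC (th dth : R -> R) (a b : R) : (forall t : R, is_derive t 1 th (dth t)) ->
  continuous dth -> a <= b -> \int[lam]_(t in `[a, b]) dth t = th b - th a.
Proof.
move=> hd cd; rewrite le_eqVlt => /predU1P[->|ab].
  by rewrite set_itv1 Rintegral_set1 subrr.
have cth := is_derive1_continuous hd.
rewrite /Rintegral (@continuous_FTC2 _ _ th)//.
- exact: continuous_subspaceT.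
- split; first by move=> t _; exact: ex_derive.
  + by apply: cvg_at_right_filter; exact: cth.
  + by apply: cvg_at_left_filter; exact: cth.
- by move=> t _; rewrite derive1E; exact: derive_val.
Qed.

(** The integral of h s * kap s t in s is the oriented integral of h from 0 to t, for t of either
    sign.  A single measurable kernel makes Fubini's theorem applicable to primitives. *)
Definition kap (s t : R) : R := (s <= t)%R%:R - (s < 0)%R%:R.

Lemma kap_abs s t : `|kap s t| <= 1.
Proof. by rewrite /kap; case: (s <= t); case: (s < 0); rewrite ?subrr ?subr0 ?sub0r ?normrN ?normr1 ?normr0. Qed.

Lemma kap_neq0 s t : kap s t != 0 -> `|s| <= `|t|.
Proof.
rewrite /kap; case: (leP s t); case: (ltP s 0) => s0 st; rewrite ?subrr ?eqxx// => _.
  by rewrite ger0_norm// (le_trans st)// ler_norm.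
by rewrite ltr0_norm// ltr0_norm ?lerN2 ?(ltW st)// (lt_trans st).
Qed.

Lemma kapB r s t : s <= t -> kap r t - kap r s = \1_(`]s, t]%classic) r.
Proof.
move=> st; rewrite /kap indicE.
rewrite opprB addrA subrK; have [h|h] := boolP (r \in `]s, t]%classic).
  move: h => /set_mem; rewrite /= in_itv/= => /andP[sr ->].
  by rewrite leNgt sr subr0.
have : ~ r \in `]s, t] by move=> h'; move/negP: h; apply; exact: mem_set.
rewrite in_itv/=; case: (leP r t) => rt; case: (ltP s r) => sr //=; rewrite ?subrr//.
by move: (lt_le_trans rt (le_trans sr st)); rewrite ltxx.
Qed.

Lemma measurable_kap : measurable_fun setT (fun p : measurableTypeR R * measurableTypeR R => kap p.1 p.2).
Proof.
have -> : (fun p : measurableTypeR R * measurableTypeR R => kap p.1 p.2) =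
    (fun p => \1_(`[0, +oo[%classic) (p.2 - p.1 : R) - \1_(`]-oo, 0[%classic) (p.1 : R)).
  apply/funext => p; rewrite /kap !indicE; congr (_ - _); first congr (nat_of_bool _)%:R.
    by apply/idP/idP => [h|/set_mem]; [apply: mem_set; rewrite /= in_itv/= subr_ge0 h|
      rewrite /= in_itv/= andbT subr_ge0].
  by congr (nat_of_bool _)%:R; apply/idP/idP => [h|/set_mem]; [apply: mem_set; rewrite /= in_itv/=|
      rewrite /= in_itv].
apply: measurable_funB.
  apply: (measurableT_comp (f := \1_(`[0 : R, +oo[%classic) : R -> R)).
    by apply: measurable_indic; exact: measurable_itv.
  by apply: measurable_funB; [exact: measurable_snd|exact: measurable_fst].
apply: (measurableT_comp (f := \1_(`]-oo, 0 : R[%classic) : R -> R)).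
  by apply: measurable_indic; exact: measurable_itv.
exact: measurable_fst.
Qed.

Lemma measurable_kap1 t : measurable_fun setT (fun s : R => kap s t).
Proof.
pose j (s : measurableTypeR R) : measurableTypeR R * measurableTypeR R := (s, t).
have mj : measurable_fun setT j by apply/measurable_fun_pairP; split => //=; first [exact: measurable_id|exact: measurable_cst].
exact: (measurableT_comp measurable_kap mj).
Qed.

Lemma measurable_kap2 s : measurable_fun setT (fun t : R => kap s t).
Proof.
pose j (t : measurableTypeR R) : measurableTypeR R * measurableTypeR R := (s, t).
have mj : measurable_fun setT j by apply/measurable_fun_pairP; split => //=; first [exact: measurable_id|exact: measurable_cst].
exact: (measurableT_comp measurable_kap mj).
Qed.

(** The primitive of h that vanishes at 0. *)
Definition prim h (t : R) : R := \int[lam]_s (h s * kap s t).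

Lemma slice_loc_cbfun h psi : slice_loc h -> cbfun psi ->
  lam.-integrable setT (EFin \o (fun s => h s * psi s)).
Proof.
move=> [hm hy] [mp [M [N [pM pN]]]].
have iN := (itv_integrable_mkcond _ _).1 (hy N).
apply: le_integrable (integrableZl measurableT M%:R iN) => //.
  by apply/measurable_EFinP; apply: measurable_funM.
move=> t _; rewrite restrict_EFin /= lee_fin normrM [leRHS]normrM.
rewrite patchE; case: ifPn => tN; first by rewrite mulrC ler_pM// normr_nat.
rewrite (_ : psi t = 0) ?normr0 ?mulr0//.
by apply/eqP/negPn/negP => /pN h'; move/negP: tN; apply; exact: mem_set.
Qed.

Lemma kap_cbfun t : cbfun (fun s => kap s t).
Proof.
split; first exact: measurable_kap1.
exists 1%N, (Num.truncn `|t|).+1; split => s; first exact: kap_abs.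
move=> /kap_neq0 h; rewrite in_itv/= -ler_norml (le_trans h)//.
exact/ltW/truncnS_gt.
Qed.

Lemma primB h s t : slice_loc h -> s <= t ->
  prim h t - prim h s = \int[lam]_(r in `[s, t]) h r.
Proof.
move=> lh st; rewrite /prim -RintegralB//; last 2 first.
- by apply: slice_loc_cbfun => //; exact: kap_cbfun.
- by apply: slice_loc_cbfun => //; exact: kap_cbfun.
rewrite -Rintegral_itv_obnd_cbnd; last first.
  apply: integrableS (slice_loc_itv s t lh) => //; apply: subset_itv_oc_cc.
rewrite [RHS]Rintegral_mkcond; apply: eq_Rintegral => r _.
by rewrite -mulrBr kapB// patchE indicE; case: ifPn => _; rewrite ?mulr1 ?mulr0.
Qed.

Lemma int_kap_deriv (th : R -> R) s : C1c1 setT th ->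
  \int[lam]_t (kap s t * th^`()%classic t) = - th s.
Proof.
move=> c1; have [N [h1 h2]] := C1c1_bound c1; have [_ cbd] := C1c1_cbfun c1.
have cd : continuous th^`()%classic by case: c1.
pose M : R := Num.max N%:R `|s| + 1.
have NM : N%:R < M by rewrite /M ltr_pwDr// le_max lexx.
have sM : `|s| < M by rewrite /M ltr_pwDr// le_max lexx orbT.
have thM t : M <= `|t| -> th t = 0.
  move=> Mt; apply/eqP/negPn/negP => /h1; rewrite leNgt; move/negP; apply.
  exact: lt_le_trans Mt.
have M0 : 0 < M by apply: le_lt_trans NM.
have thMp : th M = 0 by apply: thM; rewrite ger0_norm// ltW.
have thMn : th (- M) = 0 by apply: thM; rewrite normrN ger0_norm// ltW.
have smM : s <= M by apply/ltW/(le_lt_trans (ler_norm s)).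
have smM' : - M <= s by rewrite lerNl; apply/ltW/(le_lt_trans _ sM); rewrite -normrN ler_norm.
have iM (a b : R) : \int[lam]_(t in `[a, b]) th^`()%classic t =
    \int[lam]_t (\1_(`[a, b]%classic) t * th^`()%classic t).
  rewrite Rintegral_mkcond; apply: eq_Rintegral => t _.
  by rewrite patchE indicE; case: ifPn => _; rewrite ?mul1r ?mul0r.
have ii (a b : R) : lam.-integrable setT (EFin \o (fun t => \1_(`[a, b]%classic) t * th^`()%classic t)).
  have l1 : slice_loc (\1_(`[a, b]%classic) : R -> R).
    split; first by apply: measurable_indic; exact: measurable_itv.
    move=> K; apply: integrableS (integrable_indic_itv a b true false) => //.
  exact: slice_loc_cbfun.
transitivity (\int[lam]_t (\1_(`[s, M]%classic) t * th^`()%classic t -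
    (s < 0)%R%:R * (\1_(`[- M, M]%classic) t * th^`()%classic t))).
  apply: eq_Rintegral => t _; have [->|/h2 tN] := eqVneq (th^`()%classic t) 0.
    by rewrite !mulr0 subr0.
  have tM : `|t| <= M by apply: le_trans tN (ltW NM).
  have -> : \1_(`[- M, M]%classic) t = 1 :> R.
    by rewrite indicE mem_set//= in_itv/= -ler_norml.
  rewrite mul1r /kap mulrBl; congr (_ * _ - _).
  rewrite indicE; congr (nat_of_bool _)%:R; apply/idP/idP => [h|/set_mem].
    by apply: mem_set; rewrite /= in_itv/= h (le_trans (ler_norm t)).
  by rewrite /= in_itv/= => /andP[].
rewrite RintegralB//; last first.
  have := integrableZl measurableT (s < 0)%R%:R (ii (- M) M).
  by apply: eq_integrable => // t _.
rewrite RintegralZl// -!iM !(C1_FTC (C1c1P c1))//; last by rewrite ge0_cp// ltW.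
by rewrite thMp thMn subrr mulr0 subr0 sub0r.
Qed.

Lemma slice_loc_le (h k : R -> R) : measurable_fun setT h -> slice_loc k ->
  (forall t, `|h t| <= `|k t|) -> slice_loc h.
Proof.
move=> mh [mk ik] hk; split=> // K.
have H := integrable_dom (m := lam) (D := `[- K%:R, K%:R]%classic) _ _ hk (ik K).
by apply: H; [exact: measurable_itv|exact: mh].
Qed.

(** Integration by parts for an absolutely continuous function, from Fubini's theorem and [int_kap_deriv]. *)
Lemma prim_deriv_test h (th : R -> R) : slice_loc h -> C1c1 setT th ->
  \int[lam]_t (prim h t * th^`()%classic t) = - \int[lam]_s (h s * th s).
Proof.
move=> lh c1; have [cb1 [md [M [N [dM dN]]]]] := C1c1_cbfun c1.
pose F (p : measurableTypeR R * measurableTypeR R) : R := h p.1 * kap p.1 p.2 * th^`()%classic p.2.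
have mF : measurable_fun setT F.
  apply: measurable_funM; last exact: measurableT_comp md measurable_snd.
  apply: measurable_funM; last exact: measurable_kap.
  exact: measurableT_comp lh.1 measurable_fst.
have c1N : cbfun (\1_(`[- N%:R, N%:R]%classic) : R -> R).
  split; first by apply: measurable_indic; exact: measurable_itv.
  exists 1%N, N; split => t; rewrite indicE; first by case: (_ \in _); rewrite ?normr1 ?normr0.
  by case: (boolP (t \in _)) => [/set_mem|_] //; rewrite eqxx.
have slc1 : slice_loc (cst 1 : R -> R).
  split; first exact: measurable_cst.
  move=> K; apply: integrable_cst_fin => //.
  by rewrite /= lebesgue_measure_itv/=; case: ifPn => _; rewrite ?ltry// -EFinD ltry.
have iF : (lam \x lam)%E.-integrable setT (EFin \o F).
  have i1 := slice_loc_cbfun lh c1N.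
  have i2 : lam.-integrable setT (EFin \o (fun t => 1 * th^`()%classic t)).
    by apply: (slice_loc_cbfun slc1); split => //; exists M, N.
  apply: le_integrable (integrable_prod_tensor i1 i2) => //; first exact/measurable_EFinP.
  move=> [s t] _; rewrite /= lee_fin /F /= mul1r.
  have [->|/dN tN] := eqVneq (th^`()%classic t) 0; first by rewrite !mulr0 normr0.
  have [->|/kap_neq0 st] := eqVneq (kap s t) 0; first by rewrite mulr0 mul0r normr0.
  rewrite indicE mem_set; last first.
    by move: tN; rewrite /= !in_itv/= -!ler_norml; exact: le_trans.
  by rewrite mulr1 !normrM ler_wpM2r// ler_piMr// kap_abs.
have E1 := Rint_fubini iF.
have HA (s : R) : \int[lam]_t F (s, t) = - (h s * th s).
  rewrite -mulrN -(int_kap_deriv s c1).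
  have ik : lam.-integrable setT (EFin \o (fun t : R => kap s t * th^`()%classic t)); last first.
    apply: (etrans _ (RintegralZl (h s) measurableT ik)).
    by apply: eq_Rintegral => t _; rewrite /F /= mulrA.
  have slk : slice_loc (kap s).
    apply: (slice_loc_le (measurable_kap2 s) slc1) => t /=.
    by rewrite normr1; exact: kap_abs.
  have cbd : cbfun (th^`()%classic) by split; [exact: md|exists M, N; split].
  exact: slice_loc_cbfun slk cbd.
have HB (t : R) : \int[lam]_s F (s, t) = prim h t * th^`()%classic t.
  exact: (RintegralZr (th^`()%classic t) measurableT (slice_loc_cbfun lh (kap_cbfun t))).
transitivity (\int[lam]_t \int[lam]_s F (s, t)).
  by apply: eq_Rintegral => t _; rewrite HB.
rewrite -E1; apply: (etrans _ (Rint_opp (slice_loc_cbfun lh cb1))).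
by apply: eq_Rintegral => s _; rewrite HA.
Qed.

End kernel.

(** * Absolute continuity on almost every vertical line *)

Section acl.
Context {R : realType} {n : nat}.
Implicit Types (u g z : 'rV[R]_n.+1 -> R) (y : 'rV[R]_n).
Local Notation lam := (@lebesgue_measure R).
Local Notation mu := (@leb R n).
Local Notation nu := (@leb R n.+1).

(** Boxes have finite height, so on a box a bound that does not involve the last coordinate is enough. *)
Lemma L1loc_cyl u (k : nat -> 'rV[R]_n -> \bar R) : measurable_fun setT u ->
  (forall N, measurable_fun setT (k N)) -> (forall N y, (0 <= k N y)%E) ->
  (forall N : nat, (\int[mu]_(y in cbox N%:R) k N y < +oo)%E) ->
  (forall (N : nat) y t, cbox N%:R y -> t \in `[- N%:R, N%:R] ->
     (`|u (row_rcons y t)|%:E <= k N y)%E) -> L1loc u.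
Proof.
move=> mu_ mk k0 koo uk; apply: L1loc_cbox => // N.
have mB := @measurable_cbox R n.+1 N%:R; have mB' := @measurable_cbox R n N%:R.
apply/(integrable_mkcond _ mB); rewrite restrict_EFin.
have mr : measurable_fun setT (u \_ (cbox N%:R)).
  by apply/(measurable_restrictT _ mB); exact: measurable_funTS.
apply/integrableP; split; first exact/measurable_EFinP.
rewrite leb_ge0_fubini1//; last by do 2 apply: measurableT_comp => //.
pose J : set R := `[- N%:R, N%:R]%classic.
have mJ : measurable J by exact: measurable_itv.
have mkr : measurable_fun setT (k N \_ (cbox N%:R)).
  by apply/(measurable_restrictT _ mB'); exact: measurable_funTS.
have kr0 y : (0 <= (k N \_ (cbox N%:R)) y)%E by apply: erestrict_ge0 => *; exact: k0.
apply: (@le_lt_trans _ _ (\int[mu]_y ((k N \_ (cbox N%:R)) y * lam J))%E).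
  apply: ge0_le_integral => //.
  - by move=> y _; exact: integral_ge0.
  - pose F (x : 'rV[R]_n.+1) := `|(EFin \o u \_ (cbox N%:R)) x|%E.
    have mabs : measurable_fun [set: 'rV[R]_n.+1] F by do 2 apply: measurableT_comp => //.
    have H := measurable_fun_fubini_tonelli_F (m2 := lam) _ (measurable_comp_rc mabs).
    by apply: H => p; exact: abse_ge0.
  - exact: emeasurable_funM mkr (measurable_cst _).
  - move=> y _; have -> : lam J = (\int[lam]_t (\1_J t)%:E)%E by rewrite integral_indic ?setIT.
    rewrite -ge0_integralZl//; last by apply/measurable_EFinP; exact: measurable_indic.
    apply: ge0_le_integral => //.
    + apply: measurableT_comp => //.
      exact: (@measurable_slice R n _ _ (EFin \o u \_ (cbox N%:R)) y ((measurable_EFinP _ _).2 mr)).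
    + apply: measurable_funeM; apply/measurable_EFinP; exact: measurable_indic.
    move=> t _; rewrite [X in (`|(X)%:E| <= _)%E]patchE; case: ifPn => [/set_mem/row_rcons_cbox[h1 h2]|_]; last first.
      by rewrite abse0 mule_ge0 ?lee_fin//; exact: kr0.
    by rewrite patchE mem_set// indicE mem_set// mule1; exact: uk.
rewrite ge0_integralZr//.
rewrite -integral_mkcond lte_mul_pinfty//; last first.
  by rewrite /= lebesgue_measure_itv/=; case: ifPn => _; rewrite ?ltry// -EFinD ltry.
  by rewrite ge0_fin_numE// integral_ge0.
by apply: integral_ge0.
Qed.

Lemma L1loc_comp_init (c : 'rV[R]_n -> R) : L1loc c -> L1loc (c \o @row_init R n).
Proof.
move=> lc; apply: (@L1loc_cyl _ (fun _ y => `|c y|%:E)) => //.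
- exact: measurableT_comp lc.1 (@measurable_row_init R n).
- by move=> _; apply/measurable_EFinP; apply: measurableT_comp => //; exact: lc.1.
- by move=> N; have /integrableP[_] := L1loc_integrable_cbox N%:R lc.
- by move=> N y t _ _; rewrite /= row_init_rcons.
Qed.

Definition vprim g (x : 'rV[R]_n.+1) : R :=
  prim (fun s => g (row_rcons (row_init x) s)) (row_last x).

Lemma L1loc_vprim g : L1loc g -> L1loc (vprim g).
Proof.
move=> lg; have mg := lg.1.
pose k (N : nat) y := (\int[lam]_s `|((g \_ (cbox N%:R)) (row_rcons y s))%:E|)%E.
have mgN (N : nat) : measurable_fun setT (g \_ (cbox N%:R)).
  by apply/(measurable_restrictT _ (@measurable_cbox R n.+1 N%:R)); exact: measurable_funTS.
have mk N : measurable_fun setT (k N).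
  pose F (x : 'rV[R]_n.+1) := `|((g \_ (cbox N%:R)) x)%:E|%E.
  have mabs : measurable_fun [set: 'rV[R]_n.+1] F.
    by apply: measurableT_comp => //; exact/measurable_EFinP.
  have H := measurable_fun_fubini_tonelli_F (m2 := lam) _ (measurable_comp_rc mabs).
  by apply: H => p; exact: abse_ge0.
apply: (@L1loc_cyl _ k) => //.
- pose q (p : 'rV[R]_n.+1 * measurableTypeR R) : R :=
    g (row_rcons (row_init p.1) p.2) * kap p.2 (row_last p.1).
  have mq : measurable_fun setT q.
    apply: measurable_funM.
      apply: (measurableT_comp (f := g \o rc) (g := fun p : 'rV[R]_n.+1 * measurableTypeR R => (row_init p.1, p.2))).
        exact: measurable_comp_rc.
      apply/measurable_fun_pairP; split; last exact: measurable_snd.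
      exact: measurableT_comp (@measurable_row_init R n) measurable_fst.
    apply: (measurableT_comp (f := fun p : measurableTypeR R * measurableTypeR R => kap p.1 p.2)
      (g := fun p : 'rV[R]_n.+1 * measurableTypeR R => (p.2, row_last p.1 : measurableTypeR R))).
      exact: measurable_kap.
    apply/measurable_fun_pairP; split; first exact: measurable_snd.
    exact: measurableT_comp (@coord_measurable_rV R n.+1 ord_max) measurable_fst.
  exact: (measurable_Rint_param lam mq).
- by move=> N y; exact: integral_ge0.
- move=> N.
  have mB := @measurable_cbox R n.+1 N%:R; have mB' := @measurable_cbox R n N%:R.
  have /(integrable_mkcond _ mB) := L1loc_integrable_cbox N%:R lg.
  rewrite restrict_EFin => /integrableP[_]; apply: le_lt_trans.
  rewrite leb_ge0_fubini1//; last first.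
    by apply: measurableT_comp => //; exact/measurable_EFinP.
  apply: (@ge0_subset_integral _ _ _ mu (cbox N%:R) setT mB' measurableT (k N)) => //.
  by move=> y _; exact: integral_ge0.
- move=> N y t yN tN; rewrite /vprim row_init_rcons row_last_rcons /prim /Rintegral.
  set h := (fun s => _); have mh : measurable_fun setT h.
    apply/measurable_EFinP; apply: measurable_funM; last exact: measurable_kap1.
    exact: measurable_slice.
  apply: (@le_trans _ _ (\int[lam]_s `|h s|)%E); last first.
    apply: ge0_le_integral => //.
    + exact: measurableT_comp.
    + by apply: measurableT_comp => //; apply/measurable_EFinP; exact: measurable_slice (mgN N).
    move=> s _; rewrite /h /= lee_fin normrM patchE.
    have [->|/kap_neq0 st] := eqVneq (kap s t) 0; first by rewrite normr0 mulr0.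
    rewrite mem_set; last first.
      apply/row_rcons_cbox; split => //; move: tN; rewrite !in_itv/= -!ler_norml.
      exact: le_trans.
    by rewrite ler_piMr// kap_abs.
  have := le_abse_integral lam measurableT mh.
  by apply: le_trans; case: (\int[_]_x _)%E => //= *; rewrite normr0 leey.
Qed.

Lemma continuous_prim (h : R -> R) : slice_loc h -> continuous (prim h).
Proof.
move=> lh t; have tt : t - 1 < t + 1 by lra.
have := parameterized_integral_continuous (ltW tt) (slice_loc_itv _ _ lh).
move=> /(continuous_within_itvP _ tt)[+ _ _] => /(_ t).
rewrite in_itv/= gtrDl ltrDl ltr01 oppr_lt0 ltr01 => /(_ isT) ct.
have {}ct : {for t, continuous (fun x => prim h (t - 1) + parameterized_integral lam (t - 1) x h)}.
  by apply: (@continuousD _ _ _ (cst (prim h (t - 1)))) => //; exact: cst_continuous.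
have e : \forall x \near t, prim h (t - 1) + parameterized_integral lam (t - 1) x h = prim h x.
  near=> x; have tx : t - 1 <= x.
    by apply/ltW; near: x; apply: lt_nbhsr; rewrite gtrDl oppr_lt0.
  by rewrite -[RHS](subrK (prim h (t - 1))) addrC primB.
move: ct; rewrite /prop_for /continuous_at (nbhs_singleton e).
exact: cvg_trans (near_eq_cvg e).
Unshelve. all: by end_near.
Qed.

(** The vanishing integral makes the primitive compactly supported. *)
Lemma cc1_primitive (psi : R -> R) (N : nat) : continuous psi ->
  (forall t, psi t != 0 -> `|t| <= N%:R) -> \int[lam]_t psi t = 0 ->
  exists th, C1c1 setT th /\ forall t, th^`()%classic t = psi t.
Proof.
move=> cpsi psiN psi0; have cb := cc1_cbfun cpsi psiN.
have slc1 : slice_loc (cst 1 : R -> R).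
  split; first exact: measurable_cst.
  move=> K; apply: integrable_cst_fin => //.
  by rewrite /= lebesgue_measure_itv/=; case: ifPn => _; rewrite ?ltry// -EFinD ltry.
have ipsi : lam.-integrable setT (EFin \o psi).
  by have := slice_loc_cbfun slc1 cb; apply: eq_integrable => // t _; rewrite /= mul1r.
pose th t := \int[lam]_(s in `]-oo, t]) psi s.
have dth (t : R) : is_derive t 1 th (psi t).
  have [||||h1 h2] := @continuous_FTC1 _ psi -oo%O t (t + 1).
  - by rewrite ltrDl.
  - by apply: integrableS ipsi => //.
  - by rewrite ltNyr.
  - exact: cpsi.
  by apply: DeriveDef; [exact: h1|rewrite -derive1E].
exists th; split; last by move=> t; rewrite derive1E; apply: derive_val.
apply: (C1c1I dth cpsi (@segment_compact R (- N%:R) N%:R)) => t; apply: contra_neqP.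
rewrite /= in_itv/= -ler_norml => /negP; rewrite -ltNge => Nt.
rewrite /th Rintegral_mkcond; have [t0|t0] := leP t 0.
  rewrite /Rintegral integral0_eq// => s _; rewrite patchE; case: ifPn => // /set_mem.
  rewrite /= in_itv/= => st; congr EFin; apply/eqP/negPn/negP => /psiN.
  by rewrite leNgt => /negP; apply; apply: lt_le_trans Nt _; rewrite !ler0_norm ?lerN2// (le_trans st).
rewrite -[RHS]psi0; apply: eq_Rintegral => s _; rewrite patchE; case: ifPn => // /negP st.
symmetry; apply/eqP/negPn/negP => /psiN sN; apply: st; apply: mem_set.
rewrite /= in_itv/= (le_trans (ler_norm s))// (le_trans sN)// ltW//.
by rewrite -(gtr0_norm t0).

Qed.
Lemma int_tent : \int[lam]_t tent t = 1.
Proof.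
rewrite -[RHS](_ : stepf 0 - stepf (- 1 : R) = _); last by rewrite stepf_ge1// stepf_le0// subr0.
rewrite -(C1_FTC is_derive_stepf continuous_tent) ?oppr_le0// [RHS]Rintegral_mkcond.
apply: eq_Rintegral => t _; rewrite patchE; case: ifPn => // /negP h.
have [t1|t1] := leP t (- 1); first exact: tent_le_eq0.
have [t2|t2] := leP 0 t; first exact: tent_ge_eq0.
by case: h; apply: mem_set; rewrite /= in_itv/= !ltW.
Qed.

Lemma tent_bound (t : R) : tent t != 0 -> `|t| <= 1.
Proof.
apply: contra_neqT; rewrite -ltNge => h; have [t0|t0] := leP 0 t; first exact: tent_ge_eq0.
by apply: tent_le_eq0; rewrite lerNr ltW// -(ltr0_norm t0).
Qed.

Lemma tent_cbfun : cbfun (@tent R).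
Proof. exact: (cc1_cbfun (N := 1) (@continuous_tent R) tent_bound). Qed.

Lemma C1c_cbfunV m (a : 'rV[R]_m -> R) : C1c a -> cbfunV a.
Proof.
move=> ca; have cc := C1c_continuous ca; split; first exact: continuous_measurable_rV.
have [_ _ cs] := ca; have [M hM] := cc_bounded cc cs (@C1c_neq0 _ _ a).
have [N hN] := compact_sub_cbox cs.
exists (Num.truncn M).+1, N; split => t; last by move=> /C1c_neq0/hN.
by rewrite (le_trans (hM t))//; apply/ltW/truncnS_gt.
Qed.

Lemma L1loc_sub m (u v : 'rV[R]_m -> R) : L1loc u -> L1loc v -> L1loc (fun x => u x - v x).
Proof.
move=> [mu_ iu] [mv iv]; split; first exact: measurable_funB.
move=> K cK; have mK := compact_measurable_rV cK.
by have := integrableB mK (iu K cK) (iv K cK).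
Qed.

Lemma cbfun_integrable (th : R -> R) : cbfun th -> lam.-integrable setT (EFin \o th).
Proof.
have slc1 : slice_loc (cst 1 : R -> R).
  split; first exact: measurable_cst.
  move=> K; apply: integrable_cst_fin => //.
  by rewrite /= lebesgue_measure_itv/=; case: ifPn => _; rewrite ?ltry// -EFinD ltry.
by move=> cb; have := slice_loc_cbfun slc1 cb; apply: eq_integrable => // t _; rewrite /= mul1r.
Qed.

Lemma slint_comp_init (c : 'rV[R]_n -> R) (th : R -> R) y : cbfun th ->
  slint (c \o @row_init R n) th y = c y * \int[lam]_t th t.
Proof.
move=> cb; rewrite /slint.
apply: (etrans _ (RintegralZl (c y) measurableT (cbfun_integrable cb))).
by apply: eq_Rintegral => t _; rewrite /= row_init_rcons.
Qed.

(** For every test function th, the function th - m tent, where m is the integral of th, is the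
    derivative of a test function.  Hence z pairs with a product a * th as the function c does, where
    c is the average of z against [tent]. *)
Lemma last_indep z : L1loc z ->
  (forall a th, C1c a -> C1c1 setT th ->
    (\int[nu]_x (z x * tensor a (th^`()%classic) x)%:E = 0)%E) ->
  exists2 c, L1loc c & {ae nu, forall x, z x = c (row_init x)}.
Proof.
move=> lz hz; pose c := slint z (@tent R).
have lc : L1loc c by apply: L1loc_slint => //; exact: tent_cbfun.
have lci := L1loc_comp_init lc.
exists c => //.
suff : {ae nu, forall x, z x - (c \o @row_init R n) x = 0}.
  by apply: filterS => x /eqP; rewrite subr_eq0 => /eqP.
apply: tensor_separates; first exact: L1loc_sub.
move=> a th ca cth; have cVa := C1c_cbfunV ca; have [cbth _] := C1c1_cbfun cth.
set m := \int[lam]_t th t.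
have iz psi : cbfun psi -> nu.-integrable setT (EFin \o (fun x => z x * tensor a psi x)).
  by move=> cp; exact: L1loc_cbfunV lz (cbfun_tensor cVa cp).
have E1 : (\int[nu]_x (z x * tensor a th x)%:E = m%:E * \int[nu]_x (z x * tensor a (@tent R) x)%:E)%E.
  have [N [hN _]] := C1c1_bound cth.
  pose psi t := th t - m * tent t.
  have cpsi : continuous psi.
    move=> t; apply: (@continuousB _ _ _ th (fun t => m * tent t)); first exact: C1c1_continuous cth t.
    apply: (@continuousM _ _ (cst m) (@tent R)); first exact: cst_continuous.
    exact: continuous_tent.
  have psiN t : psi t != 0 -> `|t| <= (maxn N 1)%:R.
    apply: contra_neqT; rewrite -ltNge => h.
    have hN' : (N%:R : R) < `|t| by apply: le_lt_trans h; rewrite ler_nat leq_maxl.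
    have h1 : (1 : R) < `|t| by apply: le_lt_trans h; rewrite (ler_nat _ 1) leq_maxr.
    have th0 : th t = 0 by apply/eqP/negPn/negP => /hN; rewrite leNgt hN'.
    have te0 : tent t = 0 by apply/eqP/negPn/negP => /tent_bound; rewrite leNgt h1.
    by rewrite /psi th0 te0 mulr0 subrr.
  have it := cbfun_integrable tent_cbfun.
  have psi0 : \int[lam]_t psi t = 0.
    have imt := integrableZl measurableT m it.
    apply: (etrans (RintegralB measurableT (cbfun_integrable cbth) imt)).
    have -> := RintegralZl m measurableT it.
    by rewrite int_tent mulr1 subrr.
  have [Th [cTh dTh]] := cc1_primitive cpsi psiN psi0.
  have := hz a Th ca cTh; rewrite (_ : Th^`()%classic = psi); last exact/funext.
  have iz2 := integrableZl measurableT m (iz _ tent_cbfun).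
  have psiE x : (z x * tensor a psi x)%:E =
    ((z x * tensor a th x)%:E - m%:E * (z x * tensor a (@tent R) x)%:E)%E.
    by rewrite -EFinM -EFinB /tensor /psi; congr EFin; ring.
  under eq_integral => x _ do rewrite psiE.
  rewrite integralB//; last exact: iz.
  rewrite integralZl//; last exact: iz tent_cbfun.
  set A := (\int[_]_x (z x * tensor a th x)%:E)%E; set B := (\int[_]_x _)%E.
  have fA : A \is a fin_num by apply: integrable_fin_num (iz _ cbth).
  have fB : B \is a fin_num by apply: integrable_fin_num (iz _ tent_cbfun).
  by rewrite -(fineK fA) -(fineK fB) -EFinM -EFinB => -[/eqP]; rewrite subr_eq0 => /eqP ->.
under eq_integral => x _ do rewrite mulrBl EFinB.
rewrite integralB//; last 2 first.
- exact: iz.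
- exact: L1loc_cbfunV lci (cbfun_tensor cVa cbth).
rewrite E1 slint_fubini//; last exact: tent_cbfun.
rewrite slint_fubini//.
under [in X in (_ - X)%E]eq_integral => y _ do rewrite slint_comp_init// mulrAC mulrC EFinM.
have ica := L1loc_cbfunV lc cVa.
by rewrite integralZl// subee// fin_numM// integrable_fin_num.
Qed.

Lemma vprim_test g a th : L1loc g -> C1c a -> C1c1 setT th ->
  (\int[nu]_x (vprim g x * tensor a (th^`()%classic) x)%:E = - \int[nu]_x (g x * tensor a th x)%:E)%E.
Proof.
move=> lg ca cth; have cVa := C1c_cbfunV ca; have [cbth cbdth] := C1c1_cbfun cth.
have lG := L1loc_vprim lg.
rewrite !slint_fubini// -integralN; last first.
  apply: fin_num_adde_defl; rewrite fin_numN; apply: integrable_neg_fin_num => //.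
  exact: L1loc_cbfunV (L1loc_slint lg cbth) cVa.
have mm u psi : L1loc u -> cbfun psi -> measurable_fun setT (fun y => (slint u psi y * a y)%:E).
  move=> lu cp; apply/measurable_EFinP; apply: measurable_funM; last exact: cVa.1.
  by apply: measurable_slint; [case: lu|case: cp].
apply: ae_eq_integral => //.
- exact: mm.
- by apply: measurableT_comp => //; exact: mm.
apply: filterS (ae_slice_loc lg) => y ly _.
rewrite -EFinN -mulNr /slint; congr (_ * _)%:E.
rewrite -(prim_deriv_test ly cth); apply: eq_Rintegral => t _.
by rewrite /vprim row_init_rcons row_last_rcons.
Qed.

(** The function f - vprim g has weak derivative 0 in the last direction. *)
Lemma acl_ae f g : L1loc f -> L1loc g ->
  (forall a th, C1c a -> C1c1 setT th ->
    (\int[nu]_x (f x * tensor a (th^`()%classic) x)%:E = - \int[nu]_x (g x * tensor a th x)%:E)%E) ->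
  exists2 c, L1loc c & {ae nu, forall x, f x = c (row_init x) + vprim g x}.
Proof.
move=> lf lg hfg; have lG := L1loc_vprim lg.
have [] := @last_indep (fun x => f x - vprim g x) (L1loc_sub lf lG).
  move=> a th ca cth; have [_ cbd] := C1c1_cbfun cth.
  have cT := cbfun_tensor (C1c_cbfunV ca) cbd.
  under eq_integral => x _ do rewrite mulrBl EFinB.
  rewrite integralB//; try exact: L1loc_cbfunV.
  rewrite hfg// vprim_test// subee// fin_numN.
  apply: integrable_fin_num => //.
  by apply: L1loc_cbfunV => //; apply: cbfun_tensor; [exact: C1c_cbfunV|case: (C1c1_cbfun cth)].
by move=> c lc h; exists c => //; apply: filterS h => x /eqP; rewrite subr_eq => /eqP.
Qed.

End acl.

Lemma ae_forall_countable d (T : measurableType d) {R : realType} (m : {measure set T -> \bar R})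
    (I : countType) (P : I -> T -> Prop) :
  (forall i, {ae m, forall x, P i x}) -> {ae m, forall x, forall i, P i x}.
Proof.
move=> h; have : {ae m, forall x, forall k, if unpickle k is Some i then P i x else True}.
  by apply/ae_foralln => k; case: (unpickle k) => // ; exact: aeW.
by apply: filterS => x hx i; have := hx (pickle i); rewrite pickleK.
Qed.

Section precise.
Context {R : realType}.
Local Notation lam := (@lebesgue_measure R).

Lemma measurable_eball m (x : 'rV[R]_m) r : measurable (eball x r).
Proof. by apply: open_measurable_rV; exact: open_eball. Qed.

Lemma average_bound m (f : 'rV[R]_m -> R) x r (l K c : R) : L1loc f -> 0 < r -> 0 < c ->
  (c%:E <= leb m (eball x r))%E ->
  (\int[leb m]_(y in eball x r) `|f y - l|%:E <= K%:E)%E ->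
  `|average f x r - l| <= K / c.
Proof.
move=> lf r0 c0 cl hK; set E := eball x r.
have mE : measurable E := measurable_eball x r.
have Eoo : (leb m E < +oo)%E.
  apply: le_lt_trans (leb_ball_fin x r); apply: le_measure; rewrite ?inE//.
    exact: measurable_ball_rV.
  exact: eball_sub_ball.
have fE : leb m E \is a fin_num by rewrite ge0_fin_numE.
have vc : c <= fine (leb m E) by rewrite -lee_fin fineK.
have v0 : 0 < fine (leb m E) by apply: lt_le_trans vc.
have iE : (leb m).-integrable E (EFin \o f).
  apply: integrableS (L1loc_integrable_ball x r lf) => //; first exact: measurable_ball_rV.
  exact: eball_sub_ball.
have il : (leb m).-integrable E (EFin \o cst l) by apply: integrable_cst_fin.
have -> : average f x r - l = (\int[leb m]_(y in E) (f y - l)) / fine (leb m E).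
  rewrite RintegralB// Rintegral_cst// mulrBl mulfK//.
  exact: lt0r_neq0.
rewrite normrM [X in _ * X]gtr0_norm ?invr_gt0//.
have iB : (leb m).-integrable E (EFin \o (fun y => f y - l)) by have := integrableB mE iE il.
have hn : `|\int[leb m]_(y in E) (f y - l)| <= K.
  rewrite -lee_fin; apply: le_trans hK.
  rewrite /Rintegral -abse_EFin fineK; last exact: integrable_fin_num.
  exact: le_abse_integral (measurable_int _ iB).
apply: (@le_trans _ _ (K / fine (leb m E))).
  by rewrite ler_wpM2r// invr_ge0 ltW.
have K0 : 0 <= K by apply: le_trans hn.
by rewrite ler_wpM2l// lef_pV2// posrE.
Qed.

Lemma L1loc_add m (u v : 'rV[R]_m -> R) : L1loc u -> L1loc v -> L1loc (fun x => u x + v x).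
Proof.
move=> [mu_ iu] [mv iv]; split; first exact: measurable_funD.
move=> K cK; have mK := compact_measurable_rV cK.
by have := integrableD mK (iu K cK) (iv K cK).
Qed.

Lemma L1loc_norm m (u : 'rV[R]_m -> R) : L1loc u -> L1loc (fun x => `|u x|).
Proof.
move=> [mu_ iu]; split; first exact: measurableT_comp.
by move=> K cK; have := integrable_abse (iu K cK).
Qed.

Lemma itv_indic_cbfun (p q : R) : cbfun (\1_(`[p, q]%classic) : R -> R).
Proof.
split; first by apply: measurable_indic; exact: measurable_itv.
exists 1%N, (Num.truncn (Num.max `|p| `|q|)).+1; split => s; rewrite indicE.
  by case: (_ \in _); rewrite ?normr1 ?normr0.
case: (boolP (s \in _)) => [/set_mem|_]; last by rewrite eqxx.
rewrite /= in_itv/= => /andP[ps sq] _; rewrite in_itv/= -ler_norml.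
apply: le_trans (ltW (truncnS_gt _)); rewrite le_max.
have [s0|s0] := leP 0 s; first by rewrite (ger0_norm s0) (le_trans sq (ler_norm q)) orbT.
by rewrite (ltr0_norm s0) ler_normr lerN2 ps orbT.
Qed.

Section cylinder.
Context {n : nat}.
Local Notation mu := (@leb R n).
Local Notation nu := (@leb R n.+1).

Lemma eball_cyl (y0 y : 'rV[R]_n) (t s r : R) : 0 < r -> eball (row_rcons y0 t) r (row_rcons y s) ->
  ball y0 r y /\ s \in `]t - r, t + r[.
Proof.
move=> r0 /(eball_sub_ball r0)/(ball_rVP _ _ r0) h; split.
  by apply/ball_rVP => // i; have := h (lift ord_max i); rewrite !mxE liftK.
by have := h ord_max; rewrite !mxE unlift_none ltr_distlC in_itv/=.
Qed.

Lemma cyl_integral_le (F : 'rV[R]_n.+1 -> R) (W : 'rV[R]_n -> R) y0 (t r : R) :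
  0 < r -> measurable_fun setT F -> (forall x, 0 <= F x) ->
  measurable_fun setT W -> (forall y, 0 <= W y) ->
  {ae mu, forall y, forall s, ball y0 r y -> s \in `]t - r, t + r[ -> F (row_rcons y s) <= W y} ->
  (\int[nu]_(x in eball (row_rcons y0 t) r) (F x)%:E <= (2 * r)%:E * \int[mu]_(y in ball y0 r) (W y)%:E)%E.
Proof.
move=> r0 mF F0 mW W0 FW; set E := eball _ _.
have mE : measurable E by exact: measurable_eball.
pose J : set R := `]t - r, t + r[%classic.
have mJ : measurable J by exact: measurable_itv.
have lJ : lam J = (2 * r)%:E.
  by rewrite /= lebesgue_measure_itv/= lte_fin ifT; [rewrite -EFinD; congr EFin; ring|lra].
have mFE : measurable_fun setT (F \_ E).
  by apply/(measurable_restrictT _ mE); exact: measurable_funTS.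
have FE0 x : 0 <= (F \_ E) x by rewrite patchE; case: ifPn.
have mB := measurable_ball_rV y0 r.
have mWB : measurable_fun setT (W \_ (ball y0 r)).
  by apply/(measurable_restrictT _ mB); exact: measurable_funTS.
have WB0 y : 0 <= (W \_ (ball y0 r)) y by rewrite patchE; case: ifPn.
rewrite integral_mkcond -[X in (X <= _)%E](_ : \int[nu]_x ((F \_ E) x)%:E = _)%E; last first.
  by apply: eq_integral => x _; rewrite !patchE; case: ifPn.
rewrite [in leRHS]integral_mkcond -[X in (_ <= _ * X)%E](_ : \int[mu]_y ((W \_ (ball y0 r)) y)%:E = _)%E; last first.
  by apply: eq_integral => x _; rewrite !patchE; case: ifPn.
rewrite leb_ge0_fubini1//; last exact/measurable_EFinP.
rewrite -ge0_integralZl//; last 3 first.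
- exact/measurable_EFinP.
- by move=> y _; rewrite lee_fin.
- by rewrite lee_fin mulr_ge0// ltW.
apply: ae_ge0_le_integral => //.
- by move=> y _; apply: integral_ge0 => s _; rewrite lee_fin.
- have mF' : measurable_fun [set: 'rV[R]_n.+1] (EFin \o (F \_ E)) by exact/measurable_EFinP.
  have H := measurable_fun_fubini_tonelli_F (m2 := lam) _ (measurable_comp_rc mF').
  by apply: H => p; rewrite /= lee_fin.
- by move=> y _; rewrite mule_ge0 ?lee_fin// mulr_ge0// ltW.
- by apply: measurable_funeM; exact/measurable_EFinP.
apply: filterS FW => y yW _.
have -> : (2 * r)%:E = (\int[lam]_s (\1_J s)%:E)%E by rewrite integral_indic ?setIT.
rewrite muleC -ge0_integralZl//.
  apply: ge0_le_integral => //.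
  - by move=> s _; rewrite lee_fin.
  - exact: (@measurable_slice R n _ _ (EFin \o F \_ E) y ((measurable_EFinP _ _).2 mFE)).
  - by apply: measurable_funeM; apply/measurable_EFinP; exact: measurable_indic.
  move=> s _; rewrite -EFinM lee_fin [leLHS]patchE; case: ifPn => [/set_mem/(eball_cyl r0)[h1 h2]|_].
    by rewrite patchE mem_set// indicE mem_set// mulr1; exact: yW.
  by rewrite mulr_ge0.
  by apply/measurable_EFinP; exact: measurable_indic.
by rewrite lee_fin.
Qed.

(** A statement about all the points of almost every line.  Take y0 to be a Lebesgue point of the
    countably many functions u q, the values at a rational height q, and v (p, q), the variations
    between rational heights.  A height t lies between rationals p and q that are close to it, and
    near (y0, t) the values on the line through y differ from the value at q by at most v (p, q) y. *)
Lemma acl_average f g c : L1loc f -> L1loc g -> L1loc c ->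
  {ae nu, forall x, f x = c (row_init x) + vprim g x} ->
  {ae mu, forall y, slice_loc (fun s => g (row_rcons y s)) /\
    forall t, average f (row_rcons y t) r @[r --> 0^'+] -->
      c y + prim (fun s => g (row_rcons y s)) t}.
Proof.
move=> lf lg lc hf.
pose u (q : rat) y := c y + slint g (fun s => kap s (ratr q)) y.
pose v (pq : rat * rat) := slint (fun x => `|g x|) (\1_(`[ratr pq.1, ratr pq.2]%classic) : R -> R).
have lu q : L1loc (u q) by apply: L1loc_add => //; apply: L1loc_slint => //; exact: kap_cbfun.
have lv pq : L1loc (v pq) by apply: L1loc_slint; [exact: L1loc_norm|exact: itv_indic_cbfun].
pose Ft x := c (row_init x) + vprim g x.
have lFt : L1loc Ft by apply: L1loc_add; [exact: L1loc_comp_init|exact: L1loc_vprim].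
have hu := ae_forall_countable (fun q => lebesgue_point_ae (lu q)).
have hv := ae_forall_countable (fun pq => lebesgue_point_ae (lv pq)).
have hs := ae_slice_loc lg.
have slabs (h : R -> R) : slice_loc h -> slice_loc (fun s => `|h s|).
  move=> lh; have mh : measurable_fun setT (fun s => `|h s|) by apply: measurableT_comp lh.1.
  by apply: (slice_loc_le mh lh) => s; rewrite normr_id.
have vE y p q : slice_loc (fun s => g (row_rcons y s)) -> ratr p <= ratr q :> R ->
    v (p, q) y = prim (fun s => `|g (row_rcons y s)|) (ratr q) - prim (fun s => `|g (row_rcons y s)|) (ratr p).
  move=> ly pq; rewrite primB//; last exact: slabs.
  rewrite Rintegral_mkcond; apply: eq_Rintegral => s _.
  by rewrite patchE indicE; case: ifPn => _; rewrite ?mulr1 ?mulr0.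
have vB y p q s : slice_loc (fun s => g (row_rcons y s)) -> s \in `[ratr p, ratr q] ->
    `|prim (fun s => g (row_rcons y s)) s - prim (fun s => g (row_rcons y s)) (ratr q)| <= v (p, q) y.
  move=> ly; rewrite in_itv/= => /andP[ps sq].
  rewrite distrC primB// vE//; last exact: le_trans sq.
  apply: (@le_trans _ _ (prim (fun s => `|g (row_rcons y s)|) (ratr q) - prim (fun s => `|g (row_rcons y s)|) s)).
    rewrite primB//; last exact: slabs.
    by apply: le_normr_Rintegral => //; exact: slice_loc_itv.
  rewrite lerD2l lerN2 -subr_ge0 primB//; last exact: slabs.
  by apply: Rintegral_ge0.
apply: filterS3 hu hv hs => y0 hu hv ly0; split => // t.
set h := fun s => g (row_rcons y0 s).
set l := c y0 + prim h t.
apply/(@cvgrPdist_le _ R) => /= e e0.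
pose ce : R := n.+2%:R^-1 ^+ n.+1.
have ce0 : 0 < ce by rewrite exprn_gt0// invr_gt0.
(* the three terms of W below contribute 2, 2 and 6 * 2^n times e1 * r^(n+1) *)
pose C : R := 4 + 6 * 2 ^+ n.
have C0 : 0 < C by rewrite addr_gt0// mulr_gt0// exprn_gt0.
pose e1 := e * ce / C.
have e10 : 0 < e1 by rewrite divr_gt0// mulr_gt0.
have [d1 d10 hd1] : exists2 d, 0 < d & forall s, `|s - t| < d -> `|prim h s - prim h t| <= e1.
  have := continuous_prim ly0 (x := t); rewrite /continuous_at.
  move=> /(@cvgrPdist_le _ R _ (nbhs t)) /(_ _ e10) [d /= d0 hd]; exists d => // s st.
  by rewrite distrC; apply: hd => /=; rewrite distrC.
have [d2 d20 hd2] : exists2 d, 0 < d & forall s, `|s - t| < d ->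
    `|prim (fun s => `|h s|) s - prim (fun s => `|h s|) t| <= e1.
  have := continuous_prim (slabs _ ly0) (x := t); rewrite /continuous_at.
  move=> /(@cvgrPdist_le _ R _ (nbhs t)) /(_ _ e10) [d /= d0 hd]; exists d => // s st.
  by rewrite distrC; apply: hd => /=; rewrite distrC.
pose d := Num.min d1 d2.
have d0 : 0 < d by rewrite lt_min d10.
have [p /andP[p1 p2]] : exists p : rat, t - d < ratr p < t.
  have /rat_in_itvoo[p] : t - d < t by rewrite gtrDl oppr_lt0.
  by rewrite in_itv/= => hp; exists p.
have [q /andP[q1 q2]] : exists q : rat, t < ratr q < t + d.
  have /rat_in_itvoo[q] : t < t + d by rewrite ltrDl.
  by rewrite in_itv/= => hq; exists q.
have d_le1 : d <= d1 by rewrite ge_min lexx.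
have d_le2 : d <= d2 by rewrite ge_min lexx orbT.
have [du du0 hdu] := hu q _ e10.
have [dv dv0 hdv] := hv (p, q) _ e10.
have pd : `|ratr p - t| < d by rewrite ltr0_norm ?subr_lt0//; lra.
have qd : `|ratr q - t| < d by rewrite gtr0_norm ?subr_gt0//; lra.
have v0 : v (p, q) y0 <= 2 * e1.
  rewrite vE//; last by lra.
  have h1 := hd2 _ (lt_le_trans pd d_le2).
  have h2 := hd2 _ (lt_le_trans qd d_le2).
  move: h1 h2; rewrite !ler_norml; rewrite -/h; lra.
pose dd := Num.min (Num.min du dv) (Num.min (t - ratr p) (ratr q - t)).
have dd0 : 0 < dd by rewrite !lt_min du0 dv0 !subr_gt0 p2 q1.
near=> r.
have r0 : 0 < r by near: r; exact: nbhs_right_gt.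
have rdd : r < dd by near: r; exact: nbhs_right_lt.
have [[rdu rdv] [rp rq]] : (r < du /\ r < dv) /\ (r < t - ratr p /\ r < ratr q - t).
  by move: rdd; rewrite !lt_min => /andP[/andP[-> ->] /andP[-> ->]].
rewrite distrC.
pose K := e1 * C * r ^+ n.+1.
have -> : e = K / (ce * r ^+ n.+1).
  rewrite /K /e1; field; rewrite !gt_eqF ?exprn_gt0//.
apply: average_bound => //; first by rewrite mulr_gt0// exprn_gt0.
  exact: leb_eball_ge.
have -> : (\int[nu]_(y in eball (row_rcons y0 t) r) `|f y - l|%:E =
    \int[nu]_(y in eball (row_rcons y0 t) r) `|Ft y - l|%:E)%E.
  apply: ae_eq_integral; first exact: measurable_eball.
  - apply/measurable_EFinP; apply: measurableT_comp => //; apply: measurable_funTS.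
    by apply: measurable_funB => //; exact: lf.1.
  - apply/measurable_EFinP; apply: measurableT_comp => //; apply: measurable_funTS.
    by apply: measurable_funB => //; exact: lFt.1.
  - by apply: filterS hf => x hx _; rewrite hx.
(* go from s to q on the line through y, from y to y0 at height q, from q to t on the line through y0 *)
pose W y := `|v (p, q) y - v (p, q) y0| + `|u q y - u q y0| + 3 * e1.
have mv : measurable_fun setT (fun y => `|v (p, q) y - v (p, q) y0|).
  by apply: measurableT_comp => //; apply: measurable_funB => //; exact: (lv (p, q)).1.
have muq : measurable_fun setT (fun y => `|u q y - u q y0|).
  by apply: measurableT_comp => //; apply: measurable_funB => //; exact: (lu q).1.
apply: (le_trans (@cyl_integral_le (fun x => `|Ft x - l|) W y0 t r r0 _ _ _ _ _)) => //.
- by apply: measurableT_comp => //; apply: measurable_funB => //; exact: lFt.1.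
- by do 2 apply: measurable_funD => //.
- by move=> y; rewrite !addr_ge0// mulr_ge0// ltW.
- apply: filterS (ae_slice_loc lg) => y ly s _; rewrite in_itv/= => /andP[s1 s2].
  rewrite /Ft /vprim row_init_rcons row_last_rcons.
  have B1 : `|prim (fun s => g (row_rcons y s)) s - prim (fun s => g (row_rcons y s)) (ratr q)| <= v (p, q) y.
    by apply: vB => //; rewrite in_itv/=; apply/andP; split; apply: ltW; lra.
  have B2 := hd1 _ (lt_le_trans qd d_le1).
  rewrite /W /l.
  have e1' : u q y = c y + prim (fun s => g (row_rcons y s)) (ratr q) by [].
  have e2' : u q y0 = c y0 + prim h (ratr q) by [].
  rewrite e1' e2'; move: B1 B2 v0; move: (prim _ s) (prim _ (ratr q)) (prim h _) (prim h t) (v _ y) (v _ y0).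
  move=> a1 a2 a3 a4 a5 a6; rewrite !ler_norml.
  have := ler_norm (a5 - a6); have := ler_norm (c y + a2 - (c y0 + a3)).
  have := ler_norm (- (c y + a2 - (c y0 + a3))); rewrite normrN.
  lra.
rewrite [X in (_ * X)%E](_ : _ = \int[mu]_(y in ball y0 r) (`|v (p, q) y - v (p, q) y0|%:E +
  `|u q y - u q y0|%:E + (3 * e1)%:E))%E; last first.
  by apply: eq_integral => y _; rewrite !EFinD.
have mB := measurable_ball_rV y0 r.
have mv' : measurable_fun (ball y0 r) (fun y => `|v (p, q) y - v (p, q) y0|%:E).
  by apply/measurable_EFinP; exact: measurable_funTS.
have mu' : measurable_fun (ball y0 r) (fun y => `|u q y - u q y0|%:E).
  by apply/measurable_EFinP; exact: measurable_funTS.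
have e30 : 0 <= 3 * e1 by rewrite mulr_ge0// ltW.
rewrite ge0_integralD//; last exact: emeasurable_funD.
rewrite ge0_integralD// integral_cst//.
apply: (@le_trans _ _ ((2 * r)%:E * ((e1 * r ^+ n)%:E + (e1 * r ^+ n)%:E + (3 * e1)%:E * ((2 * r) ^+ n)%:E))%E).
  apply: lee_wpmul2l; first by rewrite lee_fin mulr_ge0// ltW.
  apply: leeD; first by apply: leeD; [exact: hdv|exact: hdu].
  by apply: lee_wpmul2l; [rewrite lee_fin|exact: leb_ball_le].
have -> : K = 2 * r * (e1 * r ^+ n + e1 * r ^+ n + 3 * e1 * (2 * r) ^+ n).
  by rewrite /K /C exprMn exprS; ring.
by [].
by move=> y _; rewrite adde_ge0.
Unshelve. all: by end_near.
Qed.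

Definition vertical_derivative (f g : 'rV[R]_n.+1 -> R) := [/\ L1loc f, L1loc g &
  forall a th, C1c a -> C1c1 setT th ->
    (\int[nu]_x (f x * tensor a (th^`()%classic) x)%:E = - \int[nu]_x (g x * tensor a th x)%:E)%E].

Definition acl_line (f g : 'rV[R]_n.+1 -> R) (y : 'rV[R]_n) := slice_loc (fun s => g (row_rcons y s)) /\
  forall s t, f (row_rcons y t) - f (row_rcons y s) =
    prim (fun s => g (row_rcons y s)) t - prim (fun s => g (row_rcons y s)) s.

(** The precise representative takes the limit of the averages wherever it exists, which by
    [acl_average] is at every height of almost every line. *)
Lemma ae_acl_line f g : vertical_derivative f g -> f = precise_rep f ->
  {ae mu, forall y, acl_line f g y}.
Proof.
move=> [lf lg hfg] fp; have [c lc hc] := acl_ae lf lg hfg.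
apply: filterS (acl_average lf lg lc hc) => y [ly hy]; split => //.
have fE t : f (row_rcons y t) = c y + prim (fun s => g (row_rcons y s)) t.
  have := hy t; set l := c y + _ => hl; rewrite fp /precise_rep.
  have -> : `[< cvg (average f (row_rcons y t) r @[r --> 0^'+]) >] = true.
    by apply/asboolP; apply/cvg_ex; exists l.
  exact: cvg_lim hl.
by move=> s t; rewrite !fE; ring.
Qed.

Lemma acl_continuous f g y : acl_line f g y -> continuous (fun t => f (row_rcons y t)).
Proof.
move=> [ly h]; pose b := f (row_rcons y 0) - prim (fun s => g (row_rcons y s)) 0.
have -> : (fun t => f (row_rcons y t)) = (fun t => b + prim (fun s => g (row_rcons y s)) t).
  by apply/funext => t; rewrite /b -(subrK (f (row_rcons y 0)) (f (row_rcons y t))) h; ring.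
move=> t; apply: (@continuousD _ _ _ (cst b)); first exact: cst_continuous.
exact: continuous_prim.
Qed.

End cylinder.

End precise.

(** * The Gauss-Green formula for epigraphs *)

Section line.
Context {R : realType}.
Local Notation lam := (@lebesgue_measure R).
Implicit Types h : R -> R.

Lemma slice_loc_cst (a : R) : slice_loc (cst a : R -> R).
Proof.
split; first exact: measurable_cst.
move=> K; apply: integrable_cst_fin => //.
by rewrite /= lebesgue_measure_itv/=; case: ifPn => _; rewrite ?ltry// -EFinD ltry.
Qed.

Lemma slice_loc_continuous h : continuous h -> slice_loc h.
Proof.
move=> ch; split; first exact: continuous_measurable_fun.
move=> N; apply: continuous_compact_integrable; first exact: segment_compact.
by apply: continuous_subspaceT.
Qed.

Lemma slice_loc_norm h : slice_loc h -> slice_loc (fun s => `|h s|).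
Proof.
move=> lh; have mh : measurable_fun setT (fun s => `|h s|) by apply: measurableT_comp lh.1.
by apply: (slice_loc_le mh lh) => s; rewrite normr_id.
Qed.

Lemma prim_norm_diff h s t : slice_loc h -> s <= t ->
  `|prim h t - prim h s| <= prim (fun s => `|h s|) t - prim (fun s => `|h s|) s.
Proof.
move=> lh st; rewrite !primB//; last exact: slice_loc_norm.
by apply: le_normr_Rintegral => //; exact: slice_loc_itv.
Qed.

Lemma prim_norm_mono h s t : slice_loc h -> s <= t ->
  prim (fun s => `|h s|) s <= prim (fun s => `|h s|) t.
Proof. by move=> lh st; rewrite -subr_ge0 (le_trans _ (prim_norm_diff lh st)). Qed.

(** An approximate identity at a, of mass 1 on the interval [a - 1 / (k + 1), a]: the derivative of
    t |-> stepf ((k + 1) (t - a)). *)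
Definition delta_seq (k : nat) (a t : R) : R := k.+1%:R * tent (k.+1%:R * (t - a)).

Lemma delta_ge0 k a t : 0 <= delta_seq k a t.
Proof. by rewrite mulr_ge0// tent_ge0. Qed.

Lemma delta_supp k a t : delta_seq k a t != 0 -> a - k.+1%:R^-1 <= t <= a.
Proof.
have k0 : 0 < k.+1%:R :> R by [].
apply: contraR; rewrite negb_and -!ltNge => /orP[h|h]; rewrite /delta_seq.
  rewrite tent_le_eq0 ?mulr0// -ler_pdivlMl// mulrN1 lerBlDr addrC; exact: ltW.
by rewrite tent_ge_eq0 ?mulr0// mulr_ge0// subr_ge0 ltW.
Qed.

Lemma continuous_delta k a : continuous (delta_seq k a).
Proof.
move=> t; apply: (@continuousM _ _ (cst k.+1%:R) (fun t => tent (k.+1%:R * (t - a)))).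
  exact: cst_continuous.
apply: (@continuous_comp _ _ _ (fun t => k.+1%:R * (t - a)) (@tent R)); last exact: continuous_tent.
apply: (@continuousM _ _ (cst k.+1%:R) (fun t => t - a)); first exact: cst_continuous.
by apply: continuousB; [exact: id|exact: cst_continuous].
Qed.

Lemma delta_cbfun k a : cbfun (delta_seq k a).
Proof.
pose N := (Num.truncn (`|a| + 1)).+1.
apply: (cc1_cbfun (N := N) (@continuous_delta k a)) => t /delta_supp /andP[h1 h2].
have hN : `|a| + 1 < N%:R by exact: truncnS_gt.
have k1 : k.+1%:R^-1 <= 1 :> R by rewrite invf_le1// (ler_nat _ 1).
have n1 := ler_norm a; have := ler_norm (- a); rewrite normrN => n2.
by move: (k.+1%:R^-1) k1 h1 => b k1 h1; rewrite ler_norml; apply/andP; split; lra.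
Qed.

Lemma int_delta k a : \int[lam]_t delta_seq k a t = 1.
Proof.
have k0 : 0 < k.+1%:R :> R by [].
pose b := a - k.+1%:R^-1.
have ba : b <= a by rewrite gerBl invr_ge0.
have hd (t : R) : is_derive t 1 (fun t => stepf (k.+1%:R * (t - a))) (delta_seq k a t).
  rewrite /delta_seq mulrC.
  apply: (@is_derive1_comp _ (@stepf R) (fun t => k.+1%:R * (t - a))); first exact: is_derive_stepf.
  rewrite -[X in is_derive _ _ _ X]mulr1; apply: is_deriveZ.
  by rewrite -[X in is_derive _ _ _ X]subr0; apply: is_deriveB.
have := C1_FTC hd (@continuous_delta k a) ba.
rewrite subrr mulr0 stepf_ge1// stepf_le0; last by rewrite /b addrAC subrr sub0r mulrN mulfV.
rewrite subr0 => <-; rewrite [RHS]Rintegral_mkcond; apply: eq_Rintegral => t _.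
rewrite patchE; case: ifPn => // /negP h; apply/eqP/negPn/negP => /delta_supp ab.
by apply: h; apply: mem_set; rewrite /= in_itv.
Qed.

Lemma delta_approx k a h l e : continuous h ->
  (forall t : R, a - k.+1%:R^-1 <= t <= a -> `|h t - l| <= e) ->
  `|\int[lam]_t (h t * delta_seq k a t) - l| <= e.
Proof.
move=> ch he; have cbd := delta_cbfun k a.
have id1 := cbfun_integrable cbd.
have ih u : slice_loc u -> lam.-integrable setT (EFin \o (fun t => u t * delta_seq k a t)).
  by move=> lu; exact: slice_loc_cbfun lu cbd.
have chl : continuous (fun t => h t - l).
  by move=> t; apply: continuousB; [exact: ch|exact: cst_continuous].
have -> : \int[lam]_t (h t * delta_seq k a t) - l = \int[lam]_t ((h t - l) * delta_seq k a t).
  have lE : l = \int[lam]_t (l * delta_seq k a t).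
    by rewrite (RintegralZl l measurableT id1) int_delta mulr1.
  rewrite [X in _ - X]lE; rewrite -(RintegralB measurableT (ih _ (slice_loc_continuous ch)) (ih _ (slice_loc_cst l))).
  by apply: eq_Rintegral => t _; rewrite /= mulrBl.
apply: le_trans (le_normr_Rintegral measurableT (ih _ (slice_loc_continuous chl))) _.
rewrite -[leRHS]mulr1 -(int_delta k a) -(RintegralZl e measurableT id1).
apply: le_Rintegral => //.
- by have := integrable_abse (ih _ (slice_loc_continuous chl)).
- exact: (integrableZl measurableT e id1).
move=> t _ /=; rewrite normrM (ger0_norm (delta_ge0 _ _ _)).
have [->|/delta_supp/he h'] := eqVneq (delta_seq k a t) 0; first by rewrite !mulr0.
by rewrite ler_wpM2r// delta_ge0.
Qed.

Lemma delta_cvg h a : continuous h ->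
  \int[lam]_t (h t * delta_seq k a t) @[k --> \oo] --> h a.
Proof.
move=> ch; apply/(@cvgrPdist_le _ R) => /= e e0.
have := ch a; rewrite /continuous_at => /(@cvgrPdist_le _ R _ (nbhs a)) /(_ _ e0) [d /= d0 hd].
near=> k; have kd : k.+1%:R^-1 < d by near: k; exact: (near_infty_natSinv_lt (PosNum d0)).
rewrite distrC; apply: delta_approx => // t /andP[t1 t2].
rewrite distrC; apply: hd => /=; rewrite ger0_norm ?subr_ge0//.
by move: kd t1 t2; move: (k.+1%:R^-1) => b; lra.
Unshelve. all: by end_near.
Qed.

End line.

Section vector_field.
Context {R : realType} {n m : nat}.
Implicit Types phi : 'rV[R]_n -> 'rV[R]_m.

Lemma partial_coord phi i j x : C1c phi ->
  partial i (fun y => phi y ord0 j) x = (partial i phi x) ord0 j.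
Proof. by move=> [h _ _]; rewrite /partial derive_mx// mxE. Qed.

Lemma C1c_coord phi j : C1c phi -> C1c (fun x => phi x ord0 j).
Proof.
move=> c1; have [h1 h2 h3] := c1; split.
- by move=> i x; exact: ((derivable_mxP _ _ _).1 (h1 i x)).
- move=> i; have -> : partial i (fun y => phi y ord0 j) = (fun x => (partial i phi x) ord0 j).
    by apply/funext => x; exact: partial_coord.
  move=> x; apply: (@continuous_comp _ _ _ (partial i phi) (fun v : 'rV[R]_m => v ord0 j)); first exact: h2.
  exact: coord_continuous.
- apply: tsupport_compact h3 _; first exact: norm_hausdorff.
  move=> x hx; apply: subset_closure => /=; apply: contraNN hx => /eqP ->.
  by rewrite mxE.
Qed.

Lemma C1c_scale (a : 'rV[R]_n -> R) (v : 'rV[R]_m) : C1c a -> C1c (fun x => a x *: v).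
Proof.
move=> ca; have [h1 h2 h3] := ca.
have hd i x : derivable (fun x => a x *: v) x (delta_mx ord0 i).
  apply/derivable_mxP => k l; have -> : (fun x => (a x *: v) k l) = (fun x => v k l *: a x).
    by apply/funext => y; rewrite mxE mulrC.
  by apply: derivableZ.
have dE i : partial i (fun x => a x *: v) = (fun x => partial i a x *: v).
  apply/funext => x; rewrite /partial derive_mx//; apply/matrixP => k l; rewrite !mxE.
  have -> : (fun x => (a x *: v) k l) = (fun x => v k l *: a x).
    by apply/funext => y; rewrite mxE mulrC.
  by rewrite deriveZ// mulrC.
split => //.
- move=> i; rewrite dE => x.
  by apply: (@cvgZr_tmp R _ _ (nbhs x) _ (partial i a) (partial i a x) v (h2 i x)).
- apply: tsupport_compact h3 _; first exact: norm_hausdorff.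
  move=> x hx; apply: subset_closure => /=; apply: contraNN hx => /eqP ->.
  by rewrite scale0r.
Qed.

End vector_field.

Section gauss_green.
Context {R : realType} {n : nat}.
Local Notation lam := (@lebesgue_measure R).
Local Notation mu := (@leb R n).
Local Notation nu := (@leb R n.+1).
Implicit Types (f g : 'rV[R]_n.+1 -> R) (w : 'rV[R]_n -> R) (y : 'rV[R]_n).

Lemma continuous_row_rcons y : continuous (fun t : R => row_rcons y t).
Proof.
move=> t U; rewrite -(@nbhs_ballE R) => -[e /= e0 tU].
rewrite nbhs_simpl /= -(@nbhs_ballE R); exists e => //= s ts; apply: tU.
apply/ball_rVP => // i; rewrite !mxE; case: unliftP => [j _|_]; first by rewrite subrr normr0.
exact: ts.
Qed.

(** A bound for |f| on the segment [-N, N] of the line through y: the mean over [0, 1] plus the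
    variation on [-N, N].  It is locally integrable in y. *)
Definition line_dom f g (N : nat) y : R :=
  slint (fun x => `|f x|) (\1_(`[0, 1]%classic) : R -> R) y +
  slint (fun x => `|g x|) (\1_(`[- N%:R, N%:R]%classic) : R -> R) y.

Lemma L1loc_line_dom f g N : L1loc f -> L1loc g -> L1loc (line_dom f g N).
Proof.
by move=> lf lg; apply: L1loc_add; apply: L1loc_slint; try exact: L1loc_norm; exact: itv_indic_cbfun.
Qed.

Lemma slint_indic u (a b : R) y : slint u (\1_(`[a, b]%classic) : R -> R) y =
  \int[lam]_(t in `[a, b]) u (row_rcons y t).
Proof.
rewrite /slint [RHS]Rintegral_mkcond; apply: eq_Rintegral => t _.
by rewrite patchE indicE; case: ifPn => _; rewrite ?mulr1 ?mulr0.
Qed.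

Lemma line_dom_bound f g (N : nat) y (t : R) : acl_line f g y -> (0 < N)%N ->
  t \in `[- N%:R, N%:R] -> `|f (row_rcons y t)| <= line_dom f g N y.
Proof.
move=> acl N0 tN; have [lg hfg] := acl.
have N1 : (1 : R) <= N%:R by rewrite (ler_nat _ 1).
have cf := acl_continuous acl.
set h := fun s => g (row_rcons y s).
rewrite /line_dom; set D2 := slint (fun x => `|g x|) _ _.
have D2E : D2 = prim (fun s => `|h s|) N%:R - prim (fun s => `|h s|) (- N%:R).
  by rewrite /D2 slint_indic primB//; [exact: slice_loc_norm|lra].
have key s t0 : - N%:R <= s -> s <= t0 -> t0 <= N%:R -> `|f (row_rcons y t0) - f (row_rcons y s)| <= D2.
  move=> h1 h2 h3; rewrite hfg (le_trans (prim_norm_diff lg h2))// D2E.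
  by apply: lerB; apply: prim_norm_mono.
have key2 s : s \in `[0, 1] -> `|f (row_rcons y t)| <= `|f (row_rcons y s)| + D2.
  rewrite in_itv/= => /andP[s0 s1]; move: tN; rewrite in_itv/= => /andP[t1 t2].
  rewrite -lerBlDl (le_trans (lerB_dist _ _))//.
  have [st|/ltW ts] := leP s t; first by apply: key => //; lra.
  by rewrite distrC; apply: key => //; lra.
rewrite slint_indic.
have i01 (a : R) : \int[lam]_(t in `[0, 1]) a = a.
  have l01 : lam `[0, 1]%classic = 1%:E by rewrite /= lebesgue_measure_itv/= lte01 sube0.
  have H := @Rintegral_cst _ _ _ lam `[0, 1]%classic (measurable_itv _) a.
  exact: (etrans H (etrans (congr1 (fun z => a * fine z) l01) (mulr1 a))).
rewrite -[leLHS]i01 -[X in _ <= _ + X]i01 -RintegralD//; last 2 first.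
- exact: slice_loc_itv (slice_loc_norm (slice_loc_continuous cf)).
- exact: slice_loc_itv (slice_loc_cst D2).
apply: le_Rintegral => //.
- exact: slice_loc_itv (slice_loc_cst _).
- have := integrableD _ (slice_loc_itv 0 1 (slice_loc_norm (slice_loc_continuous cf))) (slice_loc_itv 0 1 (slice_loc_cst D2)).
  by apply.
Qed.

Section test.
Variables (w : 'rV[R]_n -> R) (c : R).
Hypothesis cw : C1c w.

(** The conormal (-grad w, 1) of the graph of w. *)
Definition conormal y : 'rV[R]_n.+1 :=
  \row_i (if unlift ord_max i is Some j then - partial j w y else 1).

Definition epigraph : set 'rV[R]_n.+1 := [set x | c + w (row_init x) <= row_last x].

Definition height x : R := row_last x - (c + w (row_init x)).

(** C^1 functions that converge to the indicator of the epigraph, and whose gradient is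
    concentrated just below the graph. *)
Definition soft_epi (k : nat) x : R := stepf (k.+1%:R * height x).

Lemma is_derive_height i x :
  is_derive x (delta_mx ord0 i) height (conormal (row_init x) ord0 i).
Proof.
rewrite /height mxE; case: unliftP => [j|] ->.
  rewrite -[- _]add0r -[partial _ _ _]add0r; apply: is_deriveB.
    by apply: (@is_derive_last _ _ id).
  by apply: is_deriveD; apply: (is_derive_init (C1c_is_derive j (row_init x) cw)).
rewrite -[1]subr0 -[0]addr0; apply: is_deriveB; last first.
  by apply: is_deriveD; exact: is_derive_init_max.
by apply: (@is_derive_last_max _ _ id); exact: is_derive_id.
Qed.

Lemma continuous_height : continuous height.
Proof.
move=> x; apply: (@continuousB _ _ _ (@row_last R n) (fun x => c + w (row_init x))).
  exact: continuous_row_last.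
apply: (@continuousD _ _ _ (cst c) (fun x => w (row_init x))); first exact: cst_continuous.
apply: (@continuous_comp _ _ _ (@row_init R n) w); first exact: continuous_row_init.
exact: C1c_continuous.
Qed.

Lemma is_derive_soft_epi k i x : is_derive x (delta_mx ord0 i) (soft_epi k)
  (k.+1%:R * tent (k.+1%:R * height x) * conormal (row_init x) ord0 i).
Proof.
rewrite -mulrA mulrCA; apply: (@is_derive_comp_dir _ _ (fun x => k.+1%:R * height x) (@stepf R)).
  exact: (is_deriveZ _ (is_derive_height i x)).
exact: is_derive_stepf.
Qed.

Lemma continuous_soft_epi k : continuous (soft_epi k).
Proof.
move=> x; apply: (@continuous_comp _ _ _ (fun x => k.+1%:R * height x) (@stepf R)); last exact: continuous_stepf.
apply: (@continuousM _ _ (cst k.+1%:R) height); [exact: cst_continuous|exact: continuous_height].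
Qed.

Lemma continuous_conormal i : continuous (fun y => conormal y ord0 i).
Proof.
case E : (unlift ord_max i) => [j|].
  have -> : (fun y => conormal y ord0 i) = (fun y => - partial j w y).
    by apply/funext => y; rewrite mxE E.
  by move=> y; apply: continuousN; case: cw => _ h _; exact: h.
have -> : (fun y => conormal y ord0 i) = cst 1 by apply/funext => y; rewrite mxE E.
exact: cst_continuous.
Qed.

Lemma soft_epi_cvg x : soft_epi k x @[k --> \oo] --> (\1_epigraph x : R).
Proof.
apply: cvg_near_cst; rewrite indicE; have [/set_mem h|/negP h] := boolP (x \in epigraph).
  by apply: nearW => k; apply: stepf_ge1; rewrite mulr_ge0// subr_ge0.
have {}h : height x < 0.
  by rewrite subr_lt0 ltNge; apply/negP => h'; apply: h; apply: mem_set.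
have nh : 0 < - height x by rewrite oppr_gt0.
near=> k; apply: stepf_le0; rewrite -lerN2 opprK -mulrN.
have : k.+1%:R^-1 < - height x by near: k; exact: (near_infty_natSinv_lt (PosNum nh)).
by move=> h'; rewrite -ler_pdivrMl// mulr1; exact: ltW.
Unshelve. all: by end_near.
Qed.

Lemma measurable_epigraph : measurable epigraph.
Proof.
apply: closed_measurable_rV; rewrite (_ : epigraph = height @^-1` `[0, +oo[); last first.
  by apply/seteqP; split => x; rewrite /epigraph/= in_itv/= andbT /height subr_ge0.
apply: preimage_closed; last exact: interval_closed.
by move=> x _; exact: continuous_height.
Qed.

Lemma soft_epi_test k (a : 'rV[R]_n.+1 -> R) : C1c a ->
  C1c (fun x => soft_epi k x * a x) /\
  forall i x, partial i (fun x => soft_epi k x * a x) x =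
    soft_epi k x * partial i a x +
    a x * (delta_seq k (c + w (row_init x)) (row_last x) * conormal (row_init x) ord0 i).
Proof.
move=> ca; have [_ cp cs] := ca.
pose da i x := soft_epi k x * partial i a x +
    a x * (delta_seq k (c + w (row_init x)) (row_last x) * conormal (row_init x) ord0 i).
have hd i x : is_derive x (delta_mx ord0 i) (fun x => soft_epi k x * a x) (da i x).
  exact: (is_deriveM (is_derive_soft_epi k i x) (C1c_is_derive i x ca)).
split; last by move=> i x; rewrite /partial; apply: derive_val.
apply: (C1cI hd _ cs) => [i|x h]; last first.
  by apply: C1c_neq0; apply: contraNN h => /eqP ->; rewrite mulr0.
move=> x; apply: (@continuousD _ _ _ (fun x => soft_epi k x * partial i a x)).
  by apply: (@continuousM _ _ (soft_epi k)); [exact: continuous_soft_epi|exact: cp].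
apply: (@continuousM _ _ a); first exact: C1c_continuous.
apply: (@continuousM _ _ (fun x => delta_seq k (c + w (row_init x)) (row_last x))); last first.
  apply: (@continuous_comp _ _ _ (@row_init R n) (fun y => conormal y ord0 i)); first exact: continuous_row_init.
  exact: continuous_conormal.
apply: (@continuousM _ _ (cst k.+1%:R) (fun x => tent (k.+1%:R * height x))); first exact: cst_continuous.
apply: (@continuous_comp _ _ _ (fun x => k.+1%:R * height x) (@tent R)); last exact: continuous_tent.
apply: (@continuousM _ _ (cst k.+1%:R) height); [exact: cst_continuous|exact: continuous_height].
Qed.

Lemma soft_epi_abs k x : `|soft_epi k x| <= 1.
Proof. by rewrite ger0_norm ?stepf_ge0 ?stepf_le1. Qed.

(** The weak gradient of f tested with the components of soft_epi k * phi.  The derivative of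
    [soft_epi] produces the kernel [delta_seq] times the conormal. *)
Lemma gauss_green_soft k f (G phi : 'rV[R]_n.+1 -> 'rV[R]_n.+1) :
  L1loc f -> is_weak_gradient f G -> C1c phi ->
  [/\ nu.-integrable setT (EFin \o (fun x => div phi x * f x + edot (phi x) (G x))),
      nu.-integrable setT (EFin \o (fun x => f x *
        (edot (phi x) (conormal (row_init x)) * delta_seq k (c + w (row_init x)) (row_last x)))) &
  \int[nu]_x (soft_epi k x * (div phi x * f x + edot (phi x) (G x))) =
  - \int[nu]_x (f x * (edot (phi x) (conormal (row_init x)) *
      delta_seq k (c + w (row_init x)) (row_last x)))].
Proof.
move=> lf [lG hG] cphi.
pose p i x := phi x ord0 i; have cp i : C1c (p i) := C1c_coord i cphi.
pose D i x := f x * partial i (p i) x + G x ord0 i * p i x.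
have DE x : div phi x * f x + edot (phi x) (G x) = \sum_(i < n.+1) D i x.
  rewrite /D big_split/= /div mulr_suml /edot.
  by congr (_ + _); apply: eq_bigr => i _; rewrite mulrC.
pose V i x := f x * (p i x * (delta_seq k (c + w (row_init x)) (row_last x) * conormal (row_init x) ord0 i)).
have VE x : f x * (edot (phi x) (conormal (row_init x)) *
    delta_seq k (c + w (row_init x)) (row_last x)) = \sum_(i < n.+1) V i x.
  rewrite /V -mulr_sumr /edot mulr_suml; congr (_ * _).
  by apply: eq_bigr => i _; rewrite /p; ring.
have ifd i : nu.-integrable setT (EFin \o (fun x => f x * partial i (p i) x)).
  exact: L1loc_integrable_partial.
have iGp i : nu.-integrable setT (EFin \o (fun x => G x ord0 i * p i x)).
  exact: L1loc_integrable_C1c (lG i) (cp i).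
have iD i : nu.-integrable setT (EFin \o D i).
  by have := integrableD measurableT (ifd i) (iGp i).
have ms : measurable_fun setT (soft_epi k).
  by apply: continuous_measurable_rV; exact: continuous_soft_epi.
have isoft u : nu.-integrable setT (EFin \o u) -> nu.-integrable setT (EFin \o (fun x => soft_epi k x * u x)).
  move=> iu; apply: (integrable_dom _ _ _ iu) => //.
    have mu_ := (measurable_EFinP _ _).1 (measurable_int _ iu).
    exact: measurable_funM.
  by move=> x; rewrite normrM ler_piMl// soft_epi_abs.
have it i : nu.-integrable setT (EFin \o (fun x => f x * partial i (fun x => soft_epi k x * p i x) x)).
  by apply: L1loc_integrable_partial => //; case: (soft_epi_test k (cp i)).
have dE i x := (soft_epi_test k (cp i)).2 i x.
have iV i : nu.-integrable setT (EFin \o V i).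
  have := integrableB measurableT (it i) (isoft _ (ifd i)).
  apply: eq_integrable => // x _; rewrite /= -EFinB dE /V; congr EFin; ring.
(* the product rule for soft_epi k * phi_i splits the weak formulation into these two terms *)
have key i : \int[nu]_x (soft_epi k x * D i x) = - \int[nu]_x V i x.
  have := hG i _ (soft_epi_test k (cp i)).1.
  move=> /(congr1 fine); rewrite fineN => H.
  have E1 : \int[nu]_x (f x * partial i (fun x => soft_epi k x * p i x) x) =
      \int[nu]_x (soft_epi k x * (f x * partial i (p i) x)) + \int[nu]_x V i x.
    rewrite -RintegralD//; last exact: isoft.
    by apply: eq_Rintegral => x _; rewrite dE /V; ring.
  have E2 : \int[nu]_x (soft_epi k x * D i x) =
      \int[nu]_x (soft_epi k x * (f x * partial i (p i) x)) +
      \int[nu]_x (G x ord0 i * (soft_epi k x * p i x)).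
    rewrite -RintegralD//; last 2 first.
    - exact: isoft.
    - by apply: eq_integrable (isoft _ (iGp i)) => // x _ /=; congr EFin; ring.
    by apply: eq_Rintegral => x _; rewrite /D; ring.
  rewrite E2; move: H E1; rewrite /Rintegral => -> E1.
  by rewrite -[X in _ + X]opprK E1 opprD addrA subrr sub0r.
have isum (u : 'I_n.+1 -> 'rV[R]_n.+1 -> R) : (forall i, nu.-integrable setT (EFin \o u i)) ->
    nu.-integrable setT (EFin \o (fun x => \sum_i u i x)) /\
    \int[nu]_x (\sum_i u i x) = \sum_i \int[nu]_x u i x.
  move=> iu; have H : (fun x => (\sum_i u i x)%:E) = (fun x => \sum_i (u i x)%:E)%E.
    by apply/funext => x; rewrite sumEFin.
  split.
    have H2 : nu.-integrable setT (fun x => \sum_i (u i x)%:E)%E.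
      by apply: integrable_sum => // i _; exact: iu.
    by apply: eq_integrable H2 => // x _; rewrite /= sumEFin.
  rewrite /Rintegral H integral_sum//.
  rewrite -[RHS]/(fine (\sum_i fine (\int[nu]_x (u i x)%:E))%:E); congr fine.
  by rewrite -sumEFin; apply: eq_bigr => i _; rewrite fineK//; apply: integrable_fin_num => //; exact: iu.
have [iDs _] := isum _ iD; have [iVs sV] := isum _ iV.
have [_ sD] := isum (fun i x => soft_epi k x * D i x) (fun i => isoft _ (iD i)).
split.
- by apply: eq_integrable iDs => // x _; rewrite /= DE.
- by apply: eq_integrable iVs => // x _; rewrite /= VE.
transitivity (\int[nu]_x (\sum_i soft_epi k x * D i x)).
  by apply: eq_Rintegral => x _; rewrite DE mulr_sumr.
rewrite sD; under eq_bigr => i _ do rewrite key.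
by rewrite sumrN -sV; congr (- _); apply: eq_Rintegral => x _; rewrite VE.
Qed.

Lemma continuous_normal_part (phi : 'rV[R]_n.+1 -> 'rV[R]_n.+1) : C1c phi ->
  continuous (fun x => edot (phi x) (conormal (row_init x))).
Proof.
move=> cphi x; rewrite /edot.
apply: (@cvg_big _ _ +%R 0 predT (@add_continuous R) _ (nbhs x)) => i _; apply: (@continuousM _ _ (fun x => phi x ord0 i)).
  exact: (C1c_continuous (C1c_coord i cphi)).
apply: (@continuous_comp _ _ _ (@row_init R n) (fun y => conormal y ord0 i)); first exact: continuous_row_init.
exact: continuous_conormal.
Qed.

Definition graph_pt y : 'rV[R]_n.+1 := row_rcons y (c + w y).

Lemma measurable_graph_pt : measurable_fun setT graph_pt.
Proof.
apply: (measurableT_comp (f := rc) (g := fun y => (y, c + w y : measurableTypeR R))).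
  exact: measurable_rc.
apply/measurable_fun_pairP; split => /=; first exact: measurable_id.
by apply: measurable_funD => //; exact: continuous_measurable_rV (C1c_continuous cw).
Qed.

(** The limit of [gauss_green_soft]: f is continuous along each line, so the kernel picks its value
    at the height c + w y, and [line_dom] dominates. *)
Theorem gauss_green_epigraph f g (G phi : 'rV[R]_n.+1 -> 'rV[R]_n.+1) :
  L1loc f -> L1loc g -> (forall y, acl_line f g y) -> is_weak_gradient f G -> C1c phi ->
  let u y := f (graph_pt y) * edot (phi (graph_pt y)) (conormal y) in
  mu.-integrable setT (EFin \o u) /\
  (\int[nu]_x (\1_epigraph x * (div phi x * f x + edot (phi x) (G x)))%:E =
   - \int[mu]_y (u y)%:E)%E.
Proof.
move=> lf lg acl hG cphi u.
pose D x := div phi x * f x + edot (phi x) (G x).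
pose M x := edot (phi x) (conormal (row_init x)).
have cM : continuous M := continuous_normal_part cphi.
have [_ _ cs] := cphi.
have Ms x : M x != 0 -> tsupport phi x.
  move=> h; apply: subset_closure; apply: contraNN h => /eqP h.
  by rewrite /M /edot h; apply/eqP; apply: big1 => i _; rewrite mxE mul0r.
have [B hB] := cc_bounded cM cs Ms.
have [N1 hN1] := compact_sub_cbox cs.
have [W hW] : exists W : R, forall y, `|w y| <= W.
  by have [_ _ cws] := cw; exact: cc_bounded (C1c_continuous cw) cws (@C1c_neq0 _ _ w).
pose N := (Num.truncn (`|c| + W + 1)).+1.
have hN : `|c| + W + 1 < N%:R by exact: truncnS_gt.
pose h y t := f (row_rcons y t) * M (row_rcons y t).
have ch y : continuous (h y).
  move=> t; apply: (@continuousM _ _ (fun t => f (row_rcons y t))); first exact: acl_continuous.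
  apply: (@continuous_comp _ _ _ (fun t => row_rcons y t) M); last exact: cM.
  exact: continuous_row_rcons.
pose J k y := \int[lam]_t (h y t * delta_seq k (c + w y) t).
have mh : measurable_fun setT (fun p : 'rV[R]_n * measurableTypeR R => h p.1 p.2).
  have mfM : measurable_fun setT (fun x => f x * M x).
    by apply: measurable_funM; [exact: lf.1|exact: continuous_measurable_rV].
  exact: measurable_comp_rc mfM.
have B0 : 0 <= B by apply: le_trans (hB 0).
have hbound y t : `|t| <= N%:R -> `|h y t| <= B * (line_dom f g N y * \1_(cbox N1%:R) y).
  move=> tN; rewrite /h; have [->|/Ms/hN1] := eqVneq (M (row_rcons y t)) 0.
    rewrite mulr0 normr0 !mulr_ge0// ?indicE//.
    by apply: le_trans (line_dom_bound (acl y) _ (t := 0) _) => //; rewrite in_itv/= oppr_le0 ler0n.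
  rewrite -[row_rcons y t]/(row_rcons y t) => /row_rcons_cbox[yN _].
  rewrite indicE mem_set// mulr1 normrM mulrC ler_pM//.
  by apply: line_dom_bound => //; rewrite in_itv/= -ler_norml.
have iB : mu.-integrable setT (EFin \o (fun y => B * (line_dom f g N y * \1_(cbox N1%:R) y))).
  have ca : cbfunV (\1_(cbox N1%:R) : 'rV[R]_n -> R).
    split; first by apply: measurable_indic; exact: measurable_cbox.
    exists 1%N, N1; split => y; rewrite indicE; first by case: (_ \in _); rewrite ?normr1 ?normr0.
    by case: (boolP (y \in _)) => [/set_mem|_] //; rewrite eqxx.
  have := integrableZl measurableT B (L1loc_cbfunV (L1loc_line_dom N lf lg) ca).
  by apply: eq_integrable.
have wN y t : c + w y - 1 <= t <= c + w y -> `|t| <= N%:R.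
  move=> /andP[t1 t2]; have := hW y; rewrite ler_norml => /andP[w1 w2].
  have c1 := ler_norm c; have c2 := ler_norm (- c); rewrite normrN in c2.
  by rewrite ler_norml; apply/andP; split; lra.
have JB k y : `|J k y| <= B * (line_dom f g N y * \1_(cbox N1%:R) y).
  rewrite -[J k y]subr0; apply: delta_approx; first exact: ch.
  move=> t /andP[t1 t2]; rewrite subr0; apply: hbound; apply: (wN y); rewrite t2 andbT.
  by apply: le_trans t1; rewrite lerD2l lerN2 invf_le1// (ler_nat _ 1).
have mJ k : measurable_fun setT (J k).
  have mq : measurable_fun setT (fun p : 'rV[R]_n * measurableTypeR R => h p.1 p.2 * delta_seq k (c + w p.1) p.2).
    apply: measurable_funM => //; apply: measurable_funM => //.
    apply: measurableT_comp; first by apply: continuous_measurable_fun; exact: continuous_tent.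
    apply: measurable_funM => //; apply: measurable_funB; first exact: measurable_snd.
    apply: measurable_funD => //.
    exact: (measurableT_comp (continuous_measurable_rV (C1c_continuous cw)) measurable_fst).
  exact: (measurable_Rint_param lam mq).
have mlim : measurable_fun setT u.
  apply: measurable_funM; first exact: (measurableT_comp lf.1 measurable_graph_pt).
  rewrite (_ : (fun y => edot _ _) = M \o graph_pt).
    by apply: measurableT_comp measurable_graph_pt; exact: continuous_measurable_rV.
  by apply/funext => y; rewrite /M /= row_init_rcons.
have [||iu Ju] := @dct_real _ _ _ mu J u _ mJ mlim _ iB _.
- apply: aeW => y; have := @delta_cvg _ (h y) (c + w y) (ch y).
  by rewrite /h /M row_init_rcons.
- by apply: aeW => y k; exact: JB.
split; first exact: iu.
have iD : nu.-integrable setT (EFin \o D) by case: (gauss_green_soft 0 lf hG cphi).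
have mD := (measurable_EFinP _ _).1 (measurable_int _ iD).
have [|||||_ DD] := @dct_real _ _ _ nu (fun k x => soft_epi k x * D x)
  (fun x => \1_epigraph x * D x) (fun x => `|D x|) _ _ _ _ _.
- by move=> k; apply: measurable_funM => //; apply: continuous_measurable_rV; exact: continuous_soft_epi.
- by apply: measurable_funM => //; apply: measurable_indic; exact: measurable_epigraph.
- by apply: aeW => x; apply: cvgMl; exact: soft_epi_cvg.
- by have := integrable_abse iD.
- by apply: aeW => x k; rewrite normrM ler_piMl// soft_epi_abs.
have EJ k : (\int[nu]_x (soft_epi k x * D x)%:E = - \int[mu]_y (J k y)%:E)%E.
  have [_ iV E] := gauss_green_soft k lf hG cphi.
  have iS : nu.-integrable setT (EFin \o (fun x => soft_epi k x * D x)).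
    apply: (integrable_dom _ _ _ iD) => //.
      by apply: measurable_funM => //; apply: continuous_measurable_rV; exact: continuous_soft_epi.
    by move=> x; rewrite normrM ler_piMl// soft_epi_abs.
  rewrite -[LHS]fineK; last exact: integrable_fin_num.
  rewrite -[fine _]/(\int[nu]_x (soft_epi k x * D x)) E EFinN fineK; last exact: integrable_fin_num.
  congr (- _)%E; rewrite leb_fubini1//; apply: eq_integral => y _.
  rewrite /J /Rintegral fineK; last first.
    apply: integrable_fin_num => //.
    exact: slice_loc_cbfun (slice_loc_continuous (ch y)) (delta_cbfun k (c + w y)).
  by apply: eq_integral => t _; rewrite /= /h /M row_init_rcons row_last_rcons mulrA.
move: DD; under eq_fun do rewrite EJ.
move=> DD; have := cvgeN Ju => Ju'.
exact: (cvg_unique (@ereal_hausdorff R) DD (Ju' _)).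
Qed.

End test.

End gauss_green.

(** * The variational inequality *)

Section variational.
Context {R : realType} {n : nat}.
Local Notation lam := (@lebesgue_measure R).
Local Notation mu := (@leb R n).
Local Notation nu := (@leb R n.+1).

(** The bound |v| <= (1 + |v|^2) / 2 in place of the Cauchy-Schwarz inequality: for the conormal v
    of a graph it is exact to second order in the gradient, and it avoids square roots. *)
Lemma edot_le_half (u v : 'rV[R]_n.+1) : enorm u <= 1 -> - edot u v <= (1 + edot v v) / 2.
Proof.
move=> u1; have uu1 : edot u u <= 1.
  rewrite -[X in X <= _]sqr_sqrtr ?edot_ge0// -[leRHS](expr1n _ 2).
  by rewrite lerXn2r// nnegrE// sqrtr_ge0.
apply: (@le_trans _ _ ((edot u u + edot v v) / 2)); last by rewrite ler_wpM2r// lerD2r.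
rewrite /edot -big_split/= mulr_suml -sumrN; apply: ler_sum => i _.
have := sqr_ge0 (u ord0 i + v ord0 i); rewrite expr2; lra.
Qed.

(** A nonnegative density f together with its derivative g in the last direction, absolutely
    continuous on every line and not only on almost every one. *)
Definition regular_pair (f g : 'rV[R]_n.+1 -> R) :=
  [/\ forall x, 0 <= f x, nu.-integrable setT (EFin \o f), L1loc g & forall y, acl_line f g y].

(** An upper bound for the density of the perimeter of the epigraph: (1 + |v|^2) / 2 bounds the area
    factor |v| from above, for v the conormal. *)
Definition graph_energy (f : 'rV[R]_n.+1 -> R) w c y : R :=
  (1 + edot (conormal w y) (conormal w y)) / 2 * f (graph_pt w c y).

(** The form in which minimality is used: only epigraphs of the same mass compete. *)
Definition halfspace_minimal (f : 'rV[R]_n.+1 -> R) := forall (w : 'rV[R]_n -> R) (c : R), C1c w ->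
  (\int[nu]_(x in epigraph w c) (f x)%:E = \int[nu]_(x in halfspace c) (f x)%:E)%E ->
  (\int[mu]_y (f (row_rcons y c))%:E <= \int[mu]_y (graph_energy f w c y)%:E)%E.

Lemma integrable_L1loc m (u : 'rV[R]_m -> R) : (leb m).-integrable setT (EFin \o u) -> L1loc u.
Proof.
move=> iu; split; first exact: (measurable_EFinP _ _).1 (measurable_int _ iu).
by move=> K cK; apply: integrableS iu => //; exact: compact_measurable_rV.
Qed.

Lemma measurable_conormal (w : 'rV[R]_n -> R) i : C1c w -> measurable_fun setT (fun y => conormal w y ord0 i).
Proof. by move=> cw; apply: continuous_measurable_rV; exact: continuous_conormal. Qed.

Lemma graph_energy_ge0 f w c y : (forall x, 0 <= f x) -> 0 <= graph_energy f w c y.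
Proof.
move=> f0; rewrite mulr_ge0// divr_ge0// addr_ge0// edot_ge0//.
Qed.

Lemma measurable_graph_energy f w c : measurable_fun setT f -> C1c w -> measurable_fun setT (graph_energy f w c).
Proof.
move=> mf cw; apply: measurable_funM; last exact: (measurableT_comp mf (measurable_graph_pt c cw)).
apply: measurable_funM => //; apply: measurable_funD => //; rewrite /edot.
by apply: measurable_sum => i; apply: measurable_funM; exact: measurable_conormal.
Qed.

Lemma Per_epigraph_le f g G w c : regular_pair f g -> is_weak_gradient f G -> C1c w ->
  forall phi, C1c phi -> (forall x, enorm (phi x) <= 1) ->
  (\int[nu]_x (\1_(epigraph w c) x * (div phi x * f x + edot (phi x) (G x)))%:E
    <= \int[mu]_y (graph_energy f w c y)%:E)%E.
Proof.
move=> [f0 fi lg acl] hG cw phi cphi phi1; have lf := integrable_L1loc fi.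
have [iu ->] := gauss_green_epigraph c cw lf lg acl hG cphi.
set u := fun y => _ in iu *.
have mE := measurable_graph_energy c lf.1 cw.
have [|] := leP +oo%E (\int[mu]_y (graph_energy f w c y)%:E)%E.
  by rewrite leye_eq => /eqP ->; rewrite leey.
move=> Eoo; have iE : mu.-integrable setT (EFin \o graph_energy f w c).
  apply/integrableP; split; first exact/measurable_EFinP.
  under eq_integral => y _ do rewrite gee0_abs ?lee_fin ?graph_energy_ge0//.
  exact: Eoo.
rewrite -integralN; last first.
  by apply: fin_num_adde_defl; rewrite fin_numN; apply: integrable_neg_fin_num.
apply: le_integral => //; first by have := integrableN iu; apply.
move=> y _; rewrite -EFinN lee_fin /graph_energy /u -mulrN mulrC ler_wpM2r//.
exact: edot_le_half.
Qed.

Lemma C1c_cst0 m : C1c (cst 0 : 'rV[R]_m -> R).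
Proof.
apply: (C1cI (dphi := fun _ => cst 0) (K := set0)) => //.
- by move=> i; exact: cst_continuous.
- exact: compact0.
- by move=> x; rewrite eqxx.
Qed.

Lemma conormal0 y : conormal (cst 0) y = delta_mx ord0 ord_max :> 'rV[R]_n.+1.
Proof.
apply/rowP => i; rewrite !mxE; case: unliftP => [j|] ->.
  by rewrite /partial derive_cst oppr0 [lift _ _ == _]eq_sym (negbTE (neq_lift _ _)).
by rewrite !eqxx.
Qed.

Lemma epigraph0 (c : R) : epigraph (cst 0) c = halfspace c :> set 'rV[R]_n.+1.
Proof. by apply/seteqP; split => x; rewrite /epigraph/= addr0. Qed.

(** Test with downward fields, cut off to be compactly supported, and apply Fatou's lemma. *)
Lemma Per_halfspace_ge f g G c P : regular_pair f g -> is_weak_gradient f G ->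
  (forall phi, C1c phi -> (forall x, enorm (phi x) <= 1) ->
    (\int[nu]_x (\1_(halfspace c) x * (div phi x * f x + edot (phi x) (G x)))%:E <= P)%E) ->
  (\int[mu]_y (f (row_rcons y c))%:E <= P)%E.
Proof.
move=> [f0 fi lg acl] hG hP; have lf := integrable_L1loc fi.
have mfc : measurable_fun setT (fun y => f (row_rcons y c)) by exact: measurable_slice_last lf.1.
pose chi (k : nat) : 'rV[R]_n -> R := cutoff 1 k%:R 0.
have cchi k : C1c (chi k) by exact: cutoff_C1c.
have hk k : (\int[mu]_y (f (row_rcons y c) * chi k y)%:E <= P)%E.
  (* the second factor is 1 at the height c *)
  pose a := tensor (chi k) (lbump 1 c 0).
  have ca : C1c a by apply: tensor_C1c => //; exact: lbump_C1c1.
  pose phi x := a x *: (- delta_mx ord0 ord_max) : 'rV[R]_n.+1.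
  have cphi : C1c phi := C1c_scale _ ca.
  have a0 x : 0 <= a x by rewrite mulr_ge0// ?cutoff_ge0// stepf_ge0.
  have a1 x : a x <= 1 by rewrite mulr_ile1// ?cutoff_ge0 ?cutoff_le1 ?stepf_ge0 ?stepf_le1.
  have phi1 x : enorm (phi x) <= 1.
    apply: le_trans (enorm_le_sum _) _; rewrite (bigD1 ord_max)//= big1; last first.
      by move=> i /negbTE ni; rewrite !mxE ni oppr0 mulr0 normr0.
    by rewrite addr0 !mxE !eqxx mulrN mulr1 normrN ger0_norm.
  have := hP phi cphi phi1; rewrite -epigraph0.
  have [iu ->] := gauss_green_epigraph c (C1c_cst0 n) lf lg acl hG cphi.
  apply: le_trans; rewrite -integralN; last first.
    by apply: fin_num_adde_defl; rewrite fin_numN; apply: integrable_neg_fin_num.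
  rewrite le_eqVlt; apply/orP; left; apply/eqP/eq_integral => y _.
  rewrite -EFinN conormal0 /graph_pt /= addr0; congr EFin.
  rewrite /edot (bigD1 ord_max)//= big1; last by move=> i /negbTE ni; rewrite !mxE ni andbF mulr0.
  rewrite addr0 !mxE !eqxx mulrN !mulr1 mulrN opprK /a /tensor row_init_rcons row_last_rcons.
  congr (_ * _); rewrite /lbump subrr expr0n/= subr0 expr1n mulr1 stepf_ge1 ?mulr1//.
have mk k : measurable_fun setT (fun y => (f (row_rcons y c) * chi k y)%:E).
  apply/measurable_EFinP; apply: measurable_funM => //.
  by apply: continuous_measurable_rV; exact: C1c_continuous.
have fk0 k y : [set: 'rV[R]_n] y -> (0 <= (f (row_rcons y c) * chi k y)%:E)%E.
  by move=> _; rewrite lee_fin mulr_ge0// cutoff_ge0.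
have := fatou mu measurableT mk fk0.
under eq_integral => y _.
  rewrite (_ : limn_einf _ = (f (row_rcons y c))%:E); last first.
    have cv : (f (row_rcons y c) * chi k y)%:E @[k --> \oo] --> (f (row_rcons y c))%:E.
      apply: cvg_near_cst; near=> k; rewrite /chi cutoff_eq1 ?mulr1//.
      by near: k; exact: nbhs_infty_ger.
    by rewrite is_cvg_limn_einfE; [exact: cvg_lim cv|apply/cvg_ex; eexists; exact: cv].
  over.
move=> /le_trans; apply; rewrite limn_einf_lim; apply: lime_le; first exact: is_cvg_einfs.
apply: nearW => k; apply: le_trans (hk k).
by apply: ereal_inf_lbound; exists k => /=.
Unshelve. all: by end_near.
Qed.

(** Setting f to 0 on the exceptional lines of [ae_acl_line] changes it on a null set only, which
    affects neither the weak gradient nor the integrals. *)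
Lemma weight_regular f : weight f -> exists f0 g0,
  [/\ regular_pair f0 g0, is_weak_gradient f0 (grad f),
      {ae nu, forall x, f0 x = f x} &
      {ae mu, forall y, forall t, f0 (row_rcons y t) = f (row_rcons y t)}].
Proof.
move=> [f0 fi [lf exg] fp]; have hG : is_weak_gradient f (grad f) := xgetPex _ exg.
have [lG hGt] := hG.
pose g x := grad f x ord0 ord_max.
have vd : vertical_derivative f g.
  split; [exact: lf|exact: lG|move=> a th ca cth]; have := hGt ord_max _ (tensor_C1c ca cth).
  under eq_integral => x _ do rewrite partial_tensor_max//.
  by [].
have [N [mN N0 hN]] := ae_acl_line vd fp.
pose good (x : 'rV[R]_n.+1) : R := \1_(~` N) (row_init x).
have goodE y t : ~ N y -> good (row_rcons y t) = 1.
  by move=> h; rewrite /good row_init_rcons indicE mem_set.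
have good0 y t : N y -> good (row_rcons y t) = 0.
  by move=> h; rewrite /good row_init_rcons indicE memNset//; apply.
have mgood : measurable_fun setT good.
  apply: (measurableT_comp (f := \1_(~` N) : 'rV[R]_n -> R)); last exact: measurable_row_init.
  by apply: measurable_indic; exact: measurableC.
have goodle x : `|good x| <= 1 by rewrite /good indicE; case: (_ \in _); rewrite ?normr1 ?normr0.
have ae0 (u : 'rV[R]_n.+1 -> R) : {ae nu, forall x, u x * good x = u x}.
  have N0' : mu.-negligible N by exists N; split.
  apply: (negligibleS _ (leb_negligible_cylinder N0')) => x /= h; apply: contrapT => h'.
  by apply: h; rewrite -[x]row_rconsK goodE// mulr1.
have lgood u : L1loc u -> L1loc (fun x => u x * good x).
  move=> [mu_ iu]; split; first exact: measurable_funM.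
  move=> K cK; apply: (integrable_dom _ _ _ (iu K cK)); first exact: compact_measurable_rV.
    exact: measurable_funM.
  by move=> x; rewrite normrM ler_piMr.
exists (fun x => f x * good x), (fun x => g x * good x); split.
- split.
  + by move=> x; rewrite mulr_ge0// /good indicE.
  + apply: (integrable_dom _ _ _ fi) => //; first by apply: measurable_funM => //; exact: lf.1.
    by move=> x; rewrite normrM ler_piMr.
  + exact: lgood (lG ord_max).
  + move=> y; have [yN|yN] := pselect (N y).
      rewrite /acl_line; have -> : (fun s => g (row_rcons y s) * good (row_rcons y s)) = cst 0.
        by apply/funext => s; rewrite good0// mulr0.
      split; first exact: slice_loc_cst.
      have p0 t : prim (cst 0 : R -> R) t = 0.
        by rewrite /prim /Rintegral integral0_eq// => s _; rewrite mul0r.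
      by move=> s t; rewrite !good0// !mulr0 !p0.
    have [sl hd] : acl_line f g y by apply: contrapT => h; apply: yN; exact: hN.
    rewrite /acl_line; have -> : (fun s => g (row_rcons y s) * good (row_rcons y s)) = (fun s => g (row_rcons y s)).
      by apply/funext => s; rewrite goodE// mulr1.
    by split => // s t; rewrite !goodE// !mulr1.
- split; first exact: lG.
  move=> i phi cphi; rewrite -hGt//; apply: ae_eq_integral => //.
  + apply/measurable_EFinP; apply: measurable_funM; first exact: (lgood f lf).1.
    by apply: continuous_measurable_rV; case: cphi.
  + apply/measurable_EFinP; apply: measurable_funM; first exact: lf.1.
    by apply: continuous_measurable_rV; case: cphi.
  + by apply: filterS (ae0 f) => x hx _; rewrite hx.
- exact: ae0.
- exists N; split => // y /= h; apply: contrapT => yN; apply: h => t.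
  by rewrite goodE// mulr1.
Qed.

Lemma weight_halfspace_minimal f f0 g0 :
  (forall c : R, Per_minimal f (halfspace c)
     [set F | lebesgue_measurable F /\ wmeasure f F = wmeasure f (halfspace c)]) ->
  measurable_fun setT f ->
  regular_pair f0 g0 -> is_weak_gradient f0 (grad f) ->
  {ae nu, forall x, f0 x = f x} -> (forall i, measurable_fun setT (fun x => grad f x ord0 i)) ->
  halfspace_minimal f0.
Proof.
move=> hmin mf reg hG f0f mG w c cw hvol.
have [_ fi _ _] := reg; have mf0 := (integrable_L1loc fi).1.
have mE := measurable_epigraph c cw.
have mH : measurable (halfspace c : set 'rV[R]_n.+1).
  by rewrite -epigraph0; apply: measurable_epigraph; exact: C1c_cst0.
have wE (E : set 'rV[R]_n.+1) : measurable E -> wmeasure f E = (\int[nu]_(x in E) (f0 x)%:E)%E.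
  move=> mE'; apply: ae_eq_integral => //.
  - by apply/measurable_EFinP; exact: measurable_funTS.
  - by apply/measurable_EFinP; exact: measurable_funTS.
  - by apply: filterS f0f => x hx _; rewrite hx.
have PE (E : set 'rV[R]_n.+1) (phi : 'rV[R]_n.+1 -> 'rV[R]_n.+1) : measurable E -> C1c phi ->
    (\int[nu]_x (\1_E x * (div phi x * f x + edot (phi x) (grad f x)))%:E =
     \int[nu]_x (\1_E x * (div phi x * f0 x + edot (phi x) (grad f x)))%:E)%E.
  move=> mE' cphi.
  have mm u : measurable_fun setT u ->
    measurable_fun setT (fun x => \1_E x * (div phi x * u x + edot (phi x) (grad f x))).
    move=> mu_; apply: measurable_funM; first exact: measurable_indic.
    apply: measurable_funD.
      apply: measurable_funM => //; apply: measurable_sum => i.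
      by apply: continuous_measurable_rV; have [_ h _] := C1c_coord i cphi; exact: h.
    apply: measurable_sum => i; apply: measurable_funM => //.
    by apply: continuous_measurable_rV; exact: C1c_continuous (C1c_coord i cphi).
  apply: ae_eq_integral => //; try by apply/measurable_EFinP; exact: mm.
  by apply: filterS f0f => x hx _; rewrite hx.
apply: (Per_halfspace_ge reg hG) => phi cphi phi1.
rewrite -PE//; apply: (@le_trans _ _ (Per f (halfspace c))).
  by apply: ereal_sup_ubound; exists phi.
apply: (@le_trans _ _ (Per f (epigraph w c))).
  apply: hmin; split; last by rewrite !wE.
  by exists (epigraph w c) => //; rewrite setYK; exact: negligible_set0.
apply: ge_ereal_sup => _ [psi [cpsi psi1] <-]; rewrite PE//.
exact: Per_epigraph_le reg hG cw _ cpsi psi1.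
Qed.

End variational.

(** * The variational inequality integrated over heights *)

Section primitive.
Context {R : realType}.
Local Notation lam := (@lebesgue_measure R).
Implicit Types h : R -> R.

Lemma int_cst_itv (a b z : R) : a <= b -> \int[lam]_(t in `[a, b]) z = (b - a) * z.
Proof.
move=> ab; have lab : lam `[a, b]%classic = (b - a)%:E.
  rewrite /= lebesgue_measure_itv/= lte_fin; case: ifPn => //; rewrite -leNgt => ba.
  by rewrite (le_anti (introT andP (conj ab ba))) subrr.
have H := @Rintegral_cst _ _ _ lam `[a, b]%classic (measurable_itv _) z.
exact: (etrans H (etrans (congr1 (fun u => z * fine u) lab) (mulrC _ _))).
Qed.

Lemma prim_taylor h (c v l e : R) : continuous h ->
  (forall t, `|t - c| <= `|v| -> `|h t - l| <= e) ->
  `|prim h (c + v) - prim h c - v * l| <= `|v| * e.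
Proof.
move=> ch; have lh := slice_loc_continuous ch.
have key (a b : R) : a <= b -> (forall t, a <= t <= b -> `|h t - l| <= e) ->
    `|prim h b - prim h a - (b - a) * l| <= (b - a) * e.
  move=> ab hh; rewrite primB//.
  have ic (z : R) := int_cst_itv z ab.
  have icst z := slice_loc_itv a b (slice_loc_cst z).
  rewrite -(ic l) -(RintegralB _ (slice_loc_itv a b lh) (icst l)); last exact: measurable_itv.
  have lhl : slice_loc (fun t => h t - l).
    apply: slice_loc_continuous => t.
    by apply: continuousB; [exact: ch|exact: cst_continuous].
  apply: (le_trans (le_normr_Rintegral _ (slice_loc_itv a b lhl))); first exact: measurable_itv.
  rewrite -ic; apply: le_Rintegral => //.
  - exact: slice_loc_itv (slice_loc_norm lhl).
  - exact: icst.
have [v0|/ltW v0] := leP 0 v => hh.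
  have := key c (c + v); rewrite (_ : c + v - c = v); last by ring.
  rewrite (ger0_norm v0); apply.
    by rewrite lerDl.
  by move=> t /andP[t1 t2]; apply: hh; rewrite !ger0_norm ?subr_ge0//; lra.
have := key (c + v) c; rewrite (_ : c - (c + v) = - v); last by ring.
rewrite (ler0_norm v0).
rewrite (_ : prim h c - prim h (c + v) - - v * l = - (prim h (c + v) - prim h c - v * l)); last by ring.
rewrite normrN.
apply; first by rewrite gerDl.
by move=> t /andP[t1 t2]; apply: hh; rewrite !ler0_norm ?subr_le0//; lra.
Qed.

Lemma prim_lip h (c v e : R) : continuous h ->
  (forall t, `|t - c| <= `|v| -> `|h t| <= e) -> `|prim h (c + v) - prim h c| <= `|v| * e.
Proof.
move=> ch he; have := @prim_taylor h c v 0 e ch; rewrite mulr0 subr0; apply.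
by move=> t /he; rewrite subr0.
Qed.

Lemma is_derive_prim h (t : R) : continuous h -> is_derive t 1 (prim h) (h t).
Proof.
move=> ch; have lh := slice_loc_continuous ch.
apply: (@near_eq_is_derive _ _ _ (fun x => prim h (t - 1) + \int[lam]_(s in `[t - 1, x]) h s)).
  near=> x; have tx : t - 1 <= x.
    by apply/ltW; near: x; apply: lt_nbhsr; rewrite gtrDl oppr_lt0.
  by rewrite -primB// addrC subrK.
have [||||h1 h2] := @continuous_FTC1_closed _ h (t - 1) t (t + 1).
- by rewrite ltrDl.
- exact: slice_loc_itv.
- by rewrite gtrDl oppr_lt0.
- exact: ch.
rewrite -[h t]add0r; apply: is_deriveD.
by apply: DeriveDef; [exact: h1|rewrite -derive1E].
Unshelve. all: by end_near.
Qed.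

Lemma int_shift h (a b z : R) : continuous h -> a <= b ->
  \int[lam]_(t in `[a, b]) h (t + z) = prim h (b + z) - prim h (a + z).
Proof.
move=> ch ab; apply: (@C1_FTC _ (fun t => prim h (t + z)) (fun t => h (t + z)) a b) => //.
  move=> t; exact: (is_derive_translate (is_derive_prim (t + z) ch)).
move=> t; apply: (@continuous_comp _ _ _ (fun t => t + z) h); last exact: ch.
by apply: continuousD; [exact: id|exact: cst_continuous].
Qed.

Lemma prim_mono_bounds h (a d : R) : continuous h -> {homo h : x y / x <= y} -> 0 <= d ->
  d * h a <= prim h (a + d) - prim h a <= d * h (a + d).
Proof.
move=> ch mh d0.
have ad : a <= a + d by rewrite lerDl.
have lh := slice_loc_continuous ch.
have icst z := slice_loc_itv a (a + d) (slice_loc_cst z).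
have ih := slice_loc_itv a (a + d) lh.
rewrite primB// -[X in X * h a <= _](_ : a + d - a = d); last by rewrite addrAC subrr add0r.
rewrite -[X in _ <= X * h (a + d)](_ : a + d - a = d); last by rewrite addrAC subrr add0r.
rewrite -!int_cst_itv//; apply/andP; split; apply: le_Rintegral => //.
- exact: icst.
- by move=> t /=; rewrite in_itv/= => /andP[t1 t2]; exact: mh.
- exact: icst.
by move=> t /=; rewrite in_itv/= => /andP[t1 t2]; exact: mh.
Qed.

(** The primitive of h turns the integral into a difference of increments over intervals of length
    2 d at the two ends. *)
Lemma int_shift_diff h (c0 c1 v d : R) : continuous h -> {homo h : x y / x <= y} ->
  c0 <= c1 -> 0 <= d ->
  \int[lam]_(t in `[c0, c1]) (h (t + (v + d)) - h (t + (v - d))) <=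
    2 * d * (h (c1 + v + d) - h (c0 + v - d)).
Proof.
move=> ch mh c01 d0.
have cs z : continuous (fun t => h (t + z)).
  move=> t; apply: (@continuous_comp _ _ _ (fun t => t + z) h); last exact: ch.
  by apply: continuousD; [exact: id|exact: cst_continuous].
have is_ z := slice_loc_itv c0 c1 (slice_loc_continuous (cs z)).
rewrite (RintegralB _ (is_ (v + d)) (is_ (v - d))); last exact: measurable_itv.
rewrite !int_shift//.
have d2 : 0 <= 2 * d by rewrite mulr_ge0.
have /andP[_ h1] := prim_mono_bounds (c1 + v - d) ch mh d2.
have /andP[h2 _] := prim_mono_bounds (c0 + v - d) ch mh d2.
move: h1 h2; rewrite (_ : c1 + v - d + 2 * d = c1 + v + d); last by ring.
rewrite (_ : c0 + v - d + 2 * d = c0 + v + d); last by ring.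
rewrite !addrA; lra.
Qed.

End primitive.

Section box_fubini.
Context d1 d2 (T1 : measurableType d1) (T2 : measurableType d2) {R : realType}.
Variables (m1 : {sigma_finite_measure set T1 -> \bar R}) (m2 : {sigma_finite_measure set T2 -> \bar R}).

Lemma Rint_fubini_dom (A : set T1) (B : set T2) (q : T1 * T2 -> R) (dm : T1 -> R) :
  measurable A -> measurable B -> (m2 B < +oo)%E -> measurable_fun setT q ->
  m1.-integrable A (EFin \o dm) -> (forall x y, A x -> B y -> `|q (x, y)| <= dm x) ->
  \int[m1]_(x in A) (\int[m2]_(y in B) q (x, y)) = \int[m2]_(y in B) (\int[m1]_(x in A) q (x, y)).
Proof.
move=> mA mB Boo mq idm qd.
pose F (p : T1 * T2) := \1_A p.1 * (\1_B p.2 * q p).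
have mF : measurable_fun setT F.
  apply: measurable_funM.
    by apply: (measurableT_comp (f := \1_A : T1 -> R)); [exact: measurable_indic|exact: measurable_fst].
  apply: measurable_funM => //.
  by apply: (measurableT_comp (f := \1_B : T2 -> R)); [exact: measurable_indic|exact: measurable_snd].
have id1 : m1.-integrable setT (EFin \o (dm \_ A)).
  by rewrite -restrict_EFin; exact: (integrable_mkcond _ mA).1.
have iB : m2.-integrable setT (EFin \o (\1_B : T2 -> R)).
  have := (integrable_mkcond _ mB).1 (integrable_cst_fin 1 mB Boo).
  by apply: eq_integrable => // y _; rewrite /= patchE indicE; case: ifPn.
have iF : (m1 \x m2)%E.-integrable setT (EFin \o F).
  apply: (integrable_dom measurableT mF _ (integrable_prod_tensor id1 iB)).
  move=> [x y]; rewrite /F /= patchE !indicE.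
  have [/set_mem xA|_] := boolP (x \in A); last by rewrite !mul0r normr0.
  have [/set_mem yB|_] := boolP (y \in B); last by rewrite mul0r !mulr0.
  by rewrite !mul1r mulr1 (le_trans (qd _ _ xA yB))// ler_norm.
have e1 x : \int[m2]_y F (x, y) = ((fun x => \int[m2]_(y in B) q (x, y)) \_ A) x.
  rewrite patchE; case: ifPn => xA.
    rewrite [RHS]Rintegral_mkcond; apply: eq_Rintegral => y _.
    by rewrite /F /= patchE !indicE xA; case: ifPn => _; rewrite !(mul1r, mul0r).
  by rewrite /Rintegral integral0_eq// => y _; rewrite /F /= indicE (negbTE xA) mul0r.
have e2 y : \int[m1]_x F (x, y) = ((fun y => \int[m1]_(x in A) q (x, y)) \_ B) y.
  rewrite patchE; case: ifPn => yB.
    rewrite [RHS]Rintegral_mkcond; apply: eq_Rintegral => x _.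
    by rewrite /F /= patchE !indicE yB; case: ifPn => _; rewrite !(mul1r, mul0r).
  by rewrite /Rintegral integral0_eq// => x _; rewrite /F /= !indicE (negbTE yB) mul0r mulr0.
rewrite [LHS]Rintegral_mkcond [RHS]Rintegral_mkcond.
have := Rint_fubini iF.
by under eq_Rintegral do rewrite e1; under [in X in _ = X -> _]eq_Rintegral do rewrite e2.
Qed.

Lemma measurable_Rint_param_in (B : set T2) (q : T1 * T2 -> R) : measurable B ->
  measurable_fun setT q -> measurable_fun setT (fun x => \int[m2]_(y in B) q (x, y)).
Proof.
move=> mB mq; have mF : measurable_fun setT (fun p : T1 * T2 => \1_B p.2 * q p).
  apply: measurable_funM => //.
  by apply: (measurableT_comp (f := \1_B : T2 -> R)); [exact: measurable_indic|exact: measurable_snd].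
have := measurable_Rint_param m2 mF; apply: eq_measurable_fun => x _.
rewrite [RHS]Rintegral_mkcond; apply: eq_Rintegral => y _.
by rewrite /= patchE indicE; case: ifPn => _; rewrite ?mul1r ?mul0r.
Qed.

Lemma Rint_ae_ge0 (A : set T1) (X : T1 -> R) : measurable A -> measurable_fun setT X ->
  {ae m1, forall x, A x -> 0 <= X x} -> 0 <= \int[m1]_(x in A) X x.
Proof.
move=> mA mX hX; rewrite (_ : \int[m1]_(x in A) X x = \int[m1]_(x in A) `|X x|).
  exact: Rintegral_ge0.
rewrite /Rintegral; congr fine; apply: ae_eq_integral => //.
- by apply/measurable_EFinP; exact: measurable_funTS.
- by apply/measurable_EFinP; apply: measurableT_comp => //; exact: measurable_funTS.
by apply: filterS hX => x hx Ax; rewrite ger0_norm// hx.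
Qed.

End box_fubini.

Section box.
Context {R : realType} {n : nat}.
Local Notation lam := (@lebesgue_measure R).
Local Notation mu := (@leb R n).
Local Notation nu := (@leb R n.+1).
Variables (f g : 'rV[R]_n.+1 -> R) (N1 : nat).
Hypothesis reg : regular_pair f g.
Implicit Types (y : 'rV[R]_n) (v : 'rV[R]_n -> R).

Let lf : L1loc f. Proof. by case: reg => _ /integrable_L1loc. Qed.
Let lg : L1loc g. Proof. by case: reg. Qed.
Let acl y : acl_line f g y. Proof. by case: reg. Qed.
Let f0 x : 0 <= f x. Proof. by case: reg. Qed.

Definition box : set 'rV[R]_n := cbox N1%:R.

Lemma measurable_box : measurable box. Proof. exact: measurable_cbox. Qed.

Definition fline y (t : R) : R := f (row_rcons y t).
(** The increments of this primitive bound the oscillation of f on the line through y. *)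
Definition tvar y : R -> R := prim (fun s => `|g (row_rcons y s)|).
Definition mass y : R -> R := prim (fline y).

Lemma continuous_fline y : continuous (fline y). Proof. exact: acl_continuous (acl y). Qed.

Let sg y : slice_loc (fun s => g (row_rcons y s)). Proof. by case: (acl y). Qed.

Lemma continuous_tvar y : continuous (tvar y).
Proof. by apply: continuous_prim; exact: slice_loc_norm. Qed.

Lemma tvar_mono y : {homo tvar y : s t / s <= t}.
Proof. by move=> s t; exact: prim_norm_mono. Qed.

Lemma fline_osc y (s t : R) : s <= t -> `|fline y t - fline y s| <= tvar y t - tvar y s.
Proof. by move=> st; have [_ h] := acl y; rewrite /fline h; exact: prim_norm_diff. Qed.

Lemma fline_near y (c t r : R) : `|t - c| <= r -> `|fline y t - fline y c| <= tvar y (c + r) - tvar y (c - r).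
Proof.
rewrite ler_norml => /andP[h1 h2]; have [ct|/ltW tc] := leP c t.
  by apply: le_trans (fline_osc y ct) _; apply: lerB; apply: tvar_mono; lra.
by rewrite distrC; apply: le_trans (fline_osc y tc) _; apply: lerB; apply: tvar_mono; lra.
Qed.

Definition bdom (N : nat) y : R := line_dom f g N y.

Lemma fline_bdom N y (t : R) : (0 < N)%N -> `|t| <= N%:R -> `|fline y t| <= bdom N y.
Proof. by move=> N0 tN; apply: line_dom_bound => //; rewrite in_itv/= -ler_norml. Qed.

Lemma tvar_bdom N y (s t : R) : `|s| <= N%:R -> `|t| <= N%:R -> `|tvar y t - tvar y s| <= bdom N y.
Proof.
move=> sN tN; have d1 : 0 <= slint (fun x => `|f x|) (\1_(`[0, 1]%classic) : R -> R) y.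
  by apply: Rintegral_ge0 => r _; rewrite mulr_ge0.
apply: (@le_trans _ _ (tvar y N%:R - tvar y (- N%:R))).
  move: sN tN; rewrite !ler_norml => /andP[s1 s2] /andP[t1 t2].
  have := tvar_mono y s1; have := tvar_mono y s2; have := tvar_mono y t1; have := tvar_mono y t2.
  lra.
rewrite /bdom /line_dom [X in _ <= _ + X]slint_indic -primB ?lerDr//.
  exact: slice_loc_norm.
by apply: (@le_trans _ _ 0) => //; rewrite oppr_le0.
Qed.

Lemma bdom_ge0 N y : (0 < N)%N -> 0 <= bdom N y.
Proof. by move=> N0; apply: le_trans (fline_bdom y (t := 0) N0 _) => //; rewrite normr0. Qed.

Lemma integrable_bdom N : mu.-integrable box (EFin \o bdom N).
Proof. by apply: L1loc_integrable_cbox; exact: L1loc_line_dom. Qed.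

Lemma measurable_on_graph (u : 'rV[R]_n.+1 -> R) v : measurable_fun setT u -> measurable_fun setT v ->
  measurable_fun setT (fun y => u (row_rcons y (v y))).
Proof.
move=> mu_ mv; apply: (measurableT_comp mu_).
apply: (measurableT_comp (f := rc) (g := fun y => (y, v y : measurableTypeR R))).
  exact: measurable_rc.
by apply/measurable_fun_pairP; split => /=; [exact: measurable_id|exact: mv].
Qed.

Lemma measurable_fline v : measurable_fun setT v -> measurable_fun setT (fun y => fline y (v y)).
Proof. by move=> mv; apply: (measurable_on_graph _ mv); exact: lf.1. Qed.

Lemma measurable_tvar v : measurable_fun setT v -> measurable_fun setT (fun y => tvar y (v y)).
Proof.
move=> mv; have := measurable_on_graph (L1loc_vprim (L1loc_norm lg)).1 mv.
apply: eq_measurable_fun => y _.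
by rewrite /vprim row_init_rcons row_last_rcons.
Qed.

Lemma measurable_mass v : measurable_fun setT v -> measurable_fun setT (fun y => mass y (v y)).
Proof.
move=> mv; have := measurable_on_graph (L1loc_vprim lf).1 mv.
apply: eq_measurable_fun => y _.
by rewrite /vprim row_init_rcons row_last_rcons.
Qed.

Lemma box_integrable N (C : R) (u : 'rV[R]_n -> R) : measurable_fun setT u ->
  (forall y, `|u y| <= C * bdom N y) -> mu.-integrable box (EFin \o u).
Proof.
move=> mu_ uC; have := integrableZl measurable_box C (integrable_bdom N).
apply: (integrable_dom measurable_box mu_) => y.
by rewrite (le_trans (uC y))// ler_norm.
Qed.

Definition total_var (t : R) : R := \int[mu]_(y in box) tvar y t.

Lemma integrable_tvar (t : R) : mu.-integrable box (EFin \o (fun y => tvar y t)).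
Proof.
have := L1loc_integrable_cbox N1%:R (L1loc_slint (L1loc_norm lg) (kap_cbfun t)).
exact.
Qed.

Lemma total_var_mono : {homo total_var : s t / s <= t}.
Proof.
move=> s t st; apply: le_Rintegral; first exact: measurable_box.
- exact: integrable_tvar.
- exact: integrable_tvar.
by move=> y _; exact: tvar_mono.
Qed.

Definition mean (a : 'rV[R]_n -> R) (t : R) : R := \int[mu]_(y in box) (a y * fline y t).

Lemma total_var_osc (t e : R) : 0 < e -> exists2 d, 0 < d & total_var (t + d) - total_var (t - d) < e.
Proof.
move=> e0; pose dk (k : nat) : R := k.+1%:R^-1.
have dk0 k : 0 < dk k by rewrite invr_gt0.
have dk1 k : dk k <= 1 by rewrite invf_le1// (ler_nat _ 1).
pose N := (Num.truncn (`|t| + 1)).+1.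
have hN : `|t| + 1 < N%:R by exact: truncnS_gt.
pose u k := (fun y => tvar y (t + dk k) - tvar y (t - dk k)) \_ box.
have mb := measurable_box.
have mt k : measurable_fun setT (fun y => tvar y (t + dk k) - tvar y (t - dk k)).
  by apply: measurable_funB; apply: measurable_tvar; exact: measurable_cst.
have mu_ k : measurable_fun setT (u k).
  by apply/(measurable_restrictT _ mb); apply: measurable_funTS.
have iD : mu.-integrable setT (EFin \o (bdom N \_ box)).
  by rewrite -restrict_EFin; apply/(integrable_mkcond _ mb); exact: integrable_bdom.
have [|||_] := @dct_real _ _ _ mu u (cst 0) (bdom N \_ box) mu_ _ _ iD _.
- exact: measurable_cst.
- apply: aeW => y; have [yb|yb] := boolP (y \in box); last first.
    rewrite (_ : (fun k => u k y) = cst 0); first exact: cvg_cst.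
    by apply/funext => k; rewrite /u patchE (negbTE yb).
  rewrite (_ : (fun k => u k y) = (fun k => tvar y (t + dk k) - tvar y (t - dk k))); last first.
    by apply/funext => k; rewrite /u patchE yb.
  have dcv : dk k @[k --> \oo] --> 0 by exact: cvg_harmonic.
  have h1 : tvar y (t + dk k) @[k --> \oo] --> tvar y t.
    have tc : t + dk k @[k --> \oo] --> t.
      by rewrite -[X in _ --> X]addr0; apply: cvgD => //; exact: cvg_cst.
    exact: (cvg_comp _ _ tc (@continuous_tvar y t)).
  have h2 : tvar y (t - dk k) @[k --> \oo] --> tvar y t.
    have tc : t - dk k @[k --> \oo] --> t.
      by rewrite -[X in _ --> X]subr0; apply: cvgB => //; exact: cvg_cst.
    exact: (cvg_comp _ _ tc (@continuous_tvar y t)).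
  by rewrite -(subrr (tvar y t)); exact: cvgB.
- apply: aeW => y k; rewrite /u !patchE; case: ifPn => _; last by rewrite normr0.
  have n1 := ler_norm t; have := ler_norm (- t); rewrite normrN => n2.
  have k0 := dk0 k; have k1 := dk1 k; move: (dk k) k0 k1 => d k0 k1.
  by apply: tvar_bdom; rewrite ler_norml; apply/andP; split; lra.
rewrite integral0_eq// => cv.
have uE k : (\int[mu]_y (u k y)%:E = (total_var (t + dk k) - total_var (t - dk k))%:E)%E.
  rewrite -[RHS]/((_ : R)%:E) -(RintegralB mb (integrable_tvar _) (integrable_tvar _)).
  have iu : mu.-integrable setT (EFin \o u k).
    rewrite /u -restrict_EFin; apply/(integrable_mkcond _ mb).
    by have := integrableB mb (integrable_tvar (t + dk k)) (integrable_tvar (t - dk k)).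
  by rewrite Rintegral_mkcond /Rintegral fineK//; apply: integrable_fin_num => //; exact: iu.
have e0' : (0 < e%:E)%E by rewrite lte_fin.
have [k] := cvg_ereal_lt cv e0'.
by rewrite uE lte_fin => h; exists (dk k).
Qed.

Lemma total_var_unif (c0 c1 e : R) : 0 < e -> exists2 d, 0 < d &
  forall c r, c0 <= c <= c1 -> 0 <= r -> r <= d -> total_var (c + r) - total_var (c - r) < e.
Proof.
move=> e0; have /compact_near_coveringP := @segment_compact R c0 c1.
move=> /(_ R 0^'+ (fun r c => total_var (c + r) - total_var (c - r) < e)).
move=> /(_ _) [|].
  move=> c _; have [d d0 hd] := total_var_osc c e0.
  exists ([set c' | `|c' - c| < d / 2], [set r | 0 < r < d / 2]); first split => /=.
  - exists (d / 2) => /=; first by rewrite divr_gt0.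
    by move=> c' /=; rewrite distrC.
  - near=> r; apply/andP; split; near: r; first exact: nbhs_right_gt.
    by apply: nbhs_right_lt; rewrite divr_gt0.
  move=> [c' r] /= [h /andP[r0 rd]]; apply: le_lt_trans hd.
  move: h; rewrite ltr_norml => /andP[h1 h2].
  by apply: lerB; apply: total_var_mono; lra.
move=> d /= d0 hd; exists (d / 2); first by rewrite divr_gt0.
move=> c r cI r0 rd; apply: le_lt_trans (_ : total_var (c + d / 2) - total_var (c - d / 2) < e).
  by apply: lerB; apply: total_var_mono; lra.
apply: (hd (d / 2)) => //=.
- by rewrite sub0r normrN gtr0_norm ?divr_gt0//; lra.
- by rewrite divr_gt0.
Unshelve. all: by end_near.
Qed.

Definition mean_osc (c r : R) : R := total_var (c + r) - total_var (c - r).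

Lemma mean_integrable (a : 'rV[R]_n -> R) M (t : R) : measurable_fun setT a ->
  (forall y, `|a y| <= M) -> mu.-integrable box (EFin \o (fun y => a y * fline y t)).
Proof.
move=> ma aM; pose N := (Num.truncn `|t|).+1.
have tN : `|t| <= N%:R by exact/ltW/truncnS_gt.
apply: (@box_integrable N M).
  by apply: measurable_funM => //; apply: measurable_fline; exact: measurable_cst.
by move=> y; rewrite normrM ler_pM//; exact: fline_bdom.
Qed.

Lemma mass_taylor y (c v r : R) : `|v| <= r ->
  `|mass y (c + v) - mass y c - v * fline y c| <= `|v| * (tvar y (c + r) - tvar y (c - r)).
Proof.
move=> vr; apply: prim_taylor; first exact: continuous_fline.
by move=> t tc; apply: fline_near; apply: le_trans vr.
Qed.

Lemma osc_integral (c r : R) : \int[mu]_(y in box) (tvar y (c + r) - tvar y (c - r)) = mean_osc c r.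
Proof. exact: (RintegralB measurable_box (integrable_tvar _) (integrable_tvar _)). Qed.

(** Exchange the integrals over c and y.  On the line through y, the integral of
    f (c + s u) - f c over [c0, c1] is the difference of two integrals of f over segments of length
    |s u| at c1 and c0, each of which is s u f up to the oscillation of f ([mass_taylor]); the integral of the
    increments of [tvar] is of the order of d by [int_shift_diff]. *)
Lemma integrated_variation (u : 'rV[R]_n -> R) (M s d B c0 c1 r : R) (N : nat) :
  measurable_fun setT u -> (forall y, `|u y| <= M) -> 0 <= d -> 0 <= B -> c0 <= c1 ->
  r = `|s| * M + d -> (0 < N)%N -> `|c0| + r <= N%:R -> `|c1| + r <= N%:R ->
  {ae lam, forall c, c0 <= c <= c1 ->
    0 <= \int[mu]_(y in box) (fline y (c + s * u y) - fline y c +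
      (tvar y (c + (s * u y + d)) - tvar y (c + (s * u y - d))) + B * bdom N y)} ->
  0 <= s * (mean u c1 - mean u c0) + `|s| * M * (mean_osc c1 r + mean_osc c0 r) +
    2 * d * (total_var (c1 + r) - total_var (c0 - r)) +
    (c1 - c0) * B * \int[mu]_(y in box) bdom N y.
Proof.
move=> mu_ uM d0 B0 c01 rE N0 c0N c1N hX.
have mb := measurable_box.
have M0 : 0 <= M by apply: le_trans (uM 0).
have suM y : `|s * u y| <= `|s| * M by rewrite normrM ler_wpM2l.
have r0 : 0 <= r by rewrite rE addr_ge0// mulr_ge0.
have sur y : `|s * u y| <= r by rewrite rE (le_trans (suM y))// lerDl.
have cN (c v : R) : c0 <= c <= c1 -> `|v| <= r -> `|c + v| <= N%:R.
  move=> /andP[h1 h2]; rewrite !ler_norml => /andP[v1 v2].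
  have := ler_norm c1; have := ler_norm (- c0); rewrite normrN => n1 n2.
  by apply/andP; split; lra.
pose chi (p : 'rV[R]_n * measurableTypeR R) : R :=
  fline p.1 (p.2 + s * u p.1) - fline p.1 p.2 +
  (tvar p.1 (p.2 + (s * u p.1 + d)) - tvar p.1 (p.2 + (s * u p.1 - d))) + B * bdom N p.1.
have mbd : measurable_fun setT (bdom N) by exact: (L1loc_line_dom N lf lg).1.
have mpt (h : 'rV[R]_n.+1 -> R) (v : 'rV[R]_n * measurableTypeR R -> R) : measurable_fun setT h ->
    measurable_fun setT v -> measurable_fun setT (fun p : 'rV[R]_n * measurableTypeR R => h (row_rcons p.1 (v p))).
  move=> mh mv; apply: (measurableT_comp mh).
  apply: (measurableT_comp (f := rc) (g := fun p : 'rV[R]_n * measurableTypeR R => (p.1, v p : measurableTypeR R))).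
    exact: measurable_rc.
  by apply/measurable_fun_pairP; split => /=; [exact: measurable_fst|exact: mv].
have mu1 : measurable_fun setT (fun p : 'rV[R]_n * measurableTypeR R => s * u p.1).
  by apply: measurable_funM => //; exact: (measurableT_comp mu_ measurable_fst).
have m2 : measurable_fun setT (fun p : 'rV[R]_n * measurableTypeR R => p.2 : R) by exact: measurable_snd.
have mT (v : 'rV[R]_n * measurableTypeR R -> R) : measurable_fun setT v ->
    measurable_fun setT (fun p : 'rV[R]_n * measurableTypeR R => tvar p.1 (v p)).
  move=> mv; have := mpt _ _ (L1loc_vprim (L1loc_norm lg)).1 mv.
  by apply: eq_measurable_fun => p _; rewrite /vprim row_init_rcons row_last_rcons.
have mchi : measurable_fun setT chi.
  apply: measurable_funD; last first.
    by apply: measurable_funM => //; exact: (measurableT_comp mbd measurable_fst).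
  apply: measurable_funD; apply: measurable_funB.
  - by apply: mpt; [exact: lf.1|exact: measurable_funD].
  - by apply: mpt; [exact: lf.1|exact: m2].
  - by apply: mT; apply: measurable_funD => //; exact: measurable_funD.
  - by apply: mT; apply: measurable_funD => //; exact: measurable_funB.
have dr : d <= r by rewrite rE lerDr mulr_ge0.
have vdr y : `|s * u y + d| <= r /\ `|s * u y - d| <= r.
  move: (suM y); rewrite rE !ler_norml => /andP[v1 v2]; split; apply/andP; split; lra.
have cB (y : 'rV[R]_n) (c : R) : `[c0, c1]%classic c -> `|chi (y, c)| <= (3 + B) * bdom N y.
  rewrite /= in_itv/= => cI; rewrite /chi /=.
  have [v1 v2] := vdr y.
  have b1 := fline_bdom y N0 (cN _ _ cI (sur y)).
  have b2 : `|fline y c| <= bdom N y.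
    by apply: fline_bdom => //; rewrite -[c]addr0; apply: cN => //; rewrite normr0.
  have b3 := tvar_bdom y (cN _ _ cI v2) (cN _ _ cI v1).
  have b4 := bdom_ge0 y N0.
  have b5 : 0 <= B * bdom N y by rewrite mulr_ge0.
  move: b1 b2 b3; rewrite !ler_norml mulrDl => /andP[? ?] /andP[? ?] /andP[? ?].
  by apply/andP; split; lra.
have iC : mu.-integrable box (EFin \o (fun y => (3 + B) * bdom N y)).
  by have := integrableZl mb (3 + B) (integrable_bdom N); apply: eq_integrable.
have Ioo : (lam `[c0, c1]%classic < +oo)%E.
  by rewrite /= lebesgue_measure_itv/=; case: ifPn => _; rewrite ?ltry// -EFinD ltry.
have mI : measurable (`[c0, c1]%classic : set (measurableTypeR R)) by exact: measurable_itv.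
have FB := Rint_fubini_dom (m1 := mu) (m2 := lam) mb mI Ioo mchi iC (fun y c _ => cB y c).
have X0 : 0 <= \int[lam]_(c in `[c0, c1]) \int[mu]_(y in box) chi (y, c).
  have mq : measurable_fun setT (fun p : measurableTypeR R * 'rV[R]_n => chi (p.2, p.1)).
    apply: (measurableT_comp (f := chi) (g := fun p : measurableTypeR R * 'rV[R]_n => (p.2, p.1))) => //.
    by apply/measurable_fun_pairP; split; [exact: measurable_snd|exact: measurable_fst].
  have mX := measurable_Rint_param_in mu mb mq.
  apply: (Rint_ae_ge0 (m1 := lam) mI mX).
  have := hX; apply: filterS; first exact: (ae_filter_ringOfSetsType lam).
  by move=> c hc; rewrite /= in_itv/=; exact: hc.
have csh (h : R -> R) z : continuous h -> continuous (fun t => h (t + z)).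
  move=> ch t; apply: (@continuous_comp _ _ _ (fun t => t + z) h); last exact: ch.
  by apply: continuousD; [exact: id|exact: cst_continuous].
have i1 y (v : R) : lam.-integrable `[c0, c1] (EFin \o (fun c : R => fline y (c + v))).
  exact: slice_loc_itv (slice_loc_continuous (csh _ v (@continuous_fline y))).
have i2 y : lam.-integrable `[c0, c1] (EFin \o fline y).
  exact: slice_loc_itv (slice_loc_continuous (@continuous_fline y)).
have i12 y (v : R) : lam.-integrable `[c0, c1] (EFin \o (fun c : R => fline y (c + v) - fline y c)).
  by have := integrableB mI (i1 y v) (i2 y).
have i3 y (v : R) : lam.-integrable `[c0, c1] (EFin \o (fun c : R => tvar y (c + (v + d)) - tvar y (c + (v - d)))).
  apply: slice_loc_itv; apply: slice_loc_continuous => t.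
  apply: (@continuousB _ _ _ (fun c : R => tvar y (c + (v + d))) (fun c : R => tvar y (c + (v - d)))).
    exact: csh (@continuous_tvar y) t.
  exact: csh (@continuous_tvar y) t.
have i123 y (v : R) : lam.-integrable `[c0, c1] (EFin \o (fun c : R => fline y (c + v) - fline y c +
    (tvar y (c + (v + d)) - tvar y (c + (v - d))))).
  by have := integrableD mI (i12 y v) (i3 y v).
have i4 y := slice_loc_itv c0 c1 (slice_loc_cst (B * bdom N y)).
have ichi y : lam.-integrable `[c0, c1] (EFin \o (fun c : R => chi (y, c))).
  by have := integrableD mI (i123 y (s * u y)) (i4 y).
(* the integral over the heights on one line *)
have inner y : \int[lam]_(c in `[c0, c1]) chi (y, c) <=
    s * (u y * fline y c1 - u y * fline y c0) +
    `|s| * M * ((tvar y (c1 + r) - tvar y (c1 - r)) + (tvar y (c0 + r) - tvar y (c0 - r))) +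
    2 * d * (tvar y (c1 + r) - tvar y (c0 - r)) + (c1 - c0) * B * bdom N y.
  pose v := s * u y.
  have cf := @continuous_fline y; have ct := @continuous_tvar y.
  have -> : \int[lam]_(c in `[c0, c1]) chi (y, c) =
    (mass y (c1 + v) - mass y (c0 + v)) - (mass y c1 - mass y c0) +
    \int[lam]_(c in `[c0, c1]) (tvar y (c + (v + d)) - tvar y (c + (v - d))) +
    (c1 - c0) * (B * bdom N y).
    apply: (etrans (RintegralD mI (i123 y v) (i4 y))); congr (_ + _); last exact: int_cst_itv.
    apply: (etrans (RintegralD mI (i12 y v) (i3 y v))); congr (_ + _).
    apply: (etrans (RintegralB mI (i1 y v) (i2 y))); congr (_ - _); first exact: int_shift.
    by rewrite -primB//; exact: slice_loc_continuous.
  have J := @int_shift_diff R (tvar y) c0 c1 v d ct (@tvar_mono y) c01 d0.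
  have vM : `|v| <= `|s| * M := suM y.
  have t1 := mass_taylor y c1 (sur y); have t0 := mass_taylor y c0 (sur y).
  rewrite -/v in t1 t0.
  have o1 : 0 <= tvar y (c1 + r) - tvar y (c1 - r) by rewrite subr_ge0; apply: tvar_mono; lra.
  have o0 : 0 <= tvar y (c0 + r) - tvar y (c0 - r) by rewrite subr_ge0; apply: tvar_mono; lra.
  have {}t1 := le_trans t1 (ler_wpM2r o1 vM); have {}t0 := le_trans t0 (ler_wpM2r o0 vM).
  have J2 : 2 * d * (tvar y (c1 + v + d) - tvar y (c0 + v - d)) <=
      2 * d * (tvar y (c1 + r) - tvar y (c0 - r)).
    have [v1 v2] := vdr y; rewrite -/v in v1 v2.
    rewrite ler_wpM2l ?mulr_ge0// lerB// tvar_mono//.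
      by move: v1; rewrite ler_norml => /andP[]; lra.
    by move: v2; rewrite ler_norml => /andP[]; lra.
  have {}J := le_trans J J2.
  have -> : s * (u y * fline y c1 - u y * fline y c0) = v * fline y c1 - v * fline y c0.
    by rewrite /v; ring.
  rewrite -(mulrA (c1 - c0)) [_ * M * _]mulrDr.
  move: t1 t0; rewrite !ler_norml => /andP[_ t1] /andP[t0 _].
  lra.
have iu t : mu.-integrable box (EFin \o (fun y => u y * fline y t)) by exact: mean_integrable uM.
have iT := integrable_tvar.
have iTB a b : mu.-integrable box (EFin \o (fun y => tvar y a - tvar y b)).
  by have := integrableB mb (iT a) (iT b).
have TBE a b : \int[mu]_(y in box) (tvar y a - tvar y b) = total_var a - total_var b.
  exact: (RintegralB mb (iT a) (iT b)).
have iZ k h : mu.-integrable box (EFin \o h) -> mu.-integrable box (EFin \o (fun y => k * h y)) /\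
    \int[mu]_(y in box) (k * h y) = k * \int[mu]_(y in box) h y.
  move=> ih; split; last exact: RintegralZl.
  by have := integrableZl mb k ih; apply: eq_integrable.
have iD h k : mu.-integrable box (EFin \o h) -> mu.-integrable box (EFin \o k) ->
    mu.-integrable box (EFin \o (fun y => h y + k y)).
  by move=> ih ik; have := integrableD mb ih ik.
have iu' : mu.-integrable box (EFin \o (fun y => u y * fline y c1 - u y * fline y c0)).
  by have := integrableB mb (iu c1) (iu c0).
have uE : \int[mu]_(y in box) (u y * fline y c1 - u y * fline y c0) = mean u c1 - mean u c0.
  exact: (RintegralB mb (iu c1) (iu c0)).
have iT2 : mu.-integrable box (EFin \o (fun y =>
    (tvar y (c1 + r) - tvar y (c1 - r)) + (tvar y (c0 + r) - tvar y (c0 - r)))) by exact: iD.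
have T2E : \int[mu]_(y in box) ((tvar y (c1 + r) - tvar y (c1 - r)) + (tvar y (c0 + r) - tvar y (c0 - r))) =
    mean_osc c1 r + mean_osc c0 r.
  by rewrite (RintegralD mb (iTB _ _) (iTB _ _)) !TBE.
have [iA AE] := iZ s _ iu'; have [iA2 A2E] := iZ (`|s| * M) _ iT2.
have [iA3 A3E] := iZ (2 * d) _ (iTB (c1 + r) (c0 - r)).
have [iA4 A4E] := iZ ((c1 - c0) * B) _ (integrable_bdom N).
rewrite -FB in X0; apply: (le_trans X0).
rewrite -uE -T2E -TBE -AE -A2E -A3E -A4E.
rewrite -(RintegralD mb iA iA2) -(RintegralD mb (iD _ _ iA iA2) iA3).
rewrite -(RintegralD mb (iD _ _ (iD _ _ iA iA2) iA3) iA4).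
apply: le_Rintegral => //; last exact: iD (iD _ _ (iD _ _ iA iA2) iA3) iA4.
apply: (@box_integrable N ((c1 - c0) * (3 + B))); first exact: (measurable_Rint_param_in lam mI mchi).
move=> y; apply: le_trans (le_normr_Rintegral mI (ichi y)) _.
rewrite -mulrA -int_cst_itv//; apply: le_Rintegral => //.
- by have := integrable_abse (ichi y).
- exact: slice_loc_itv (slice_loc_cst _).
by move=> c cI; exact: cB.
Qed.

End box.

(** * Constancy of the ratios of averages *)

Section arith.
Context {R : realType}.
Implicit Types T D E P : R.

Lemma near_pos T D E P : `|D| + E < P -> `|T - (D + P)| <= E -> 0 < T.
Proof.
move=> h; rewrite ler_norml => /andP[h1 _].
have := ler_norm (- D); rewrite normrN; lra.
Qed.

Lemma near_neg T D E P : `|D| + E < P -> `|T - (D - P)| <= E -> T < 0.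
Proof.
move=> h; rewrite ler_norml => /andP[_ h1].
have := ler_norm D; lra.
Qed.

Lemma osc_telescope (x1 x2 x3 y1 y2 y3 e : R) : x3 - x1 < e -> y3 - y1 < e ->
  x1 <= x2 -> y2 <= y3 -> x3 - y1 <= x2 - y2 + 2 * e.
Proof. lra. Qed.

(** The arithmetic of [ratio_bound]: all the terms of higher order fit into s e. *)
Lemma step_absorb (s M rho A T eta e B o1 o0 V V' X : R) : 0 < s -> 0 <= M -> 0 <= rho * A ->
  T = M + rho * A + 1 -> 0 < eta -> 8 * T * eta <= e -> 0 <= B -> s * (2 * (B + 1)) <= e ->
  o1 < eta -> o0 < eta -> V' <= V + 2 * eta ->
  0 <= X + s * M * (o1 + o0) + 2 * (s * rho * A) * V' + s ^+ 2 * B ->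
  - X <= s * (2 * rho * A * V + e).
Proof.
move=> s0 M0 q0 TE h0 hT B0 sB e1 e0 hV h.
have h1 : s * M * (o1 + o0) <= s * (2 * (M * eta)).
  rewrite -mulrA ler_wpM2l ?(ltW s0)// mulrCA ler_wpM2l//; lra.
have h2 : 2 * (s * rho * A) * V' <= s * (2 * rho * A * V) + s * (4 * (rho * A * eta)).
  rewrite (_ : _ + _ = 2 * (s * (rho * A)) * (V + 2 * eta)); last by ring.
  by rewrite -(mulrA s) ler_wpM2l// mulr_ge0// mulr_ge0// ltW.
have h3 : s ^+ 2 * B <= s * (e / 2).
  rewrite expr2 -mulrA ler_wpM2l ?(ltW s0)// ler_pdivlMr//.
  apply: le_trans sB; rewrite -mulrA ler_wpM2l ?(ltW s0)// mulrC ler_wpM2l//.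
  by rewrite lerDl.
have h4 : 2 * (M * eta) + 4 * (rho * A * eta) + e / 2 <= e.
  have e1' : 0 <= M * eta by rewrite mulr_ge0// ltW.
  have : 8 * T * eta = 8 * (M * eta) + 8 * (rho * A * eta) + 8 * eta by rewrite TE; ring.
  move: hT e1' h0; clear; move: (8 * T * eta) (M * eta) (rho * A * eta) => u1 u2 u3; lra.
have := ler_wpM2l (ltW s0) h4; rewrite !mulrDr.
move: h h1 h2 h3; clear.
move: (s * M * _) (2 * (s * rho * A) * _) (s ^+ 2 * B) (s * (2 * rho * A * V)) => v1 v2 v3 v4.
move: (s * (2 * (M * eta))) (s * (4 * (rho * A * eta))) (s * (e / 2)) (s * e) => w1 w2 w3 w4; lra.
Qed.

End arith.

Section ratio.
Context {R : realType} {n : nat}.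
Local Notation lam := (@lebesgue_measure R).
Local Notation mu := (@leb R n).
Local Notation nu := (@leb R n.+1).
Variables (f g : 'rV[R]_n.+1 -> R) (N1 : nat).
Hypothesis reg : regular_pair f g.
Hypothesis hm : halfspace_minimal f.
Implicit Types (y : 'rV[R]_n) (w : 'rV[R]_n -> R).
Local Notation box := (@box R n N1).
Local Notation fline := (fline f).
Local Notation tvar := (tvar g).
Local Notation mass := (mass f).
Local Notation bdom := (bdom f g).
Local Notation total_var := (total_var g N1).
Local Notation mean_osc := (mean_osc g N1).
Local Notation mean := (mean f N1).

Let f0 x : 0 <= f x. Proof. by case: reg. Qed.
Let fi : nu.-integrable setT (EFin \o f). Proof. by case: reg. Qed.
Let lf : L1loc f. Proof. exact: integrable_L1loc. Qed.
Let mb : measurable box. Proof. exact: measurable_box. Qed.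

Definition grad_sq w y : R := \sum_(j < n) partial j w y ^+ 2.

Lemma edot_conormal w y : edot (conormal w y) (conormal w y) = 1 + grad_sq w y.
Proof.
rewrite /edot (bigD1_ord ord_max)//= !mxE unlift_none mulr1; congr (_ + _).
by apply: eq_bigr => j _; rewrite !mxE liftK mulrNN expr2.
Qed.

(** Outside the box the graph is flat and the two sides of [halfspace_minimal] have the same
    density, so that the part outside, which is finite, cancels. *)
Lemma graph_inequality w (c L : R) (N : nat) : C1c w ->
  (forall y, ~ box y -> w y = 0 /\ grad_sq w y = 0) ->
  (forall y, grad_sq w y / 2 <= L) ->
  (0 < N)%N -> (forall y, `|c + w y| <= N%:R) -> `|c| <= N%:R ->
  (\int[nu]_(x in epigraph w c) (f x)%:E = \int[nu]_(x in halfspace c) (f x)%:E)%E ->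
  (\int[mu]_y (fline y c)%:E < +oo)%E ->
  0 <= \int[mu]_(y in box) (fline y (c + w y) - fline y c + L * bdom N y).
Proof.
move=> cw w0 wL N0 wN cN vol fin; have := hm cw vol.
have mw : measurable_fun setT w by exact: continuous_measurable_rV (C1c_continuous cw).
pose e y := graph_energy f w c y.
have eE y : e y = (1 + grad_sq w y / 2) * fline y (c + w y).
  by rewrite /e /graph_energy edot_conormal /graph_pt /fline; congr (_ * _); field.
have me : measurable_fun setT e by apply: measurable_graph_energy => //; exact: lf.1.
have mf : measurable_fun setT (fun y => fline y c).
  by apply: (measurable_fline reg); exact: measurable_cst.
have e0 y : 0 <= e y by exact: graph_energy_ge0.
rewrite -/(fline _ c) -(setUv box).
rewrite !ge0_integral_setU//; last 8 first.
- exact: measurableC.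
- by apply: measurable_funTS; exact/measurable_EFinP.
- by move=> y _; rewrite lee_fin.
- by apply/disj_setPS => y [].
- exact: measurableC.
- by apply: measurable_funTS; exact/measurable_EFinP.
- by move=> y _; rewrite lee_fin.
- by apply/disj_setPS => y [].
rewrite [X in (_ <= _ + X)%E](_ : _ = \int[mu]_(y in ~` box) (fline y c)%:E)%E; last first.
  apply: eq_integral => y /set_mem yb; have [wy gy] := w0 y yb.
  by rewrite -/(e y) eE wy gy mul0r addr0 mul1r addr0.
have cfin : (\int[mu]_(y in ~` box) (fline y c)%:E)%E \is a fin_num.
  rewrite ge0_fin_numE; last by apply: integral_ge0 => y _; rewrite lee_fin; exact: f0.
  apply: le_lt_trans fin; apply: ge0_subset_integral => //.
  - exact: measurableC.
  - exact/measurable_EFinP.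
  - by move=> y _; rewrite lee_fin; exact: f0.
rewrite leeD2rE//.
have gL y : 0 <= grad_sq w y by apply: sumr_ge0 => j _; exact: sqr_ge0.
have L0 : 0 <= L by apply: le_trans (wL 0); rewrite divr_ge0.
have fb y : 0 <= fline y (c + w y) <= bdom N y.
  by rewrite f0/=; apply: le_trans (fline_bdom reg y N0 (wN y)); exact: ler_norm.
have ie : mu.-integrable box (EFin \o e).
  apply: (@box_integrable _ _ _ _ N1 reg N (1 + L)) => // y.
  have /andP[h1 h2] := fb y; rewrite eE normrM (ger0_norm h1) ger0_norm ?addr_ge0// ?divr_ge0//.
  by rewrite ler_pM ?lerD2l// addr_ge0// divr_ge0.
have ic : mu.-integrable box (EFin \o (fun y => fline y c)).
  apply: (@box_integrable _ _ _ _ N1 reg N 1) => // y.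
  by rewrite mul1r; exact: fline_bdom.
have iw : mu.-integrable box (EFin \o (fun y => fline y (c + w y))).
  apply: (@box_integrable _ _ _ _ N1 reg N 1) => [|y].
    by apply: (measurable_fline reg); exact: measurable_funD.
  by rewrite mul1r; exact: fline_bdom.
have iwc : mu.-integrable box (EFin \o (fun y => fline y (c + w y) - fline y c)).
  by have := integrableB mb iw ic.
have iL : mu.-integrable box (EFin \o (fun y => L * bdom N y)).
  by have := integrableZl mb L (integrable_bdom N1 reg N); apply: eq_integrable.
move=> h; have {}h : \int[mu]_(y in box) fline y c <= \int[mu]_(y in box) e y.
  by rewrite -lee_fin /Rintegral !fineK//; apply: integrable_fin_num.
rewrite (_ : \int[mu]_(y in box) _ = \int[mu]_(y in box) (fline y (c + w y) + L * bdom N y) -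
    \int[mu]_(y in box) fline y c); last first.
  have iwL : mu.-integrable box (EFin \o (fun y => fline y (c + w y) + L * bdom N y)).
    by have := integrableD mb iw iL.
  rewrite -(RintegralB mb iwL ic); apply: eq_Rintegral => y _; ring.
rewrite subr_ge0; apply: (le_trans h); apply: le_Rintegral => //.
  by have := integrableD mb iw iL.
move=> y _; rewrite eE mulrDl mul1r lerD2l.
have /andP[h1 h2] := fb y; apply: ler_pM => //; exact: divr_ge0.
Qed.

(** By Fubini's theorem the difference of the two masses is the integral over y of the mass of the
    segment between the heights c and c + w y. *)
Lemma volume_eq w (c : R) : C1c w -> (forall y, ~ box y -> w y = 0) ->
  \int[mu]_(y in box) (mass y (c + w y) - mass y c) = 0 ->
  (\int[nu]_(x in epigraph w c) (f x)%:E = \int[nu]_(x in halfspace c) (f x)%:E)%E.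
Proof.
move=> cw w0 hL; have mw : measurable_fun setT w by exact: continuous_measurable_rV (C1c_continuous cw).
have mE := measurable_epigraph c cw.
have mH : measurable (halfspace c : set 'rV[R]_n.+1).
  by rewrite -epigraph0; apply: measurable_epigraph; exact: C1c_cst0.
have iA (A : set 'rV[R]_n.+1) : measurable A -> nu.-integrable setT (EFin \o (fun x => f x * \1_A x)).
  move=> mA; apply: (integrable_dom measurableT _ _ fi).
    by apply: measurable_funM; [exact: lf.1|exact: measurable_indic].
  by move=> x; rewrite normrM ler_piMr// indicE; case: (_ \in _); rewrite ?normr1 ?normr0.
have AE (A : set 'rV[R]_n.+1) : (\int[nu]_(x in A) (f x)%:E = \int[nu]_x (f x * \1_A x)%:E)%E.
  rewrite integral_mkcond; apply: eq_integral => x _.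
  by rewrite patchE indicE; case: ifPn => _; rewrite ?mulr1 ?mulr0.
have iEH : nu.-integrable setT (EFin \o (fun x => f x * \1_(halfspace c) x - f x * \1_(epigraph w c) x)).
  by have := integrableB measurableT (iA _ mH) (iA _ mE).
have inner y : (\int[lam]_t (f (row_rcons y t) * \1_(halfspace c) (row_rcons y t) -
    f (row_rcons y t) * \1_(epigraph w c) (row_rcons y t))%:E = (mass y (c + w y) - mass y c)%:E)%E.
  have sl := slice_loc_continuous (@continuous_fline _ _ _ _ reg y).
  have ik t := slice_loc_cbfun sl (kap_cbfun t).
  have iB : lam.-integrable setT (EFin \o (fun s => fline y s * kap s (c + w y) - fline y s * kap s c)).
    by have := integrableB measurableT (ik (c + w y)) (ik c).
  have -> : mass y (c + w y) - mass y c = \int[lam]_s (fline y s * kap s (c + w y) - fline y s * kap s c).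
    by rewrite (RintegralB measurableT (ik _) (ik _)).
  rewrite /Rintegral fineK; last by apply: integrable_fin_num => //; exact: iB.
  apply: ae_eq_integral => //.
  - have := measurable_slice y (measurable_int _ iEH); exact.
  - exact: measurable_int iB.
  have n1 : lam.-negligible ([set c] `|` [set c + w y]).
    have h1 (z : R) : lam.-negligible [set z].
      exists [set z]; split; [exact: measurable_set1|exact: lebesgue_measure_set1|by []].
    by apply: negligibleU; exact: h1.
  apply: negligibleS n1 => t /= ht; apply: contrapT => tn; apply: ht => _.
  have tc : t != c by apply/eqP => h; apply: tn; left.
  have tw : t != c + w y by apply/eqP => h; apply: tn; right.
  congr EFin; rewrite -/(fline y t) -!mulrBr; congr (_ * _); rewrite /kap !indicE.
  have -> : (row_rcons y t \in halfspace c) = (c <= t).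
    by apply/idP/idP => [/set_mem|h]; rewrite ?/halfspace/= ?row_last_rcons//; apply: mem_set; rewrite /= row_last_rcons.
  have -> : (row_rcons y t \in epigraph w c) = (c + w y <= t).
    by apply/idP/idP => [/set_mem|h]; rewrite ?/epigraph/= ?row_last_rcons ?row_init_rcons//; apply: mem_set; rewrite /epigraph/= row_last_rcons row_init_rcons.
  case: (ltgtP t c) tc => // _ _; case: (ltgtP t (c + w y)) tw => // _ _; rewrite ?mulr0n ?mulr1n; ring.
have := leb_fubini1 iEH; rewrite /=.
under [in X in _ = X -> _]eq_integral => y _ do rewrite inner.
rewrite (_ : \int[mu]_y _ = \int[mu]_(y in box) (mass y (c + w y) - mass y c)%:E)%E; last first.
  rewrite [RHS]integral_mkcond; apply: eq_integral => y _; rewrite patchE.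
  by case: ifPn => // /negP yb; rewrite w0 ?addr0 ?subrr// => h; apply: yb; exact: mem_set.
move=> /(congr1 fine); rewrite -[X in _ = X]/(\int[mu]_(y in box) (mass y (c + w y) - mass y c)) hL.
rewrite -[X in X = _]/(\int[nu]_x (f x * \1_(halfspace c) x - f x * \1_(epigraph w c) x)).
rewrite (RintegralB measurableT (iA _ mH) (iA _ mE)) => /eqP; rewrite subr_eq0 => /eqP h.
rewrite !AE -[LHS]fineK; last by apply: integrable_fin_num => //; exact: iA.
rewrite -[RHS]fineK; last by apply: integrable_fin_num => //; exact: iA.
by congr EFin; symmetry; exact: h.
Qed.

Lemma big_nat_above (x : R) : exists2 N : nat, (0 < N)%N & x <= N%:R.
Proof. by exists (Num.truncn x).+1 => //; exact/ltW/truncnS_gt. Qed.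

Lemma mass_integrable (v : 'rV[R]_n -> R) (c r : R) : measurable_fun setT v -> (forall y, `|v y| <= r) ->
  mu.-integrable box (EFin \o (fun y => mass y (c + v y) - mass y c)).
Proof.
move=> mv vr; have [N N0 hN] := big_nat_above (`|c| + r).
apply: (@box_integrable _ _ _ _ N1 reg N r).
  apply: measurable_funB; apply: (measurable_mass reg); last exact: measurable_cst.
  exact: measurable_funD.
move=> y; apply: (@le_trans _ _ (`|v y| * bdom N y)).
  apply: prim_lip; first exact: continuous_fline reg y.
  move=> t tc; apply: fline_bdom => //; rewrite -(subrK c t) (le_trans (ler_normD _ _))//.
  by rewrite addrC (le_trans _ hN)// lerD2l (le_trans tc).
by apply: ler_wpM2r; [exact: (bdom_ge0 reg)|exact: vr].
Qed.

Definition volume_diff (v : 'rV[R]_n -> R) (c : R) : R :=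
  \int[mu]_(y in box) (mass y (c + v y) - mass y c).

Lemma volume_diff_approx (u : 'rV[R]_n -> R) (M s c : R) : measurable_fun setT u ->
  (forall y, `|u y| <= M) ->
  `|volume_diff (fun y => s * u y) c - s * mean u c| <= `|s| * M * mean_osc c (`|s| * M).
Proof.
move=> mu_ uM; set r := `|s| * M.
have sur y : `|s * u y| <= r by rewrite normrM ler_wpM2l.
have msu : measurable_fun setT (fun y => s * u y) by exact: measurable_funM.
have i1 := mass_integrable c msu sur.
have i2 := mean_integrable N1 reg c mu_ uM.
have i2s : mu.-integrable box (EFin \o (fun y => s * (u y * fline y c))).
  by have := integrableZl mb s i2; apply: eq_integrable.
have i3 : mu.-integrable box (EFin \o (fun y => tvar y (c + r) - tvar y (c - r))).
  by have := integrableB mb (integrable_tvar N1 reg _) (integrable_tvar N1 reg _); apply.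
have i12 : mu.-integrable box (EFin \o (fun y => mass y (c + s * u y) - mass y c - s * (u y * fline y c))).
  by have := integrableB mb i1 i2s.
rewrite -(RintegralZl s mb i2) -(RintegralB mb i1 i2s).
apply: (le_trans (le_normr_Rintegral mb i12)).
rewrite -(osc_integral N1 reg) -(RintegralZl r mb i3); apply: le_Rintegral => //.
- by have := integrable_abse i12.
- by have := integrableZl mb r i3; apply: eq_integrable.
move=> y _; rewrite mulrA; apply: (le_trans (mass_taylor reg y c (sur y))).
by rewrite ler_wpM2r// subr_ge0; apply: (tvar_mono reg); have := le_trans (normr_ge0 _) (sur y); lra.
Qed.

Lemma volume_diff_lip (u v : 'rV[R]_n -> R) (c r e : R) (N : nat) : measurable_fun setT u -> measurable_fun setT v ->
  (forall y, `|u y| <= r) -> (forall y, `|v y| <= r) -> (0 < N)%N -> `|c| + 3 * r <= N%:R ->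
  (forall y, `|u y - v y| <= e) ->
  `|volume_diff u c - volume_diff v c| <= e * \int[mu]_(y in box) bdom N y.
Proof.
move=> mu_ mv ur vr N0 hN uv.
have i1 := mass_integrable c mu_ ur; have i2 := mass_integrable c mv vr.
have i12 : mu.-integrable box (EFin \o (fun y => (mass y (c + u y) - mass y c) - (mass y (c + v y) - mass y c))).
  by have := integrableB mb i1 i2.
rewrite -(RintegralB mb i1 i2); apply: (le_trans (le_normr_Rintegral mb i12)).
have iN := integrable_bdom N1 reg N.
rewrite -(RintegralZl e mb iN); apply: le_Rintegral => //.
- by have := integrable_abse i12.
- by have := integrableZl mb e iN; apply: eq_integrable.
move=> y _; rewrite opprB addrA subrK.
have -> : c + u y = (c + v y) + (u y - v y) by ring.
apply: (@le_trans _ _ (`|u y - v y| * bdom N y)).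
  apply: prim_lip; first exact: continuous_fline reg y.
  move=> t tc; apply: fline_bdom => //; apply: le_trans hN.
  rewrite -(subrK (c + v y) t) (le_trans (ler_normD _ _))//.
  have h1 := ler_normB (u y) (v y); have h2 := ler_normD c (v y).
  by have := ur y; have := vr y; lra.
by apply: ler_wpM2r; [exact: (bdom_ge0 reg)|exact: uv].
Qed.

Lemma mean_lip (u : 'rV[R]_n -> R) (A s t : R) : measurable_fun setT u -> (forall y, `|u y| <= A) -> s <= t ->
  `|mean u t - mean u s| <= A * (total_var t - total_var s).
Proof.
move=> mu_ uA st; have A0 : 0 <= A by exact: le_trans (uA 0).
have i1 := mean_integrable N1 reg t mu_ uA; have i2 := mean_integrable N1 reg s mu_ uA.
have i12 : mu.-integrable box (EFin \o (fun y => u y * fline y t - u y * fline y s)).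
  by have := integrableB mb i1 i2.
have iT : mu.-integrable box (EFin \o (fun y => tvar y t - tvar y s)).
  by have := integrableB mb (integrable_tvar N1 reg t) (integrable_tvar N1 reg s).
rewrite -(RintegralB mb i1 i2); apply: (le_trans (le_normr_Rintegral mb i12)).
rewrite -(RintegralB mb (integrable_tvar N1 reg t) (integrable_tvar N1 reg s)) -(RintegralZl A mb iT).
apply: le_Rintegral => //.
- by have := integrable_abse i12.
- by have := integrableZl mb A iT; apply: eq_integrable.
by move=> y _; rewrite -mulrBr normrM ler_pM//; exact: fline_osc reg y _ _ st.
Qed.

Lemma mean_continuous (u : 'rV[R]_n -> R) (A : R) : measurable_fun setT u -> (forall y, `|u y| <= A) ->
  continuous (mean u).
Proof.
move=> mu_ uA c; have A0 : 0 <= A by exact: le_trans (uA 0).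
apply/(@cvgrPdist_le _ R _ (nbhs c)) => /= e e0.
have A1 : 0 < A + 1 by rewrite ltr_wpDl.
have e1 : 0 < e / (A + 1) by rewrite divr_gt0.
have [d d0 hd] := total_var_osc N1 reg c e1.
exists d => //= t /ltW; rewrite distrC ler_distl => /andP[t1 t2].
have m1 : total_var (c - d) <= total_var c by apply: (total_var_mono N1 reg); rewrite gerBl ltW.
have m2 : total_var c <= total_var (c + d) by apply: (total_var_mono N1 reg); rewrite lerDl ltW.
have m3 : total_var (c - d) <= total_var t by apply: (total_var_mono N1 reg).
have m4 : total_var t <= total_var (c + d) by apply: (total_var_mono N1 reg).
have key z : z <= e / (A + 1) -> A * z <= e.
  move=> hz; apply: (@le_trans _ _ (A * (e / (A + 1)))); first by rewrite ler_wpM2l.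
  by rewrite mulrA ler_pdivrMr// mulrC ler_wpM2l// ?(ltW e0)// lerDl.
have [ct|/ltW tc] := leP c t.
  rewrite distrC; apply: (le_trans (mean_lip mu_ uA ct)); apply: key.
  exact: ltW (le_lt_trans (lerB m4 m1) hd).
apply: (le_trans (mean_lip mu_ uA tc)); apply: key; exact: ltW (le_lt_trans (lerB m2 m3) hd).
Qed.

Section pair.
Variables (a b : 'rV[R]_n -> R) (A : R).
Hypotheses (ca : C1c a) (cb : C1c b).
Hypotheses (aA : forall y, `|a y| <= A) (bA : forall y, `|b y| <= A).

(** For k the ratio of the averages of a and b, moving in this direction preserves the mass to first order. *)
Definition tilt (k : R) y : R := a y - k * b y.

Let ma : measurable_fun setT a. Proof. exact: continuous_measurable_rV (C1c_continuous ca). Qed.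
Let mb' : measurable_fun setT b. Proof. exact: continuous_measurable_rV (C1c_continuous cb). Qed.
Let A0 : 0 <= A. Proof. by apply: le_trans (aA 0). Qed.

Lemma measurable_tilt k : measurable_fun setT (tilt k).
Proof. by apply: measurable_funB => //; exact: measurable_funM. Qed.

Lemma tilt_bound k y : `|tilt k y| <= A + `|k| * A.
Proof. by rewrite (le_trans (ler_normB _ _))// lerD// normrM ler_wpM2l. Qed.

Lemma mean_tilt k c : mean (tilt k) c = mean a c - k * mean b c.
Proof.
have ia := mean_integrable N1 reg c ma aA; have ib := mean_integrable N1 reg c mb' bA.
have ikb : mu.-integrable box (EFin \o (fun y => k * (b y * fline y c))).
  by have := integrableZl mb k ib; apply: eq_integrable.
rewrite -(RintegralZl k mb ib) -(RintegralB mb ia ikb).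
by apply: eq_Rintegral => y _; rewrite /tilt; ring.
Qed.

Lemma volume_tilt_continuous s c : continuous (fun k => volume_diff (fun y => s * tilt k y) c).
Proof.
move=> k0; pose r := `|s| * (A + (`|k0| + 1) * A).
have [N N0 hN] := big_nat_above (`|c| + 3 * r).
set D := \int[mu]_(y in box) bdom N y.
have D0 : 0 <= D by apply: Rintegral_ge0 => y _; exact: (bdom_ge0 reg).
apply/(@cvgrPdist_le _ R _ (nbhs k0)) => /= e e0.
have C0 : 0 <= `|s| * A * D by rewrite !mulr_ge0.
near=> k.
have kk1 : `|k0 - k| <= 1.
  by near: k; exists 1 => //= z /= /ltW.
have kke : `|k0 - k| <= e / (`|s| * A * D + 1).
  by near: k; exists (e / (`|s| * A * D + 1)) => /=; [rewrite divr_gt0// ltr_wpDl|move=> z /= /ltW].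
have tb k' y : `|k0 - k'| <= 1 -> `|s * tilt k' y| <= r.
  move=> hk; rewrite normrM ler_wpM2l// (le_trans (tilt_bound _ _))// lerD2l ler_wpM2r//.
  by rewrite -lerBlDl (le_trans (lerB_dist _ _))// distrC.
have msu k' : measurable_fun setT (fun y => s * tilt k' y) by apply: measurable_funM => //; exact: measurable_tilt.
have k00 : `|k0 - k0| <= 1 by rewrite subrr normr0.
have uv y : `|s * tilt k0 y - s * tilt k y| <= `|s| * A * `|k0 - k|.
  rewrite -mulrBr /tilt (_ : a y - k0 * b y - (a y - k * b y) = - ((k0 - k) * b y)); last by ring.
  by rewrite normrM normrN normrM -mulrA ler_wpM2l// mulrC ler_wpM2r.
apply: (le_trans (volume_diff_lip (msu k0) (msu k) (fun y => tb k0 y k00) (fun y => tb k y kk1) N0 hN uv)).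
rewrite -/D mulrAC; apply: (@le_trans _ _ ((`|s| * A * D) * (e / (`|s| * A * D + 1)))).
  by rewrite ler_wpM2l.
rewrite mulrA ler_pdivrMr ?ltr_wpDl// mulrDr mulr1 mulrC lerDl; exact: ltW.
Unshelve. all: by end_near.
Qed.

(** The change of mass divided by s is mean a c - k * mean b c up to a small error.  By the
    hypothesis it has opposite signs at k = k0 - rho and k = k0 + rho, and it is continuous in k. *)
Lemma tilt_exists (k0 rho c s M : R) : s != 0 -> 0 < rho ->
  (forall k, `|k - k0| <= rho -> forall y, `|tilt k y| <= M) ->
  `|mean a c - k0 * mean b c| + M * mean_osc c (`|s| * M) < rho * mean b c ->
  exists2 k, `|k - k0| <= rho & volume_diff (fun y => s * tilt k y) c = 0.
Proof.
move=> s0 r0 tM h; pose Th k := volume_diff (fun y => s * tilt k y) c / s.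
have ThE k : `|k - k0| <= rho -> `|Th k - (mean a c - k * mean b c)| <= M * mean_osc c (`|s| * M).
  move=> hk; have := volume_diff_approx s c (measurable_tilt k) (tM k hk).
  rewrite mean_tilt => h'; have sp : 0 < `|s| by rewrite normr_gt0.
  rewrite -(ler_pM2l sp) mulrA -normrM mulrBr /Th (mulrCA s) divff// mulr1.
  exact: h'.
have cT : continuous Th.
  move=> k; apply: (@continuousM _ _ (fun k => volume_diff (fun y => s * tilt k y) c) (cst s^-1)).
    exact: volume_tilt_continuous.
  exact: cst_continuous.
have h1 : `|k0 - rho - k0| <= rho by rewrite addrAC subrr sub0r normrN gtr0_norm.
have h2 : `|k0 + rho - k0| <= rho by rewrite addrAC subrr add0r gtr0_norm.
have p1 : 0 < Th (k0 - rho).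
  apply: (near_pos h); have := ThE _ h1.
  by rewrite (_ : mean a c - (k0 - rho) * mean b c = mean a c - k0 * mean b c + rho * mean b c)//; ring.
have p2 : Th (k0 + rho) < 0.
  apply: (near_neg h); have := ThE _ h2.
  by rewrite (_ : mean a c - (k0 + rho) * mean b c = mean a c - k0 * mean b c - rho * mean b c)//; ring.
have [|||k kI Tk0] := @IVT R Th (k0 - rho) (k0 + rho) 0.
- by rewrite lerD2l (le_trans _ (ltW r0))// oppr_le0 ltW.
- exact: continuous_subspaceT.
- clearbody Th; move: (Th (k0 - rho)) (Th (k0 + rho)) p1 p2 => z1 z2 p1 p2.
  by apply/andP; split; [rewrite ge_min (ltW p2) orbT|rewrite le_max (ltW p1)].
exists k.
  by move: kI; rewrite in_itv/= ler_distl.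
by move/eqP: Tk0; rewrite mulf_eq0 invr_eq0 (negbTE s0) orbF => /eqP.
Qed.

Hypothesis aS : forall y, ~ box y -> a y = 0 /\ forall j, partial j a y = 0.
Hypothesis bS : forall y, ~ box y -> b y = 0 /\ forall j, partial j b y = 0.
Hypothesis gaA : forall j y, `|partial j a y| <= A.
Hypothesis gbA : forall j y, `|partial j b y| <= A.

Lemma C1c_tilt s k : C1c (fun y => s * tilt k y) /\
  forall j y, partial j (fun y => s * tilt k y) y = s * (partial j a y - k * partial j b y).
Proof.
have hd j y : is_derive y (delta_mx ord0 j) (fun y => s * tilt k y) (s * (partial j a y - k * partial j b y)).
  apply: is_deriveZ; apply: is_deriveB; first exact: C1c_is_derive.
  by apply: is_deriveZ; exact: C1c_is_derive.
split; last by move=> j y; rewrite /partial; apply: derive_val.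
apply: (C1cI hd (K := box)) => [j y| |y].
- apply: (@continuousM _ _ (cst s) (fun y => partial j a y - k * partial j b y)); first exact: cst_continuous.
  apply: (@continuousB _ _ _ (partial j a) (fun y => k * partial j b y)); first by case: ca => _ h _; exact: h.
  apply: (@continuousM _ _ (cst k) (partial j b)); first exact: cst_continuous.
  by case: cb => _ h _; exact: h.
- exact: cbox_compact.
apply: contra_neqP => /[dup] /aS[h1 _] /bS[h2 _].
by rewrite /tilt h1 h2 mulr0 subrr mulr0.
Qed.

Lemma ae_slice_finite : {ae lam, forall c, (\int[mu]_y (fline y c)%:E < +oo)%E}.
Proof.
have mfE := measurable_int _ fi.
have H : {ae lam, forall c : R, mu.-integrable setT (fun y => ((EFin \o f) \o rc) (y, c))}.
  exact: ae_integrable2 ((leb_integrable_rc mfE).1 fi).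
have := H; apply: filterS; first exact: (ae_filter_ringOfSetsType lam).
move=> c /integrableP[_]; apply: le_lt_trans; rewrite le_eqVlt; apply/orP; left; apply/eqP.
by apply: eq_integral => y _; rewrite gee0_abs// lee_fin.
Qed.

(** At the height c the competitor is given by the k of [tilt_exists], which depends on c without
    any regularity.  Since |k - k0| <= rho, replacing k by k0 moves the graph by at most
    |s| rho A, which costs the variation of f over such a segment. *)
Lemma ratio_step (k0 rho c0 c1 s M K r : R) (N : nat) : s != 0 -> 0 < rho -> c0 <= c1 ->
  (forall k, `|k - k0| <= rho -> `|k| <= K) -> M = A + K * A -> r = `|s| * M + `|s| * rho * A ->
  (0 < N)%N -> `|c0| + r <= N%:R -> `|c1| + r <= N%:R ->
  (forall c, c0 <= c <= c1 ->
    `|mean a c - k0 * mean b c| + M * mean_osc c (`|s| * M) < rho * mean b c) ->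
  0 <= s * (mean (tilt k0) c1 - mean (tilt k0) c0) +
    `|s| * M * (mean_osc c1 r + mean_osc c0 r) +
    2 * (`|s| * rho * A) * (total_var (c1 + r) - total_var (c0 - r)) +
    (c1 - c0) * (s ^+ 2 * (n%:R * M ^+ 2)) * \int[mu]_(y in box) bdom N y.
Proof.
move=> s0 r0 c01 kK ME rE N0 c0N c1N h.
have k0K : `|k0| <= K by apply: kK; rewrite subrr normr0 ltW.
have K0 : 0 <= K by apply: le_trans k0K.
have M0 : 0 <= M by rewrite ME addr_ge0// mulr_ge0.
have tM k : `|k - k0| <= rho -> forall y, `|tilt k y| <= M.
  by move=> hk y; rewrite (le_trans (tilt_bound _ _))// ME lerD2l ler_wpM2r// kK.
have tM0 : forall y, `|tilt k0 y| <= M by apply: tM; rewrite subrr normr0 ltW.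
have d0 : 0 <= `|s| * rho * A by rewrite !mulr_ge0// ltW.
have L0 : 0 <= s ^+ 2 * (n%:R * M ^+ 2).
  by apply: mulr_ge0; [exact: sqr_ge0|apply: mulr_ge0 => //; exact: sqr_ge0].
apply: (integrated_variation reg (measurable_tilt k0) tM0 d0 L0 c01 rE N0 c0N c1N).
have := ae_slice_finite; apply: filterS; first exact: (ae_filter_ringOfSetsType lam).
move=> c fin cI; have [k kk0 vol] := tilt_exists s0 r0 tM (h c cI).
pose w y := s * tilt k y.
have [cw dw] := C1c_tilt s k.
have wS y : ~ box y -> w y = 0 /\ grad_sq w y = 0.
  move=> yb; have [a1 a2] := aS yb; have [b1 b2] := bS yb.
  rewrite /w /tilt a1 b1 mulr0 subrr mulr0; split=> //.
  by rewrite /grad_sq big1// => j _; rewrite dw a2 b2 mulr0 subrr mulr0 expr0n.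
have gL y : grad_sq w y / 2 <= s ^+ 2 * (n%:R * M ^+ 2).
  have hj j : partial j w y ^+ 2 <= s ^+ 2 * M ^+ 2.
    rewrite dw exprMn ler_wpM2l ?sqr_ge0//.
    rewrite -[X in X <= _]real_normK ?num_real// lerXn2r ?nnegrE//.
    rewrite ME (le_trans (ler_normB _ _))// lerD// normrM ler_pM//; exact: kK.
  have : grad_sq w y <= n%:R * (s ^+ 2 * M ^+ 2).
    rewrite /grad_sq (le_trans (ler_sum _ (fun j _ => hj j)))//.
    by rewrite sumr_const card_ord -[leLHS]mulr_natl lexx.
  have g0 : 0 <= grad_sq w y by apply: sumr_ge0 => j _; exact: sqr_ge0.
  by rewrite mulrCA; move: (n%:R * _) => z; lra.
have cN v : `|v| <= r -> `|c + v| <= N%:R.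
  move: cI => /andP[h1 h2]; rewrite !ler_norml => /andP[v1 v2].
  have := ler_norm c1; have := ler_norm (- c0); rewrite normrN => n1 n2.
  by apply/andP; split; lra.
have wr y : `|w y| <= r.
  by rewrite normrM rE -[leLHS]addr0 lerD// ler_wpM2l// tM.
have fine0 : 0 <= r by apply: le_trans (wr 0).
have cN0 : `|c| <= N%:R by rewrite -[c]addr0; apply: cN; rewrite normr0.
have mw : measurable_fun setT w by apply: measurable_funM => //; exact: measurable_tilt.
have mu0 : measurable_fun setT (fun y => s * tilt k0 y) by apply: measurable_funM => //; exact: measurable_tilt.
have wS0 y : ~ box y -> w y = 0 by move=> /wS[].
apply: (le_trans (graph_inequality cw wS gL N0 (fun y => cN _ (wr y)) cN0 (volume_eq cw wS0 vol) fin)).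
set d := `|s| * rho * A in d0 rE *; set B := s ^+ 2 * _ in L0 gL *.
have su0 y : `|s * tilt k0 y| + d <= r by rewrite rE lerD2r normrM ler_wpM2l// tM0.
have near0 y : `|s * tilt k0 y| <= r by rewrite (le_trans _ (su0 y))// lerDl.
have vdr y : `|s * tilt k0 y + d| <= r /\ `|s * tilt k0 y - d| <= r.
  have h1 := ler_normD (s * tilt k0 y) d; have h2 := ler_normB (s * tilt k0 y) d.
  rewrite (ger0_norm d0) in h1 h2; have := su0 y; lra.
have cv v : measurable_fun setT v -> measurable_fun setT (fun y => c + v y).
  by move=> mv; exact: measurable_funD.
have ib (v : 'rV[R]_n -> R) : measurable_fun setT v -> (forall y, `|v y| <= r) ->
    mu.-integrable box (EFin \o (fun y => fline y (c + v y))).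
  move=> mv vr; apply: (@box_integrable _ _ _ _ N1 reg N 1).
    by apply: (measurable_fline reg); exact: cv.
  by move=> y; rewrite mul1r; apply: fline_bdom => //; exact: cN.
have ic : mu.-integrable box (EFin \o (fun y => fline y c)).
  apply: (@box_integrable _ _ _ _ N1 reg N 1).
    by apply: (measurable_fline reg); exact: measurable_cst.
  by move=> y; rewrite mul1r; exact: fline_bdom.
have iB : mu.-integrable box (EFin \o (fun y => B * bdom N y)).
  by have := integrableZl mb B (integrable_bdom N1 reg N); apply: eq_integrable.
have it : mu.-integrable box (EFin \o (fun y => tvar y (c + (s * tilt k0 y + d)) - tvar y (c + (s * tilt k0 y - d)))).
  apply: (@box_integrable _ _ _ _ N1 reg N 1).
    apply: measurable_funB; apply: (measurable_tvar reg); apply: cv.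
      exact: measurable_funD.
    exact: measurable_funB.
  by move=> y; have [h1 h2] := vdr y; rewrite mul1r; apply: tvar_bdom => //; exact: cN.
apply: le_Rintegral => //.
- by have := integrableD mb (integrableB mb (ib w mw wr) ic) iB.
- by have := integrableD mb (integrableD mb (integrableB mb (ib _ mu0 near0) ic) it) iB.
move=> y _; rewrite lerD2r.
have : `|(c + w y) - (c + s * tilt k0 y)| <= d.
  rewrite (_ : _ - _ = - (s * ((k - k0) * b y))); last by rewrite /w /tilt; ring.
  by rewrite normrN !normrM /d -mulrA ler_wpM2l// ler_pM.
move=> /(fline_near reg y); rewrite -!addrA ler_norml => /andP[_].
by move: (fline y _) (fline y _) (tvar y _) (tvar y _) => z1 z2 z3 z4; lra.
Qed.

(** [ratio_step] for s and for -s, divided by |s|: as s tends to 0 the oscillation terms and the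
    quadratic term vanish. *)
Lemma ratio_bound (k0 rho m c0 c1 p0 : R) : c0 <= c1 -> 0 <= m -> m < rho -> 0 < p0 ->
  (forall c, c0 <= c <= c1 -> p0 <= mean b c /\ `|mean a c - k0 * mean b c| <= m * mean b c) ->
  `|mean (tilt k0) c1 - mean (tilt k0) c0| <= 2 * rho * A * (total_var c1 - total_var c0).
Proof.
move=> c01 m0 mr p00 hc; apply/ler_addgt0Pr => e e0.
have r0 : 0 < rho by apply: le_lt_trans mr.
pose K := `|k0| + rho; pose M := A + K * A; pose T := M + rho * A + 1.
have K0 : 0 <= K by rewrite addr_ge0// ltW.
have M0 : 0 <= M by rewrite addr_ge0// mulr_ge0.
have rA0 : 0 <= rho * A by rewrite mulr_ge0// ltW.
have T0 : 0 < T by rewrite /T; lra.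
have kK k : `|k - k0| <= rho -> `|k| <= K.
  by move=> hk; rewrite -lerBlDl (le_trans (lerB_dist _ _)).
(* the first bound keeps the mass constraint solvable, the second one absorbs the oscillations into e *)
pose eta := Num.min ((rho - m) * p0 / (M + 1)) (e / (8 * T)).
have eta0 : 0 < eta by rewrite lt_min !divr_gt0 ?mulr_gt0 ?subr_gt0//; lra.
have eta1 : M * eta < (rho - m) * p0.
  have h : 0 < (rho - m) * p0 by rewrite mulr_gt0// subr_gt0.
  apply: (@le_lt_trans _ _ (M * ((rho - m) * p0 / (M + 1)))).
    by rewrite ler_wpM2l// ge_min lexx.
  rewrite mulrA ltr_pdivrMr; last by lra.
  by rewrite mulrDr mulr1 mulrC ltrDl.
have eta2 : 8 * T * eta <= e.
  by rewrite mulrC -ler_pdivlMr ?mulr_gt0// ge_min lexx orbT.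
have [d d0 hd] := total_var_unif N1 reg c0 c1 eta0.
have [N N0 hN] := big_nat_above (`|c0| + `|c1| + 1).
set D := \int[mu]_(y in box) bdom N y.
have D0 : 0 <= D by apply: Rintegral_ge0 => y _; exact: (bdom_ge0 reg).
pose B := (c1 - c0) * (n%:R * M ^+ 2) * D.
have B0 : 0 <= B by rewrite !mulr_ge0 ?subr_ge0// sqr_ge0.
pose s := Num.min (d / T) (Num.min (T^-1) (e / (2 * (B + 1)))).
have B1 : 0 < B + 1 by lra.
have s0 : 0 < s by rewrite !lt_min divr_gt0//= invr_gt0 T0/= divr_gt0// mulr_gt0.
have sT : s * T <= d by rewrite -ler_pdivlMr// ge_min lexx.
have s1 : s * T <= 1 by rewrite -ler_pdivlMr// div1r !ge_min lexx !orbT.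
have sB : s * (2 * (B + 1)) <= e by rewrite -ler_pdivlMr ?mulr_gt0// !ge_min lexx !orbT.
pose r := s * M + s * rho * A.
have rT : r <= s * T by rewrite /r /T -mulrA !mulrDr mulr1; lra.
have r00 : 0 <= r by rewrite addr_ge0// ?mulr_ge0// ltW.
have c00 : c0 <= c0 <= c1 by rewrite lexx.
have c11 : c0 <= c1 <= c1 by rewrite lexx andbT.
have rd : r <= d by apply: le_trans rT sT.
have r1 : r <= 1 by apply: le_trans rT s1.
have step z : `|z| = s ->
  0 <= z * (mean (tilt k0) c1 - mean (tilt k0) c0) +
    s * M * (mean_osc c1 r + mean_osc c0 r) +
    2 * (s * rho * A) * (total_var (c1 + r) - total_var (c0 - r)) + s ^+ 2 * B.
  move=> zs; have z0 : z != 0 by rewrite -normr_gt0 zs.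
  have := @ratio_step k0 rho c0 c1 z M K r N z0 r0 c01 kK erefl.
  rewrite zs -/D => /(_ erefl N0).
  rewrite (_ : (c1 - c0) * (z ^+ 2 * (n%:R * M ^+ 2)) * D = s ^+ 2 * B); last first.
    by rewrite /B -zs real_normK ?num_real//; ring.
  have N1_ : `|c1| + r <= N%:R.
    by apply: le_trans hN; rewrite lerD//; rewrite lerDr.
  have N0_ : `|c0| + r <= N%:R.
    by apply: le_trans hN; rewrite lerD//; rewrite lerDl.
  apply => //; move=> c cI; have [p1 p2] := hc c cI.
  have sM0 : 0 <= s * M by rewrite mulr_ge0// ltW.
  have sMr : s * M <= d by apply: le_trans rd; rewrite lerDl !mulr_ge0// ltW.
  have o1 := hd c _ cI sM0 sMr; rewrite -/(mean_osc c (s * M)) in o1.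
  apply: (@le_lt_trans _ _ (m * mean b c + M * eta)); first by rewrite lerD// ler_wpM2l// ltW.
  rewrite -ltrBrDl -mulrBl; apply: (lt_le_trans eta1).
  by rewrite ler_wpM2l// subr_ge0 ltW.
have o1 : mean_osc c1 r < eta := hd c1 _ c11 r00 rd.
have o0 : mean_osc c0 r < eta := hd c0 _ c00 r00 rd.
have q1 : total_var (c1 + r) - total_var (c0 - r) <= total_var c1 - total_var c0 + 2 * eta.
  have := total_var_mono N1 reg (_ : c1 - r <= c1); have := total_var_mono N1 reg (_ : c0 <= c0 + r).
  rewrite lerDl gerBl r00 => /(_ isT) h1 /(_ isT) h2.
  exact: osc_telescope o1 o0 h2 h1.
pose X := mean (tilt k0) c1 - mean (tilt k0) c0.
have fin z : `|z| = s -> - (z * X) <= s * (2 * rho * A * (total_var c1 - total_var c0) + e).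
  move=> /step; rewrite -/X => h; exact: step_absorb s0 M0 rA0 erefl eta0 eta2 B0 sB o1 o0 q1 h.
have f1 := fin s (gtr0_norm s0).
have f2 : s * X <= s * (2 * rho * A * (total_var c1 - total_var c0) + e).
  by have := fin (- s); rewrite normrN gtr0_norm// => /(_ erefl); rewrite mulNr opprK.
rewrite -/X ler_norml; apply/andP; split; last by rewrite -(ler_pM2l s0).
by rewrite -(ler_pM2l s0) mulrN lerNl.
Qed.

Definition mean_ratio c := mean a c / mean b c.

(** [ratio_bound] with k0 the value of the ratio at x and rho = 2 m bounds
    mean b y * |ratio y - ratio x| by 4 m A times the variation, hence by m p0 / 2. *)
Lemma ratio_halve (x0 x1 p0 m : R) : 0 < p0 -> (forall c, x0 <= c <= x1 -> p0 <= mean b c) ->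
  8 * (A * (total_var x1 - total_var x0)) <= p0 ->
  (forall x y : R, x0 <= x -> x <= y -> y <= x1 -> `|mean_ratio y - mean_ratio x| <= m) ->
  forall x y : R, x0 <= x -> x <= y -> y <= x1 -> `|mean_ratio y - mean_ratio x| <= m / 2.
Proof.
move=> p00 hp ht hm' x y x0x xy yx1.
have bp c : x0 <= c <= x1 -> 0 < mean b c by move=> /hp; exact: lt_le_trans.
have xI : x0 <= x <= x1 by rewrite x0x (le_trans xy).
have yI : x0 <= y <= x1 by rewrite yx1 andbT (le_trans x0x).
have m0 : 0 <= m by apply: le_trans (normr_ge0 _) (hm' _ _ x0x xy yx1).
move: m0; rewrite le_eqVlt => /orP[/eqP m0|m0].
  by have := hm' _ _ x0x xy yx1; rewrite -m0 mul0r.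
have m2 : m < 2 * m by rewrite mulr2n mulrDl mul1r ltrDl.
have hc c : x <= c <= y -> p0 <= mean b c /\ `|mean a c - mean_ratio x * mean b c| <= m * mean b c.
  move=> /andP[xc cy]; have cI : x0 <= c <= x1 by rewrite (le_trans x0x)// (le_trans cy).
  split; first exact: hp.
  rewrite (_ : _ - _ = (mean_ratio c - mean_ratio x) * mean b c); last first.
    by rewrite mulrBl {3}/mean_ratio divfK// gt_eqF// bp.
  rewrite normrM (gtr0_norm (bp _ cI)) ler_wpM2r ?(ltW (bp _ cI))//.
  by apply: hm' => //; exact: le_trans yx1.
have := ratio_bound xy (ltW m0) m2 p00 hc; rewrite !mean_tilt.
rewrite (_ : mean a x - _ = 0); last by rewrite divfK ?subrr// gt_eqF// bp.
rewrite subr0 (_ : mean a y - _ = (mean_ratio y - mean_ratio x) * mean b y); last first.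
  by rewrite mulrBl {2}/mean_ratio divfK// gt_eqF// bp.
rewrite normrM (gtr0_norm (bp _ yI)) => h.
rewrite -(ler_pM2r p00); apply: (@le_trans _ _ (`|mean_ratio y - mean_ratio x| * mean b y)).
  by rewrite ler_wpM2l// hp.
apply: (le_trans h).
have t1 : A * (total_var y - total_var x) <= A * (total_var x1 - total_var x0).
  apply: ler_wpM2l => //; apply: lerB; exact: (total_var_mono N1 reg).
have : 4 * m * (A * (total_var y - total_var x)) <= 4 * m * (p0 / 8).
  rewrite ler_wpM2l//; first by rewrite mulr_ge0// ltW.
  by apply: (le_trans t1); rewrite ler_pdivlMr// mulrC.
rewrite (_ : 4 * m * (p0 / 8) = m / 2 * p0); last by field.
by apply: le_trans; rewrite le_eqVlt; apply/orP; left; apply/eqP; ring.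
Qed.

(** The ratio is bounded, and [ratio_halve] applies again and again. *)
Lemma ratio_const_short (x0 x1 p0 : R) : x0 <= x1 -> 0 < p0 ->
  (forall c, x0 <= c <= x1 -> p0 <= mean b c) ->
  8 * (A * (total_var x1 - total_var x0)) <= p0 -> mean_ratio x1 = mean_ratio x0.
Proof.
move=> x01 p00 hp ht; pose L := `|mean a x0| + A * (total_var x1 - total_var x0).
have rb (x : R) : x0 <= x -> x <= x1 -> `|mean_ratio x| <= L / p0.
  move=> x0x xx1; have bx : p0 <= mean b x by apply: hp; rewrite x0x.
  have bx0 : 0 < mean b x by exact: lt_le_trans bx.
  rewrite normrM normfV (gtr0_norm bx0) ler_pM ?invr_ge0 ?(ltW bx0)//; last first.
    by rewrite lef_pV2.
  rewrite -[mean a x](subrK (mean a x0)) addrC (le_trans (ler_normD _ _))// lerD//.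
  apply: (le_trans (mean_lip ma aA x0x)).
  apply: ler_wpM2l => //; apply: lerB (lexx _); exact: (total_var_mono N1 reg).
have hk k (x y : R) : x0 <= x -> x <= y -> y <= x1 -> `|mean_ratio y - mean_ratio x| <= (2 * (L / p0)) * 2^-1 ^+ k.
  elim: k x y => [|k IH] x y h1 h2 h3.
    rewrite expr0 mulr1 (le_trans (ler_normB _ _))// mulr2n mulrDl mul1r lerD// rb//.
      exact: le_trans h2.
    exact: le_trans h3.
  by rewrite exprSr (mulrA (2 * (L / p0))); exact: (ratio_halve p00 hp ht IH h1 h2 h3).
clear rb; apply/eqP; rewrite -subr_eq0 -normr_eq0 eq_le normr_ge0 andbT.
have c0 : (2 * (L / p0)) * 2^-1 ^+ k @[k --> \oo] --> (2 * (L / p0)) * 0.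
  by apply: cvgM; [exact: cvg_cst|apply: cvg_expr; rewrite ger0_norm ?invr_ge0// invf_lt1// ltr1n].
rewrite mulr0 in c0; rewrite -(cvg_lim _ c0)//.
apply: limr_ge; first by apply/cvg_ex; eexists; exact: c0.
by apply: nearW => k; exact: hk.
Qed.

(** The variation is uniformly continuous, so the interval is a union of finitely many intervals to
    which [ratio_const_short] applies. *)
Lemma ratio_const (x0 x1 : R) : x0 <= x1 -> (forall c, x0 <= c <= x1 -> 0 < mean b c) ->
  mean_ratio x1 = mean_ratio x0.
Proof.
move=> x01 hb.
have [c cI hc] : exists2 c, c \in `[x0, x1] & forall t, t \in `[x0, x1] -> mean b c <= mean b t.
  apply: EVT_min => //; apply: continuous_subspaceT; exact: mean_continuous mb' bA.
pose p0 := mean b c.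
have p00 : 0 < p0 by apply: hb; move: cI; rewrite in_itv.
have hp t : x0 <= t <= x1 -> p0 <= mean b t by move=> tI; apply: hc; rewrite in_itv.
have A8 : 0 < 8 * (A + 1) by rewrite mulr_gt0// ltr_wpDl.
have [d d0 hd] := total_var_unif N1 reg x0 x1 (divr_gt0 p00 A8).
have step (x y : R) : x0 <= x -> x <= y -> y <= x1 -> y - x <= d -> mean_ratio y = mean_ratio x.
  move=> x0x xy yx1 yxd; apply: (ratio_const_short xy p00) => [t /andP[t1 t2]|].
    by apply: hp; rewrite (le_trans x0x)// (le_trans t2).
  have xI : x0 <= x <= x1 by rewrite x0x (le_trans xy).
  have m1 : total_var y - total_var x <= p0 / (8 * (A + 1)).
    apply: (le_trans _ (ltW (hd x d xI (ltW d0) (lexx _)))); apply: lerB; apply: (total_var_mono N1 reg).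
      by rewrite -lerBlDl.
    by rewrite gerBl ltW.
  rewrite mulrA; apply: (@le_trans _ _ (8 * A * (p0 / (8 * (A + 1))))).
    by rewrite ler_wpM2l// mulr_ge0.
  rewrite mulrA ler_pdivrMr// mulrC ler_wpM2l ?(ltW p00)// ler_wpM2l//.
  by rewrite lerDl.
suff H k (x : R) : x0 <= x <= x1 -> x <= x0 + k%:R * d -> mean_ratio x = mean_ratio x0.
  have [k k0 hk] := big_nat_above ((x1 - x0) / d).
  by apply: (H k); rewrite ?x01 ?lexx// -lerBlDl -ler_pdivrMr.
elim: k x => [|k IH] x /andP[x0x xx1].
  by rewrite mul0r addr0 => xx0; congr mean_ratio; apply/eqP; rewrite eq_le xx0.
move=> hx; have [h|/ltW h] := leP (x - d) x0.
  by apply: step => //; rewrite lerBlDl -lerBlDr.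
have xd : x - d <= x by rewrite gerBl ltW.
rewrite (step (x - d) x h xd xx1); last by rewrite opprB addrC subrK.
apply: IH; first by rewrite h (le_trans xd).
by move: hx; rewrite -natr1 mulrDl mul1r lerBlDr -addrA.
Qed.

End pair.

End ratio.

(** * Averages of slices *)

Section slice_mean.
Context {R : realType} {n : nat}.
Implicit Types (u : 'rV[R]_n.+1 -> R) (y : 'rV[R]_n) (a : 'rV[R]_n -> R) (t : R).
Local Notation lam := (@lebesgue_measure R).
Local Notation mu := (@leb R n).
Local Notation nu := (@leb R n.+1).

Definition slice_mean u a t : R := \int[mu]_y (u (row_rcons y t) * a y).

Lemma measurable_slice_mean u a : measurable_fun setT u -> measurable_fun setT a ->
  measurable_fun setT (slice_mean u a : measurableTypeR R -> R).
Proof.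
move=> mu_ ma.
pose q (p : measurableTypeR R * 'rV[R]_n) : R := u (row_rcons p.2 p.1) * a p.2.
have mq : measurable_fun setT q.
  apply: measurable_funM; last exact: measurableT_comp ma measurable_snd.
  apply: (measurableT_comp (f := u \o rc) (g := fun p : measurableTypeR R * 'rV[R]_n => (p.2, p.1))).
    exact: measurable_comp_rc.
  by apply/measurable_fun_pairP; split; [exact: measurable_snd|exact: measurable_fst].
by have := measurable_Rint_param mu mq.
Qed.

Lemma slice_mean_integrable u a (psi : R -> R) : L1loc u -> cbfunV a -> cbfun psi ->
  (mu \x lam)%E.-integrable setT (EFin \o (fun p => u (row_rcons p.1 p.2) * (a p.1 * psi p.2))).
Proof.
move=> lu ca cpsi; have iT := L1loc_cbfunV lu (cbfun_tensor ca cpsi).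
have := (leb_integrable_rc (measurable_int _ iT)).1 iT; apply: eq_integrable => // -[y t] _ /=.
by rewrite /tensor row_init_rcons row_last_rcons.
Qed.

Lemma slice_mean_locally_integrable u a (D : set R) : L1loc u -> cbfunV a -> open D ->
  locally_integrable D (slice_mean u a).
Proof.
move=> lu ca oD; have mG := measurable_slice_mean lu.1 ca.1.
split => //; first exact: measurable_funTS.
move=> K KD cK; have [N KN] : exists N : nat, K `<=` `[- N%:R, N%:R]%classic.
  have [M [_ hM]] := compact_bounded cK.
  exists (Num.truncn (`|M| + 1)).+1 => t Kt; rewrite /= in_itv/= -ler_norml.
  apply: le_trans (hM (`|M| + 1) _ t Kt) _; first by rewrite ltr_pwDr// ler_norm.
  by apply/ltW/truncnS_gt.
have mK : measurable K by exact: compact_measurable.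
have iH := slice_mean_integrable lu ca (itv_indic_cbfun (- N%:R) N%:R).
have mH := measurable_int _ iH; move: (iH) => /(integrable21ltyP _ _ mH).
apply: le_lt_trans; rewrite integral_mkcond; apply: ge0_le_integral => //.
- by move=> t _; rewrite patchE; case: ifP.
- apply: (measurable_restrictT _ mK).1; apply/measurable_EFinP.
  by apply: measurable_funTS; exact: measurableT_comp.
- have mA := measurableT_comp (@abse_measurable R setT) mH.
  have H := measurable_fun_fubini_tonelli_G (m1 := mu) _ mA.
  by apply: H => p; exact: abse_ge0.
move=> t _; rewrite patchE; case: ifPn => [/set_mem Kt|_]; last exact: integral_ge0.
rewrite /slice_mean /Rintegral.
have ms : measurable_fun setT (fun y => u (row_rcons y t) * a y).
  by apply: measurable_funM; [exact: measurable_slice_last lu.1|exact: ca.1].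
have := le_abse_integral mu measurableT ((measurable_EFinP _ _).2 ms).
move=> le1; apply: (le_trans _ (le_trans le1 _)).
  by case: (\int[_]_x _)%E => //= *; rewrite normr0 leey.
rewrite le_eqVlt; apply/orP; left; apply/eqP; apply: eq_integral => y _ /=.
by rewrite indicE (mem_set (KN _ Kt)) mulr1.
Qed.

Lemma slice_mean_fubini u a (psi : R -> R) : L1loc u -> cbfunV a -> cbfun psi ->
  (\int[nu]_x (u x * tensor a psi x)%:E = \int[lam]_t (slice_mean u a t * psi t)%:E)%E.
Proof.
move=> lu ca cpsi; have iT := L1loc_cbfunV lu (cbfun_tensor ca cpsi).
have iH := slice_mean_integrable lu ca cpsi.
rewrite leb_fubini2//; apply: ae_eq_integral => //.
- have := measurable_fubini_G iH; apply: eq_measurable_fun => t _; apply: eq_integral => y _ /=.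
  by rewrite /tensor row_init_rcons row_last_rcons.
- apply/measurable_EFinP; apply: measurable_funM; last by case: cpsi.
  exact: measurable_slice_mean lu.1 ca.1.
apply: filterS (ae_integrable2 iH) => t /= it _.
under eq_integral => y _ do rewrite /tensor row_init_rcons row_last_rcons.
have -> : slice_mean u a t * psi t = \int[mu]_y (u (row_rcons y t) * (a y * psi t)).
  have [p0|p0] := eqVneq (psi t) 0.
    by rewrite p0 mulr0 /Rintegral integral0_eq// => y _; rewrite !mulr0.
  have ia : mu.-integrable setT (EFin \o (fun y => u (row_rcons y t) * a y)).
    have := integrableZl measurableT (psi t)^-1 it; apply: eq_integrable => // y _ /=.
    by rewrite -EFinM; congr EFin; field.
  rewrite mulrC -(RintegralZl _ measurableT ia); apply: eq_Rintegral => y _; ring.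
by rewrite /Rintegral fineK//; exact: integrable_fin_num.
Qed.

Lemma C1c1_out (D : set R) (th : R -> R) (t : R) : C1c1 D th -> ~ D t -> th t = 0 /\ th^`()%classic t = 0.
Proof.
move=> [_ _ _ sD] Dt; have st : (~` tsupport th) t by move=> /sD.
have oS : open (~` tsupport th) by apply: closed_openC; exact: closed_closure.
have th0 : \forall s \near t, th s = 0.
  have := open_nbhs_nbhs (conj oS st); apply: filterS => s ss.
  by apply/eqP/negPn/negP => h; apply: ss; exact: subset_closure.
split; first exact: (nbhs_singleton th0).
have := @near_eq_derive _ _ _ th (cst 0) t 1; rewrite derive_cst.
by rewrite derive1E => <-//; exact: oner_neq0.
Qed.

Lemma C1c1_widen (D : set R) (th : R -> R) : C1c1 D th -> C1c1 setT th.
Proof. by move=> [h1 h2 h3 _]. Qed.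

(** Testing the weak gradient with products a * th shows that the weak derivative of the average is
    the average of the last component of the gradient. *)
Lemma slice_mean_W11loc1 u (G : 'rV[R]_n.+1 -> 'rV[R]_n.+1) a (D : set R) :
  L1loc u -> is_weak_gradient u G -> C1c a -> open D -> W11loc1 D (slice_mean u a).
Proof.
move=> lu [lG hG] ca oD; have cb := C1c_cbfunV ca.
split; first exact: slice_mean_locally_integrable.
exists (slice_mean (fun x => G x ord0 ord_max) a); split; first exact: slice_mean_locally_integrable.
move=> th cth; have cT := C1c1_widen cth; have [c1 c2] := C1c1_cbfun cT.
have out (b h : R -> R) : (forall t, ~ D t -> h t = 0) ->
    (\int[lam]_(t in D) (b t * h t)%:E = \int[lam]_t (b t * h t)%:E)%E.
  move=> h0; rewrite integral_mkcond; apply: eq_integral => t _; rewrite patchE.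
  by case: ifPn => // /negP tD; rewrite h0 ?mulr0// => Dt; apply: tD; exact: mem_set.
rewrite !out; try by move=> t /(C1c1_out cth) [].
rewrite -(slice_mean_fubini lu cb c2) -(slice_mean_fubini (lG ord_max) cb c1).
rewrite -hG; last exact: tensor_C1c.
by apply: eq_integral => x _; rewrite partial_tensor_max.
Qed.

End slice_mean.

(** * Charged heights *)

Section exhaustion.
Context {R : realType} {n : nat}.
Implicit Types (y : 'rV[R]_n) (a b : 'rV[R]_n -> R) (t : R).
Local Notation mu := (@leb R n).

Lemma C1c_frame a : C1c a -> exists (N : nat) (A : R), forall N1 A1, (N <= N1)%N -> A <= A1 ->
  [/\ forall y, `|a y| <= A1, forall (j : 'I_n) y, `|partial j a y| <= A1 &
      forall y, ~ cbox N1%:R y -> a y = 0 /\ forall j : 'I_n, partial j a y = 0].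
Proof.
move=> ca; have [_ cp cs] := ca; have [N hN] := compact_sub_cbox cs.
have [M hM] := cc_bounded (C1c_continuous ca) cs (@C1c_neq0 _ _ a).
have /choice[L hL] (j : 'I_n) : exists L, forall y, `|partial j a y| <= L.
  by apply: (cc_bounded (cp j) cs); exact: partial_neq0.
have L0 j : 0 <= L j by apply: le_trans (hL j 0).
have M0 : 0 <= M by apply: le_trans (hM 0).
exists N, (M + \sum_j L j) => N1 A1 NN1 AA1; split.
- by move=> y; apply: le_trans (hM y) (le_trans _ AA1); rewrite lerDl sumr_ge0.
- move=> j y; apply: le_trans (hL j y) (le_trans _ AA1).
  by rewrite (bigD1 j)//= addrCA lerDl addr_ge0// sumr_ge0.
have out y : ~ cbox N1%:R y -> ~ tsupport a y.
  move=> h /hN k; apply: h => i; have := k i; rewrite !in_itv/= -!ler_norml => h.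
  by apply: le_trans h _; rewrite ler_nat.
move=> y /out h; split; first by apply/eqP/negPn/negP => /C1c_neq0.
by move=> j; apply/eqP/negPn/negP => /partial_neq0.
Qed.

(** Cutoffs that exhaust the space: each test function is dominated by a fixed multiple of all but finitely many. *)
Definition window (i : nat) : 'rV[R]_n -> R := cutoff 1 i%:R 0.

Lemma window_C1c i : C1c (window i). Proof. exact: cutoff_C1c. Qed.

Lemma window_ge0 i y : 0 <= window i y. Proof. exact: cutoff_ge0. Qed.

Lemma window_dominates a : C1c a -> exists (C : R) (N : nat), 0 < C /\
  forall i, (N <= i)%N -> forall y, `|a y| <= C * window i y.
Proof.
move=> ca; have [_ _ cs] := ca.
have [M hM] := cc_bounded (C1c_continuous ca) cs (@C1c_neq0 _ _ a).
have M0 : 0 <= M by apply: le_trans (hM 0).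
have cq : continuous (sqd (0 : 'rV[R]_n)) by exact: continuous_sqd.
have [L [_ hL]] : bounded_set (sqd (0 : 'rV[R]_n) @` tsupport a).
  by apply: compact_bounded; apply: continuous_compact => //; exact: continuous_subspaceT.
exists (M + 1), (Num.truncn (`|L| + 1)).+1; split; first by rewrite ltr_wpDl.
move=> i iN y; have [->|/C1c_neq0 sy] := eqVneq (a y) 0.
  by rewrite normr0 mulr_ge0// ?window_ge0// addr_ge0.
rewrite /window cutoff_eq1// ?mulr1; first by apply: le_trans (hM y) _; rewrite lerDl.
apply: (@le_trans _ _ (`|L| + 1)); last first.
  by apply/ltW/(lt_le_trans (truncnS_gt _)); rewrite ler_nat.
apply: le_trans (ler_norm _) (hL (`|L| + 1) _ _ _); last by exists y.
by rewrite ltr_pwDr// ler_norm.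
Qed.

End exhaustion.

Section components.
Context {R : realType} {n : nat}.
Implicit Types (y : 'rV[R]_n) (a b : 'rV[R]_n -> R) (t : R).
Local Notation lam := (@lebesgue_measure R).
Local Notation mu := (@leb R n).
Local Notation nu := (@leb R n.+1).
Variables (f g : 'rV[R]_n.+1 -> R).
Hypothesis reg : regular_pair f g.
Hypothesis hm : halfspace_minimal f.
Local Notation P i := (slice_mean f (window i)).

Let f0 x : 0 <= f x. Proof. by case: reg. Qed.
Let lf : L1loc f. Proof. by apply: integrable_L1loc; case: reg. Qed.
Let lg : L1loc g. Proof. by case: reg. Qed.

Lemma L1loc_slice t : L1loc (fun y => f (row_rcons y t)).
Proof.
apply: L1loc_cbox => [|N1]; first exact: measurable_slice_last lf.1.
have [N N0 tN] := big_nat_above `|t|.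
apply: (box_integrable N1 reg (N := N) (C := 1)); first exact: measurable_slice_last lf.1.
by move=> y; rewrite mul1r; apply: (fline_bdom reg).
Qed.

Lemma slice_integrable a t : C1c a -> mu.-integrable setT (EFin \o (fun y => f (row_rcons y t) * a y)).
Proof. by move=> ca; apply: L1loc_integrable_C1c ca; exact: L1loc_slice. Qed.

Lemma slice_mean_box a N1 t : (forall y, ~ cbox N1%:R y -> a y = 0) -> slice_mean f a t = mean f N1 a t.
Proof.
move=> h; rewrite /mean /slice_mean [RHS]Rintegral_mkcond; apply: eq_Rintegral => y _.
rewrite patchE mulrC; case: ifPn => // /negP yN; rewrite h ?mul0r// => yB; apply: yN.
exact: mem_set.
Qed.

Lemma continuous_slice_mean a : C1c a -> continuous (slice_mean f a).
Proof.
move=> ca; have [N [A hA]] := C1c_frame ca; have [aA _ aS] := hA N A (leqnn _) (lexx _).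
rewrite (_ : slice_mean f a = mean f N a); last first.
  by apply/funext => t; apply: slice_mean_box => y /aS[].
apply: (mean_continuous reg _ aA).
exact: continuous_measurable_rV (C1c_continuous ca).
Qed.

Lemma slice_mean_ratio a b t0 t1 : C1c a -> C1c b -> t0 <= t1 ->
  (forall t, t0 <= t <= t1 -> 0 < slice_mean f b t) -> slice_mean f a t1 * slice_mean f b t0 = slice_mean f a t0 * slice_mean f b t1.
Proof.
move=> ca cb t01 hb.
have [Na [Aa ha]] := C1c_frame ca; have [Nb [Ab hb']] := C1c_frame cb.
have [A1 A2] : Aa <= Num.max Aa Ab /\ Ab <= Num.max Aa Ab by rewrite !le_max !lexx orbT.
have [aA gaA aS] := ha (maxn Na Nb) (Num.max Aa Ab) (leq_maxl _ _) A1.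
have [bA gbA bS] := hb' (maxn Na Nb) (Num.max Aa Ab) (leq_maxr _ _) A2.
have aE t : slice_mean f a t = mean f (maxn Na Nb) a t by apply: slice_mean_box => y /aS[].
have bE t : slice_mean f b t = mean f (maxn Na Nb) b t by apply: slice_mean_box => y /bS[].
have b0 t : t0 <= t <= t1 -> mean f (maxn Na Nb) b t != 0.
  by move=> /hb; rewrite bE => /lt0r_neq0.
have hb1 t : t0 <= t <= t1 -> 0 < mean f (maxn Na Nb) b t by rewrite -bE; exact: hb.
have := ratio_const reg hm ca cb aA bA aS bS gaA gbA t01 hb1.
rewrite /mean_ratio => /eqP; rewrite eqr_div ?b0 ?lexx ?t01// -!aE -!bE => /eqP.
by [].
Qed.

Lemma slice_mean_dominated a b (C : R) t : C1c a -> C1c b -> (forall y, `|a y| <= C * b y) ->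
  `|slice_mean f a t| <= C * slice_mean f b t.
Proof.
move=> ca cb ab; have ia := slice_integrable t ca; have ib := slice_integrable t cb.
apply: le_trans (le_normr_Rintegral _ ia) _ => //.
rewrite -(RintegralZl C measurableT ib); apply: le_Rintegral => //.
- by have := integrable_abse ia.
- by have := integrableZl measurableT C ib; apply: eq_integrable.
by move=> y _; rewrite normrM (ger0_norm (f0 _)) mulrCA ler_wpM2l.
Qed.

Lemma mean_window_ge0 i t : 0 <= P i t.
Proof. by apply: Rintegral_ge0 => y _; rewrite mulr_ge0// window_ge0. Qed.

(** The heights at which f does not vanish almost everywhere; the windows suffice to detect them. *)
Definition charged : set R := \bigcup_i [set t | 0 < P i t].

Lemma charged_open : open charged.
Proof.
apply: bigcup_open => i _.
rewrite (_ : [set t | _] = P i @^-1` [set s | 0 < s]) //.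
apply: (continuousP (P i)).1; first exact: (continuous_slice_mean (window_C1c i)).
exact: open_gt.
Qed.

Lemma uncharged_slice t : ~ charged t -> {ae mu, forall y, f (row_rcons y t) = 0}.
Proof.
move=> ct; apply: C1c_separates; first exact: L1loc_slice.
move=> a ca; have ia := slice_integrable t ca.
have [C [N [C0 hC]]] := window_dominates ca.
have := slice_mean_dominated t ca (window_C1c N) (hC N (leqnn N)).
have -> : P N t = 0.
  apply/eqP; rewrite eq_le mean_window_ge0 andbT leNgt; apply/negP => h.
  by apply: ct; exists N.
rewrite mulr0 normr_le0 /slice_mean /Rintegral => /eqP h.
rewrite -[LHS]fineK; first by rewrite h.
exact: integrable_fin_num.
Qed.

(** By compactness a single window j charges all the heights between s and t, and the ratio of the
    averages over the windows i and j is constant there. *)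
Lemma charged_window i s t : 0 < P i s -> (forall r, Num.min s t <= r <= Num.max s t -> charged r) ->
  0 < P i t.
Proof.
move=> Ps hc.
have common r0 r1 : r0 <= r1 -> (forall r, r0 <= r <= r1 -> charged r) ->
    exists j, forall r, r0 <= r <= r1 -> 0 < P j r.
  move=> r01 h; have /compact_near_coveringP := @segment_compact R r0 r1.
  move=> /(_ nat \oo (fun j r => 0 < P j r)) [].
    move=> r; rewrite /= in_itv /= => /h [j0 _ /= Pj0].
    have [C [N [C0 hC]]] := window_dominates (@window_C1c R n j0).
    exists ([set r' | 0 < P j0 r'], [set j | (N <= j)%N]) => /=.
      split; last by exists N.
      exact: (continuous_slice_mean (window_C1c j0) (open_nbhs_nbhs (conj (@open_gt R 0) Pj0))).
    move=> [r' j] [/= Pr' Nj].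
    have := slice_mean_dominated r' (window_C1c j0) (window_C1c j) (hC j Nj).
    by rewrite (gtr0_norm Pr') -(pmulr_rgt0 _ C0); exact: lt_le_trans.
  by move=> M _ hM; exists M => r rI; apply: (hM M _ r) => //=.
have [st|/ltW ts] := leP s t.
  have [j hj] := common s t st (fun r rI => hc r ltac:(by rewrite (min_idPl st) (max_idPr st))).
  have := slice_mean_ratio (window_C1c i) (window_C1c j) st hj.
  have Pjs : 0 < P j s by apply: hj; rewrite lexx.
  have Pjt : 0 < P j t by apply: hj; rewrite lexx andbT.
  by rewrite -(pmulr_lgt0 _ Pjs) => ->; rewrite mulr_gt0.
have [j hj] := common t s ts (fun r rI => hc r ltac:(by rewrite (min_idPr ts) (max_idPl ts))).
have := slice_mean_ratio (window_C1c i) (window_C1c j) ts hj.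
have Pjs : 0 < P j s by apply: hj; rewrite lexx andbT.
have Pjt : 0 < P j t by apply: hj; rewrite lexx.
by rewrite -(pmulr_lgt0 _ Pjs) => <-; rewrite mulr_gt0.
Qed.

Lemma window_propagates i (D : set R) s t : is_interval D -> D `<=` charged -> D s -> D t ->
  0 < P i s -> 0 < P i t.
Proof.
move=> iD Dc Ds Dt Ps; apply: (charged_window Ps) => r rI; apply: Dc.
have [st|/ltW ts] := leP s t; move: rI.
  by rewrite (min_idPl st) (max_idPr st); exact: iD.
by rewrite (min_idPr ts) (max_idPl ts); exact: iD.
Qed.

(** Both sides have the same average against every test function, by [slice_mean_ratio]. *)
Lemma slices_proportional i (D : set R) s t : is_interval D -> D `<=` charged -> D s -> D t ->
  0 < P i s -> {ae mu, forall y, f (row_rcons y t) * P i s = f (row_rcons y s) * P i t}.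
Proof.
move=> iD Dc Ds Dt Ps.
have hP r : D r -> 0 < P i r by move=> Dr; exact: window_propagates iD Dc Ds Dr Ps.
have prop a : C1c a -> slice_mean f a t * P i s = slice_mean f a s * P i t.
  move=> ca; have [st|/ltW ts] := leP s t.
    apply: (slice_mean_ratio ca (window_C1c i) st) => r rI; apply: hP; exact: iD Ds Dt _ rI.
  apply/esym; apply: (slice_mean_ratio ca (window_C1c i) ts) => r rI; apply: hP; exact: iD Dt Ds _ rI.
have lt := L1loc_slice t; have ls := L1loc_slice s.
have lZ (k : R) r : L1loc (fun y => k * f (row_rcons y r)).
  have [m h] := L1loc_slice r; split; first exact: measurable_funM.
  move=> K cK; have mK := compact_measurable_rV cK; have := integrableZl mK k (h K cK).
  by apply: eq_integrable.
have := C1c_separates (L1loc_sub (lZ (P i s) t) (lZ (P i t) s)).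
move=> /(_ _) h; apply: filterS (h _); first by move=> y /eqP; rewrite subr_eq0 mulrC (mulrC (P i t)) => /eqP.
move=> a ca.
have it := slice_integrable t ca; have is_ := slice_integrable s ca.
have iZt := integrableZl measurableT (P i s) it; have iZs := integrableZl measurableT (P i t) is_.
have iB := integrableB measurableT iZt iZs.
have E : \int[mu]_y ((P i s * f (row_rcons y t) - P i t * f (row_rcons y s)) * a y) = 0.
  transitivity (\int[mu]_y (P i s * (f (row_rcons y t) * a y) - P i t * (f (row_rcons y s) * a y))).
    by apply: eq_Rintegral => y _; ring.
  rewrite (RintegralB measurableT iZt iZs) (RintegralZl _ measurableT it) (RintegralZl _ measurableT is_).
  by rewrite -/(slice_mean f a t) -/(slice_mean f a s) mulrC prop// mulrC subrr.
rewrite -[LHS]fineK; first by rewrite -[fine _]/(Rintegral _ _ _) E.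
apply: integrable_fin_num => //; move: iB; apply: eq_integrable => // y _ /=.
by rewrite -EFinB; congr EFin; ring.
Qed.

End components.

Section lines.
Context {R : realType} d (T : measurableType d) (m : {measure set T -> \bar R}).

(** One point of C is taken in each interval with rational ends that meets C. *)
Lemma dense_sequence (C : set R) : exists r : nat -> R,
  forall t e, C t -> 0 < e -> exists2 k, C (r k) & `|t - r k| < e.
Proof.
pose pts (pq : rat * rat) : set R := C `&` `]ratr pq.1, ratr pq.2[%classic.
exists (fun k => xget 0 (pts (odflt (0, 0) (unpickle k)))) => t e Ct e0.
have [p /andP[p1 p2]] : exists p : rat, t - e < ratr p < t.
  have /rat_in_itvoo[p] : t - e < t by rewrite gtrBl.
  by rewrite in_itv /=; exists p.
have [q /andP[q1 q2]] : exists q : rat, t < ratr q < t + e.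
  have /rat_in_itvoo[q] : t < t + e by rewrite ltrDl.
  by rewrite in_itv /=; exists q.
have h : pts (p, q) t by split => //=; rewrite in_itv /= p2.
exists (pickle (p, q)); rewrite pickleK /=; have [h1 h2] := xgetPex 0 (ex_intro _ t h) => //.
move: h2; rewrite /= in_itv /= => /andP[h2 h3]; rewrite ltr_norml; apply/andP; split; lra.
Qed.

(** A relation that is continuous in the height may be checked on a countable dense set of heights,
    which lets one null set of lines serve all heights at once. *)
Lemma ae_all_heights (C : set R) (u : T -> R -> R) : (forall x, continuous (u x)) ->
  (forall t, C t -> {ae m, forall x, u x t = 0}) -> {ae m, forall x, forall t, C t -> u x t = 0}.
Proof.
move=> cu h; have [r hr] := dense_sequence C.
have : {ae m, forall x, forall k, C (r k) -> u x (r k) = 0}.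
  apply: ae_forall_countable => k; have [Cr|Cr] := pselect (C (r k)); last exact: aeW.
  by apply: filterS (h _ Cr).
apply: filterS => x hx t Ct; apply/eqP/negPn/negP => ux.
have u0 : 0 < `|u x t| by rewrite normr_gt0.
have := (@cvgrPdist_lt _ R _ (nbhs t) _ _ _).1 (cu x t) _ u0.
move=> [e /= e0 he]; have [k Ck tk] := hr t e Ct e0.
by have := he _ tk; rewrite hx// subr0 ltxx.
Qed.

End lines.

(** * Structure of the weight *)

Section weight.
Context {R : realType} {n : nat}.
Local Notation mu := (@leb R n).

Lemma ae_hausdorff m (Q : 'rV[R]_m -> Prop) : {ae leb m, forall x, Q x} -> hausdorff_ae m Q.
Proof. exact: negligible_hausdorff. Qed.

Lemma ae_cylinder (Q : 'rV[R]_n -> Prop) : {ae mu, forall y, Q y} ->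
  {ae leb n.+1, forall x, Q (row_init x)}.
Proof. exact: leb_negligible_cylinder. Qed.

Lemma ae_line_structure (f g : 'rV[R]_n.+1 -> R) (I : nat -> set R) (q : nat -> R) (i : nat -> nat) :
  regular_pair f g -> halfspace_minimal f -> (forall k, is_interval (I k)) ->
  charged f = \bigcup_k I k ->
  (forall k, I k !=set0 -> I k (q k) /\ 0 < slice_mean f (window (i k)) (q k)) ->
  {ae mu, forall y, (forall t, ~ charged f t -> f (row_rcons y t) = 0) /\
    forall k t, I k t -> f (row_rcons y t) * slice_mean f (window (i k)) (q k) =
      f (row_rcons y (q k)) * slice_mean f (window (i k)) t}.
Proof.
move=> reg hm iI cI hq.
have cf y : continuous (fun t => f (row_rcons y t)) by case: reg => _ _ _ /(_ y); exact: acl_continuous.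
have h1 : {ae mu, forall y, forall t, (~` charged f) t -> f (row_rcons y t) = 0}.
  by apply: (ae_all_heights cf) => t ct; exact: uncharged_slice reg _ ct.
have h2 : {ae mu, forall y, forall k t, I k t -> f (row_rcons y t) * slice_mean f (window (i k)) (q k) -
    f (row_rcons y (q k)) * slice_mean f (window (i k)) t = 0}.
  apply: ae_forall_countable => k; apply: ae_all_heights => [y|t It].
    move=> t; apply: (@continuousB _ _ _ (fun t => f (row_rcons y t) * slice_mean f (window (i k)) (q k))
      (fun t => f (row_rcons y (q k)) * slice_mean f (window (i k)) t)).
      by apply: (@continuousM _ _ (fun t => f (row_rcons y t)) (cst _)); [exact: cf|exact: cst_continuous].
    apply: (@continuousM _ _ (cst _) (slice_mean f (window (i k)))); first exact: cst_continuous.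
    exact: (continuous_slice_mean reg (window_C1c _)).
  have [Iq Pq] := hq k (ex_intro _ t It).
  have Ic : I k `<=` charged f by rewrite cI; exact: bigcup_sup.
  apply: filterS (slices_proportional reg hm (iI k) Ic Iq It Pq) => y ->; exact: subrr.
apply: filterS2 h1 h2 => y h1 h2; split; first exact: h1.
by move=> k t It; apply/eqP; rewrite -subr_eq0 h2.
Qed.

End weight.

Theorem lemma4p1 (R : realType) (n : nat) (f : 'rV[R]_n.+1 -> R)
  (hf : weight f)
  (hmin : forall c : R, Per_minimal f (halfspace c)
     [set F | lebesgue_measurable F /\ wmeasure f F = wmeasure f (halfspace c)]) :
  exists I : nat -> set R,
    [/\ forall j, open (I j) /\ is_interval (I j),
        trivIset setT I,
        hausdorff_ae n (fun x' : 'rV[R]_n => exists A : set nat,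
          [set t | 0 < f (row_rcons x' t)] = \bigcup_(j in A) I j) &
        forall k, exists (A : 'rV[R]_n -> R) (B : R -> R),
          hausdorff_ae n.+1 (fun x : 'rV[R]_n.+1 =>
            I k (row_last x) -> f x = A (row_init x) * B (row_last x)) /\
          [/\ W11loc1 (I k) B,
              {in I k, continuous B} &
              forall t, I k t -> 0 < B t]].
Proof.
have [f0 [g0 [reg hG aeN aeM]]] := weight_regular hf.
have [fge fi [lf _] _] := hf.
have hm := weight_halfspace_minimal hmin lf.1 reg hG aeN (fun i => (hG.1 i).1).
have oU := charged_open reg; have UE := open_disjoint_itv_bigcup oU.
set I := open_disjoint_itv oU in UE; exists I.
have iI k : is_interval (I k) by exact: open_disjoint_itv_is_interval.
have oI k : open (I k) by exact: open_disjoint_itv_open.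
have IU k : I k `<=` charged f0 by rewrite UE; exact: bigcup_sup.
have /choice[p hp] (k : nat) : exists p : R * nat, I k !=set0 ->
    I k p.1 /\ 0 < slice_mean f0 (window p.2) p.1.
  have [[q Iq]|ne] := pselect (I k !=set0); last by exists (0, 0%N).
  by have [i _ Pi] := IU k q Iq; exists (q, i).
pose B k : R -> R := slice_mean f0 (window (p k).2).
have Bpos k t : I k t -> 0 < B k t.
  move=> It; have [Iq Pq] := hp k (ex_intro _ t It).
  have H := @window_propagates R n f0 g0 reg hm (p k).2 (I k) (p k).1 t (iI k) (IU k) Iq It.
  exact: (H Pq).
have lines := ae_line_structure reg hm iI UE hp.
split => //; first exact: open_disjoint_itv_trivIset.
  apply: ae_hausdorff; apply: filterS2 aeM lines => y fE [out inn].
  exists [set k | I k !=set0 /\ 0 < f0 (row_rcons y (p k).1)].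
  apply/seteqP; split => [t /=|t [k [ne fq] It] /=]; rewrite -fE.
    move=> ft; have [k _ It] : (\bigcup_k I k) t.
      by rewrite -UE; apply: contrapT => /out ft0; rewrite ft0 ltxx in ft.
    exists k => //; have [Iq Pq] := hp k (ex_intro _ t It); split; first by exists t.
    by rewrite -(pmulr_lgt0 _ (Bpos k t It)) -inn// mulr_gt0.
  have [Iq Pq] := hp k ne.
  by rewrite -(pmulr_lgt0 _ Pq) inn// mulr_gt0// Bpos.
move=> k; exists (fun y => f0 (row_rcons y (p k).1) / B k (p k).1), (B k); split; last split.
- apply: ae_hausdorff; apply: filterS2 (ae_cylinder aeM) (ae_cylinder lines) => x fE [_ inn] It.
  have [Iq Pq] := hp k (ex_intro _ _ It).
  rewrite -{1}[x]row_rconsK -fE; apply: (mulIf (lt0r_neq0 Pq)); rewrite inn//.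
  by rewrite mulrAC mulfVK// lt0r_neq0.
- apply: slice_mean_W11loc1 hG (window_C1c _) (oI k); exact: integrable_L1loc (let: And4 _ h _ _ := reg in h).
- move=> t _; have H := @continuous_slice_mean R n f0 g0 reg _ (window_C1c (p k).2).
  exact: H.
exact: Bpos.
Qed.
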